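(* Let $\mathfrak{M}$ be an R-regular weight matrix of R-moderate growth such that there exists $M\in\mathfrak{M}$ with $\sum_{k\ge1}1/\mu_k<\infty$, where $\mu_k=M_k/M_{k-1}$. Then for every $d\ge1$ the ring ${}_d\mathcal{E}^{\{\mathfrak{M}\}}$ has property $(\mathscr{D})$.
   Context: A weight sequence is a sequence $M=(M_k)_{k\ge0}$ of positive reals with $M_k=\mu_1\cdots\mu_k$, $M_0=1$, where $(\mu_k)$ is positive and increasing with $\mu_0=1$, and $M_k^{1/k}\to\infty$; lowercase $m_k:=M_k/k!$ (similarly $n_k=N_k/k!$). For a positive sequence $m$ with $m_0=1$, $m_k^{1/k}\to\infty$, $m_{k+1}/m_k\to\infty$, set $h_m(t):=\inf_k m_kt^k$ ($t>0$), $\overline\Gamma_m(t):=\min\{k:h_m(t)=m_kt^k\}$, $\underline\Gamma_m(t):=\min\{k:m_{k+1}/m_k\ge1/t\}$. A weight matrix $\mathfrak{M}$ is a family of weight sequences totally ordered by the pointwise order. $\mathfrak{M}$ is R-regular if $m_k^{1/k}\to\infty$ for all $M\in\mathfrak{M}$, $\forall M\in\mathfrak{M}\ \exists N\in\mathfrak{M}\ \exists C\ge1\ \forall j: M_{j+1}\le C^{j+1}N_j$, and $\forall M\ \exists N\ \exists C\ge1\ \forall t>0: \overline\Gamma_n(Ct)\le\underline\Gamma_m(t)$. With $\mathrm{mg}(M,N):=\sup_{j,k\ge0,j+k\ge1}(M_{j+k}/(N_jN_k))^{1/(j+k)}$, $\mathfrak{M}$ has R-moderate growth if $\forall M\in\mathfrak{M}\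 \exists N\in\mathfrak{M}:\mathrm{mg}(M,N)<\infty$. For open $U\subseteq\mathbb{R}^d$ and $\sigma>0$, $\mathcal{B}^M_\sigma(U)$ is the set of $f\in C^\infty(U)$ with $\sup_{x\in U,\alpha}|\partial^\alpha f(x)|/(\sigma^{|\alpha|}M_{|\alpha|})<\infty$; $\mathcal{B}^{\{\mathfrak{M}\}}(U):=\bigcup_{M\in\mathfrak{M}}\bigcup_{\sigma>0}\mathcal{B}^M_\sigma(U)$, and $\mathcal{E}^{\{\mathfrak{M}\}}(U)$ is the set of $f:U\to\mathbb{C}$ with $f|_V\in\mathcal{B}^{\{\mathfrak{M}\}}(V)$ for every relatively compact open $V\subseteq U$. ${}_d\mathcal{E}^{\{\mathfrak{M}\}}$ is the ring of germs at $0\in\mathbb{R}^d$ of such functions. A subring $\mathcal{S}$ of the ring of germs at $0\in\mathbb{R}^d$ of complex valued $C^\infty$ functions has property $(\mathscr{D})$ if for every complex valued function germ $f$ at $0$: if $f^j,f^{j+1}\in\mathcal{S}$ for some integer $j\ge1$, then $f\in\mathcal{S}$. *)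

(* Defs.v *)
From HB Require Import structures.
From mathcomp Require Import all_boot all_order all_algebra.
From mathcomp Require Import all_classical all_reals all_analysis.
From mathcomp Require Import complex.
Set Implicit Arguments. Unset Strict Implicit. Unset Printing Implicit Defensive.
Import Order.TTheory GRing.Theory Num.Theory.
Import numFieldNormedType.Exports.
Local Open Scope classical_set_scope.
Local Open Scope ring_scope.

Section Defs.
Variable R : realType.

Definition mu (M : nat -> R) (k : nat) : R :=
  if k is k'.+1 then M k'.+1 / M k' else 1.

Definition weight_seq (M : nat -> R) : Prop :=
  M 0%N = 1 /\ (forall k, 0 < M k) /\
  (forall k, mu M k <= mu M k.+1) /\
  ((fun k : nat => M k `^ (k%:R)^-1) @ \oo --> +oo).

Definition lower (M : nat -> R) (k : nat) : R := M k / (k`!)%:R.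

Definition nat_min (P : nat -> Prop) : nat :=
  xget 0%N [set k | P k /\ forall j, P j -> (k <= j)%N].

Definition h_fun (m : nat -> R) (t : R) : R := inf (range (fun k => m k * t ^+ k)).

Definition Gamma_up (m : nat -> R) (t : R) : nat :=
  nat_min (fun k => h_fun m t = m k * t ^+ k).

Definition Gamma_low (m : nat -> R) (t : R) : nat :=
  nat_min (fun k => t^-1 <= m k.+1 / m k).

Definition weight_matrix (WM : set (nat -> R)) : Prop :=
  (forall M, WM M -> weight_seq M) /\
  (forall M N, WM M -> WM N ->
     (forall k, M k <= N k) \/ (forall k, N k <= M k)).

Definition R_regular (WM : set (nat -> R)) : Prop :=
  (forall M, WM M -> (fun k : nat => lower M k `^ (k%:R)^-1) @ \oo --> +oo) /\
  (forall M, WM M -> exists N, WM N /\ exists C : R, 1 <= C /\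
     forall j, M j.+1 <= C ^+ j.+1 * N j) /\
  (forall M, WM M -> exists N, WM N /\ exists C : R, 1 <= C /\
     forall t : R, 0 < t -> (Gamma_up (lower N) (C * t) <= Gamma_low (lower M) t)%N).

Definition mg (M N : nat -> R) : \bar R :=
  ereal_sup [set x | exists j k : nat, (0 < j + k)%N /\
     x = ((M (j + k)%N / (N j * N k)) `^ ((j + k)%N%:R)^-1)%:E].

Definition R_moderate_growth (WM : set (nat -> R)) : Prop :=
  forall M, WM M -> exists N, WM N /\ (mg M N < +oo)%E.

Variable d : nat.
Local Notation pt := 'rV[R]_d.

Definition ebase (i : 'I_d) : pt := delta_mx 0 i.

Definition Dseq (s : seq 'I_d) (g : pt -> R) : pt -> R :=
  foldr (fun i h => fun x => 'D_(ebase i) h x) g s.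

Definition mindex_seq (alpha : 'I_d -> nat) : seq 'I_d :=
  flatten [seq nseq (alpha i) i | i <- enum 'I_d].

Definition mabs (alpha : 'I_d -> nat) : nat := (\sum_(i < d) alpha i)%N.

Definition smooth_on_R (V : set pt) (g : pt -> R) : Prop :=
  forall (s : seq 'I_d) (x : pt), V x ->
    (forall i, derivable (Dseq s g) x (ebase i)) /\ {for x, continuous (Dseq s g)}.

Definition ReF (f : pt -> R[i]) : pt -> R := fun x => complex.Re (f x).
Definition ImF (f : pt -> R[i]) : pt -> R := fun x => complex.Im (f x).

Definition smooth_on (V : set pt) (f : pt -> R[i]) : Prop :=
  smooth_on_R V (ReF f) /\ smooth_on_R V (ImF f).

Definition pderiv (alpha : 'I_d -> nat) (f : pt -> R[i]) (x : pt) : R[i] :=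
  Complex (Dseq (mindex_seq alpha) (ReF f) x) (Dseq (mindex_seq alpha) (ImF f) x).

Definition B_M_sigma (M : nat -> R) (sigma : R) (V : set pt) (f : pt -> R[i]) : Prop :=
  smooth_on V f /\
  exists C : R, forall (x : pt) (alpha : 'I_d -> nat), V x ->
    `|pderiv alpha f x| <= (C * (sigma ^+ mabs alpha * M (mabs alpha)))%:C%C.

Definition B_roum (WM : set (nat -> R)) (V : set pt) (f : pt -> R[i]) : Prop :=
  exists M, WM M /\ exists sigma : R, 0 < sigma /\ B_M_sigma M sigma V f.

Definition rel_compact_in (V U : set pt) : Prop :=
  compact (closure V) /\ closure V `<=` U.

Definition E_roum (WM : set (nat -> R)) (U : set pt) (f : pt -> R[i]) : Prop :=
  forall V : set pt, open V -> V `<=` U -> rel_compact_in V U -> B_roum WM V f.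

Definition germ_E (WM : set (nat -> R)) (f : pt -> R[i]) : Prop :=
  exists U : set pt, open U /\ U 0 /\ E_roum WM U f.

Definition property_D (WM : set (nat -> R)) : Prop :=
  forall (f : pt -> R[i]) (j : nat), (1 <= j)%N ->
    germ_E WM (fun x => f x ^+ j) -> germ_E WM (fun x => f x ^+ j.+1) ->
    germ_E WM f.

End Defs.

(* Main.v *)
(* Fix a point [x] with [f x <> 0] and a real direction [v]. Along the line [x + t v] the
   Taylor series [P] of [f ^ j] and [Q] of [f ^ j.+1] satisfy [P ^ j.+1 = Q ^ j], and that of
   [f] is the quotient [F = Q / P]; the point is to bound its coefficients independently of
   [P 0]. After truncation and rescaling, [P] and [Q] are polynomials bounded by 1 on a disc,
   with [|Q| ^ j <= |P| ^ j.+1 + small], and [F`_k] is the limit, as the radius shrinks, of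
   the average of [Q * conj P * chi (|P|^2) * w ^- k] over circles, where [chi x] is a
   polynomial approximation of [1 / x] with [chi] changing from scale to scale. Between two
   circles of one scale the average moves little, since its radial derivative is controlled by
   the Laplacian of a bounded subharmonic function of [|P|], a regularized [log |P|]; changing
   [chi] at a fixed circle also costs little. The sum over dyadic scales is a geometric series,
   so [|F`_k| <= C ^ l] as soon as the identity holds to order [2 j (j + 1) l] with [k <= l].
   Log-convexity and moderate growth convert this into [|F_k| <= C ^ k N_k / k!], with a
   remainder estimate uniform in [x] and [v]. Points with [f <> 0], together with interior
   points of the zero set, are dense, so by continuity all differences of [f] in a pure
   direction are bounded by powers of the step. By Djokovic's polarization identity so are the
   mixed differences; hence [f] is smooth, and its partial derivatives, read off from the
   coefficients [F_k] in finitely many directions, satisfy the required bounds. *)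

Require Import Defs.
From HB Require Import structures.
From mathcomp Require Import all_boot all_order all_algebra.
From mathcomp Require Import all_classical all_reals all_analysis.
From mathcomp Require Import separable cyclotomic complex polyrcf ring lra zify.
Set Implicit Arguments. Unset Strict Implicit. Unset Printing Implicit Defensive.
Import Order.TTheory GRing.Theory Num.Theory.
Import numFieldNormedType.Exports.
Local Open Scope ring_scope.

(** * Modulus of complex numbers and roots of unity *)

(** Dividing [Q] by [P] directly costs negative powers of [|P 0|], which is arbitrarily small near
    the zero set of [f]; uniform constants must come from circles on which [P] may vanish. There
    [chi] tames the quotient: with [M * eta ^ (2 j) = 1] it acts as [1 / |P|^2] well above the
    cutoff [|P| = eta ^ j], and is at most [M] below it, where [|f|], heuristically [|P| ^ (1 / j)],
    is below [eta]. Apart from [w ^- k], each change of radius or of cutoff thus costs a multiple of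
    [eta], up to a factor [log M]. The choice [eta = (4 s) ^ (2 l)] at radius [s] splits evenly: [l]
    powers of [s] pay for [w ^- k], the other [l] make the sum over scales converge and absorb
    [log M], which is linear in the index of the scale. The truncation error has to stay below
    [(eta ^ j) ^ (j + 1)], whence the order [2 j (j + 1) l]. Averages over circles are finite sums
    over roots of unity, exact for polynomials and polynomial in the squared radius, so radial
    calculus reduces to algebra and the mean value theorem. *)

Section ComplexNorm.
Local Open Scope complex_scope.
Local Notation Re := complex.Re.
Local Notation Im := complex.Im.
Local Notation cj := (@conjc _).
Variable R : realType.
Implicit Types z w : R[i].

(** The norm of [R[i]] takes its values in [R[i]]; [nc] is the same modulus with values in [R],
    where the order is total. *)
Definition nc z : R := ComplexField.Normc.normc z.

Lemma nc_normE z : `|z| = (nc z)%:C.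
Proof. by rewrite normc_def; case: z. Qed.

Lemma nc_ge0 z : 0 <= nc z.
Proof. by case: z => a b; exact: sqrtr_ge0. Qed.

Lemma nc0 : nc 0 = 0. Proof. exact: ComplexField.Normc.normc0. Qed.
Lemma nc1 : nc 1 = 1. Proof. exact: ComplexField.Normc.normc1. Qed.
Lemma nc_eq0 z : (nc z == 0) = (z == 0).
Proof.
apply/eqP/eqP => [|->]; last exact: nc0.
exact: ComplexField.Normc.eq0_normc.
Qed.
Lemma ncM z w : nc (z * w) = nc z * nc w.
Proof. exact: ComplexField.Normc.normcM. Qed.
Lemma ncV z : nc z^-1 = (nc z)^-1.
Proof. exact: ComplexField.Normc.normcV. Qed.
Lemma ncD z w : nc (z + w) <= nc z + nc w.
Proof. exact: (@le_normcD R z w). Qed.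
Lemma ncN z : nc (- z) = nc z.
Proof. exact: (@normcN R z). Qed.
Lemma ncB z w : nc (z - w) <= nc z + nc w.
Proof. by rewrite -(ncN w); exact: ncD. Qed.
Lemma nc_dist z w : nc (z - w) = nc (w - z).
Proof. by rewrite -ncN opprB. Qed.
Lemma ncX z n : nc (z ^+ n) = nc z ^+ n.
Proof. by elim: n => [|n IH]; rewrite ?expr0 ?nc1 // !exprS ncM IH. Qed.
Lemma nc_real (x : R) : nc x%:C = `|x|.
Proof. by rewrite /nc /= expr0n /= addr0 sqrtr_sqr. Qed.
Lemma nc_sum I (r : seq I) (P : pred I) (F : I -> R[i]) :
  nc (\sum_(i <- r | P i) F i) <= \sum_(i <- r | P i) nc (F i).
Proof.
apply: (big_ind2 (fun a b => nc a <= b)) => [|a b c e ab ce|//].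
  by rewrite nc0.
by apply: le_trans (ncD _ _) _; exact: lerD.
Qed.
Lemma nc_conj z : nc (cj z) = nc z.
Proof. by case: z => a b; rewrite /nc /= sqrrN. Qed.
Lemma mulc_conj z : z * cj z = (nc z ^+ 2)%:C.
Proof. by rewrite -sqr_normc nc_normE rmorphXn. Qed.
Lemma conj_real (x : R) : cj x%:C = x%:C.
Proof. exact: conjc_real. Qed.
Lemma conj0 : cj (0 : R[i]) = 0.
Proof. exact: conjc0. Qed.
Lemma conjMn z n : cj (z *+ n) = cj z *+ n.
Proof. exact: (rmorphMn (@conjc R)). Qed.
Lemma conjM z w : cj (z * w) = cj z * cj w.
Proof. exact: (rmorphM (@conjc R)). Qed.
Lemma conjX z n : cj (z ^+ n) = cj z ^+ n.
Proof. exact: (rmorphXn (@conjc R)). Qed.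
Lemma Re_le_nc z : Re z <= nc z.
Proof.
by have := normc_ge_Re z; rewrite nc_normE lecR; apply: le_trans; exact: ler_norm.
Qed.
Lemma cReD z w : Re (z + w) = Re z + Re w. Proof. by case: z w => a b [c d]. Qed.
Lemma cReN z : Re (- z) = - Re z. Proof. by case: z. Qed.
Lemma cReB z w : Re (z - w) = Re z - Re w. Proof. by rewrite cReD cReN. Qed.
Lemma Re_sum I (r : seq I) (P : pred I) (F : I -> R[i]) :
  Re (\sum_(i <- r | P i) F i) = \sum_(i <- r | P i) Re (F i).
Proof. by apply: (big_morph _ cReD). Qed.
Lemma cReZ (x : R) z : Re (x%:C * z) = x * Re z.
Proof. by case: z => a b /=; rewrite mul0r subr0. Qed.
Lemma cReM z (x : R) : Re (z * x%:C) = Re z * x.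
Proof. by rewrite mulrC cReZ mulrC. Qed.
Lemma RealCX (x : R) n : (x ^+ n)%:C = x%:C ^+ n.
Proof. exact: rmorphXn. Qed.
Lemma cImD z w : Im (z + w) = Im z + Im w. Proof. by case: z w => a b [c d]. Qed.
Lemma nc_le_ReIm z : nc z <= `|Re z| + `|Im z|.
Proof.
rewrite {1}[z]complexE; apply: le_trans (ncD _ _) _.
rewrite ncM !nc_real lerD2l.
by rewrite {1}/nc /= expr0n expr1n add0r sqrtr1 mul1r.
Qed.
Lemma normRe_le z : `|Re z| <= nc z.
Proof. by have := normc_ge_Re z; rewrite nc_normE lecR. Qed.
Lemma normIm_le z : `|Im z| <= nc z.
Proof.
have := normRe_le (z * 'i); rewrite ReiNIm normrN ncM.
by rewrite [nc 'i]/nc /= expr0n expr1n add0r sqrtr1 mulr1.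
Qed.

(** Reduces a bound on a modulus to one on a real part, to which the real mean value theorem
    applies. *)
Lemma rotation z : exists2 u : R[i], nc u = 1 & Re (u * z) = nc z.
Proof.
have [->|z0] := eqVneq z 0; first by exists 1; rewrite ?nc1 // mulr0 nc0.
have n0 : nc z != 0 by rewrite nc_eq0.
exists (cj z * (nc z)^-1%:C).
  by rewrite ncM nc_conj nc_real ger0_norm ?invr_ge0 ?nc_ge0 // mulfV.
rewrite mulrAC [cj z * z]mulrC mulc_conj -rmorphM /= expr2 mulfK //.
Qed.

(** [X ^ N - 1] is separable in characteristic 0, so it has [N] distinct roots, and these form a
    cyclic group. They are the sample points of all circle averages. *)
Lemma exists_prim_root N : (0 < N)%N -> exists z : R[i], N.-primitive_root z.
Proof.
move=> N0; pose p : {poly R[i]} := 'X^N - 1.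
have pm : p \is monic by rewrite /p -polyC1 monicXnsubC.
have [rs ers] := closed_field_poly_normal p.
move: ers; rewrite (monicP pm) scale1r => ers.
have sz : size rs = N.
  have : size p = N.+1 by rewrite /p -polyC1 size_XnsubC.
  by rewrite ers size_prod_XsubC => -[].
have urs : uniq rs.
  rewrite -separable_prod_XsubC -ers separable_Xn_sub_1 //.
  by rewrite pnatr_eq0 -lt0n.
have /hasP[z _ zP] : has N.-primitive_root rs.
  apply: cyclic.has_prim_root => //; last by rewrite sz.
  apply/allP => z zr; apply/unity_rootP/eqP.
  have : root p z by rewrite ers root_prod_XsubC.
  by rewrite /p rootE !hornerE subr_eq0.
by exists z.
Qed.

Lemma nc_prim_root N z : (0 < N)%N -> z ^+ N = 1 -> nc z = 1.
Proof.
move=> N0 zN; have : nc z ^+ N = 1 by rewrite -ncX zN nc1.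
by move/eqP; rewrite pexpr_eq1 ?nc_ge0 // => /eqP.
Qed.

Lemma conj_unit z : nc z = 1 -> cj z = z^-1.
Proof.
move=> z1; have z0 : z != 0 by rewrite -nc_eq0 z1 oner_eq0.
by apply: (mulfI z0); rewrite mulc_conj z1 expr1n mulfV.
Qed.

Lemma conj_circleX (x : R) z n : nc z = 1 ->
  cj ((x%:C * z) ^+ n) = x%:C ^+ n / z ^+ n.
Proof.
move=> z1; rewrite (_ : cj (_ ^+ n) = cj (x%:C * z) ^+ n); last exact: rmorphXn.
rewrite (_ : cj (x%:C * z) = x%:C * z^-1) ?exprMn ?exprVn //.
by rewrite -(conj_unit z1) -[in RHS](conj_real x); exact: rmorphM.
Qed.

Lemma sum_root_unity N z a b : N.-primitive_root z -> (a < N)%N -> (b < N)%N ->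
  \sum_(i < N) (z ^+ i) ^+ a / (z ^+ i) ^+ b = (N * (a == b))%:R.
Proof.
move=> zP aN bN; have N0 := prim_order_gt0 zP.
have z0 : z != 0.
  by rewrite -nc_eq0 (nc_prim_root N0 (prim_expr_order zP)) oner_eq0.
pose u := z ^+ a / z ^+ b.
have E (i : 'I_N) : (z ^+ i) ^+ a / (z ^+ i) ^+ b = u ^+ i.
  by rewrite /u expr_div_n -!exprM ![(i * _)%N]mulnC.
under eq_bigr do rewrite E.
have uN : u ^+ N = 1.
  by rewrite /u expr_div_n -!exprM ![(_ * N)%N]mulnC !exprM (prim_expr_order zP)
     !expr1n divr1.
have [ab|ab] := eqVneq a b.
  have -> : u = 1 by rewrite /u ab divff // expf_neq0.
  under eq_bigr do rewrite expr1n.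
  by rewrite sumr_const card_ord muln1.
rewrite muln0; have u1 : u - 1 != 0.
  rewrite subr_eq0; apply: contra ab => /eqP u1.
  have /eqP : z ^+ a = z ^+ b.
    by rewrite -[RHS]mul1r -u1 /u divfK // expf_neq0.
  by rewrite (eq_prim_root_expr zP) !modn_small.
by apply: (mulfI u1); rewrite -subrX1 uN subrr mulr0.
Qed.

End ComplexNorm.

(** * Means over circles *)

Section CircleMean.
Local Open Scope complex_scope.
Local Notation Re := complex.Re.
Local Notation cj := (@conjc _).
Variable R : realType.
Local Notation C := R[i].
Implicit Types (U V P Q : {poly C}) (phi : {poly R}) (k : nat).

(* As a polynomial in [r], the average of [U w * cj (V w) / w ^+ k] over [|w|^2 = r]. *)
Definition cmean k U V : {poly C} := \poly_(b < size V) (U`_(b + k) * cj V`_b).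

Lemma cmeanE k U V b : (cmean k U V)`_b = U`_(b + k) * cj V`_b.
Proof.
by rewrite coef_poly; case: ltnP => // bV; rewrite [V`_b]nth_default // rmorph0 mulr0.
Qed.

(** Orthogonality of the roots of unity: the exponents [a] and [b + k] lie below [N], so congruence
    modulo [N] is equality and only [a = b + k] survives. What remains is [rho ^ (2 b + k)], that is
    [rho ^ k] times a power of [rho ^ 2]; hence the factor [rho ^ k] outside the mean. *)
Lemma cmean_avg k U V N (z : C) (rho : R) :
  N.-primitive_root z -> (size U <= N)%N -> (size V + k <= N)%N ->
  (cmean k U V).[(rho ^+ 2)%:C] * rho%:C ^+ k =
  N%:R^-1 * \sum_(i < N) U.[rho%:C * z ^+ i] * cj V.[rho%:C * z ^+ i] / (z ^+ i) ^+ k.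
Proof.
move=> zP sU sV; have N0 := prim_order_gt0 zP.
have NC : (N%:R : C) != 0 by rewrite pnatr_eq0 -lt0n.
have zi (i : 'I_N) : nc (z ^+ i) = 1.
  by rewrite ncX (nc_prim_root N0 (prim_expr_order zP)) expr1n.
apply: (mulfI NC); rewrite [RHS]mulrA (mulfV NC) mul1r.
have E (i : 'I_N) : U.[rho%:C * z ^+ i] * cj V.[rho%:C * z ^+ i] / (z ^+ i) ^+ k =
  \sum_(b < size V) \sum_(a < size U)
     (U`_a * cj V`_b * rho%:C ^+ (a + b)) * ((z ^+ i) ^+ a / (z ^+ i) ^+ (b + k)).
  rewrite !horner_coef rmorph_sum /= mulr_sumr mulr_suml; apply: eq_bigr => b _.
  rewrite !mulr_suml; apply: eq_bigr => a _.
  rewrite [cj (_ * _)](_ : _ = cj V`_b * cj ((rho%:C * z ^+ i) ^+ b)); last exact: rmorphM.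
  by rewrite conj_circleX // exprMn !exprD invfM; ring.
under [RHS]eq_bigr do rewrite E.
rewrite exchange_big /=.
rewrite horner_poly mulr_suml mulr_sumr; apply: eq_bigr => b _.
rewrite exchange_big /=.
transitivity (\sum_(a < size U) (U`_a * cj V`_b * rho%:C ^+ (a + b)) * (N * (a == b + k :> nat)%N)%:R).
  have [bkU|bkU] := ltnP (b + k) (size U).
    rewrite (bigD1 (Ordinal bkU)) //= eqxx muln1 big1 => [|a /negPf].
      rewrite addr0 RealCX -exprM mul2n -addnn !exprD; ring.
    by rewrite -(inj_eq val_inj) /= => ->; rewrite muln0 mulr0.
  rewrite [U`__]nth_default // !mul0r mulr0 big1 // => a _.
  by rewrite ltn_eqF ?muln0 ?mulr0 // (leq_trans (ltn_ord a)).
apply: eq_bigr => a _; rewrite -mulr_sumr sum_root_unity //.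
  exact: leq_trans (ltn_ord a) sU.
by apply: leq_trans sV; rewrite ltn_add2r.
Qed.

(** The exponent [b] of the squared radius is the index of the coefficient of [V]: the radial
    derivative falls on the antiholomorphic factor only. For [k = 0] both indices agree and it may
    be moved to [U] instead. *)
Lemma cmean_derivr k U V : 'X * (cmean k U V)^`() = cmean k U ('X * V^`()).
Proof.
apply/polyP => -[|b]; rewrite coefXM !cmeanE coefXM ?eqxx.
  by rewrite conj0 mulr0.
by rewrite /= !coef_deriv cmeanE conjMn mulrnAr.
Qed.

Lemma cmean_derivl U V : 'X * (cmean 0 U V)^`() = cmean 0 ('X * U^`()) V.
Proof.
apply/polyP => -[|b]; rewrite coefXM !cmeanE coefXM ?eqxx ?mul0r //.
by rewrite /= addn0 !coef_deriv cmeanE addn0 mulrnAl.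
Qed.

Variable P : {poly C}.

(* [cmean] with the additional weight [phi (|P w|^2)] in the average. *)
Definition wmean k phi U V : {poly C} :=
  \sum_(l < size phi) (phi`_l)%:C *: cmean k (U * P ^+ l) (V * P ^+ l).

Lemma wmean_widen k phi U V n : (size phi <= n)%N ->
  wmean k phi U V = \sum_(l < n) (phi`_l)%:C *: cmean k (U * P ^+ l) (V * P ^+ l).
Proof.
move=> sn; rewrite /wmean (big_ord_widen _ (fun l => (phi`_l)%:C *:
   cmean k (U * P ^+ l) (V * P ^+ l)) sn).
rewrite big_mkcond; apply: eq_bigr => l _; case: ltnP => // H.
by rewrite nth_default // scale0r.
Qed.

Definition pmod2 (w : C) : R := nc P.[w] ^+ 2.

(** Each monomial of [phi (|P|^2)] is split as [P ^ l * cj (P ^ l)] between [U] and [V]. Every [N]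
    beyond a threshold is allowed, so that two means can be sampled at the same points and compared
    termwise. *)
Lemma wmean_avg k phi U V (rho : R) :
  exists N0 : nat, forall N (z : C), (N0 <= N)%N -> N.-primitive_root z ->
  (wmean k phi U V).[(rho ^+ 2)%:C] * rho%:C ^+ k =
  N%:R^-1 * \sum_(i < N) (phi.[pmod2 (rho%:C * z ^+ i)])%:C *
      (U.[rho%:C * z ^+ i] * cj V.[rho%:C * z ^+ i]) / (z ^+ i) ^+ k.
Proof.
exists (\sum_(l < size phi) (size (U * P ^+ l)%R + size (V * P ^+ l)%R) + k)%N.
move=> N z N0 zP.
rewrite /wmean horner_sum mulr_suml.
transitivity (\sum_(l < size phi) (phi`_l)%:C * (N%:R^-1 * \sum_(i < N)
  (U * P ^+ l).[rho%:C * z ^+ i] * cj (V * P ^+ l).[rho%:C * z ^+ i] / (z ^+ i) ^+ k)).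
  apply: eq_bigr => l _; rewrite hornerZ -mulrA (cmean_avg _ zP) //.
    by apply: leq_trans N0; rewrite (bigD1 l) //= -!addnA leq_addr.
  apply: leq_trans N0; rewrite (bigD1 l) //= leq_add2r -addnA addnCA.
  by rewrite leq_addr.
under eq_bigr do rewrite mulrCA mulr_sumr.
rewrite -mulr_sumr exchange_big /=; congr (_ * _); apply: eq_bigr => i _.
rewrite [phi.[_]]horner_coef rmorph_sum /= !mulr_suml; apply: eq_bigr => l _.
rewrite !hornerM !horner_exp conjM conjX rmorphM /= !RealCX.
set p := P.[_]; set u := U.[_]; set v := V.[_].
rewrite -RealCX -mulc_conj exprMn; ring.
Qed.

Lemma nc_nat n : nc (n%:R : C) = n%:R.
Proof. by rewrite -(rmorph_nat (real_complex R)) nc_real ger0_norm // ler0n. Qed.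

Lemma circle_root N (z : C) (i : 'I_N) : N.-primitive_root z -> nc (z ^+ i) = 1.
Proof.
move=> zP; have N0 := prim_order_gt0 zP.
by rewrite ncX (nc_prim_root N0 (prim_expr_order zP)) expr1n.
Qed.

(* [rho] is the radius of the circle, so the mean is evaluated at [rho ^+ 2]. *)
Lemma wmean_le k phi U V (rho B : R) :
  (forall w, nc w = `|rho| ->
     `|phi.[pmod2 w]| * (nc U.[w] * nc V.[w]) <= B) ->
  nc ((wmean k phi U V).[(rho ^+ 2)%:C]) * `|rho| ^+ k <= B.
Proof.
move=> H; have [N0 HN] := wmean_avg k phi U V rho.
have [|z zP] := @exists_prim_root R N0.+1; first by [].
have := HN _ _ (leqnSn N0) zP; move/(congr1 (@nc R)); rewrite ncM ncX nc_real => ->.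
rewrite ncM ncV nc_nat mulrC ler_pdivrMr ?ltr0n //.
apply: le_trans (nc_sum _ _ _) _.
apply: (@le_trans _ _ (\sum_(i < N0.+1) B)); last by rewrite sumr_const card_ord mulr_natr.
apply: ler_sum => i _; rewrite !ncM ncV ncX circle_root // expr1n invr1 mulr1 nc_conj nc_real.
by apply: H; rewrite ncM circle_root // mulr1 nc_real.
Qed.

Lemma wmean0_eq phi U (rho : R) :
  exists N : nat, exists z : C, N.+1.-primitive_root z /\
  Re (wmean 0 phi U U).[(rho ^+ 2)%:C] =
  (\sum_(i < N.+1) phi.[pmod2 (rho%:C * z ^+ i)] * nc U.[rho%:C * z ^+ i] ^+ 2) / N.+1%:R.
Proof.
have [N0 HN] := wmean_avg 0 phi U U rho.
have [|z zP] := @exists_prim_root R N0.+1; first by [].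
exists N0, z; split => //.
have := HN _ _ (leqnSn N0) zP; rewrite expr0 mulr1 => ->.
under eq_bigr do rewrite expr0 divr1 mulc_conj -rmorphM /=.
by rewrite -rmorph_sum -(rmorph_nat (real_complex R)) -fmorphV -rmorphM mulrC.
Qed.

Lemma nc_circle N (z : C) (rho : R) (i : 'I_N) : N.-primitive_root z ->
  nc (rho%:C * z ^+ i) = `|rho|.
Proof. by move=> zP; rewrite ncM circle_root // mulr1 nc_real. Qed.

Lemma wmean0_ge0 phi U (rho : R) :
  (forall w, nc w = `|rho| -> 0 <= phi.[pmod2 w]) ->
  0 <= Re (wmean 0 phi U U).[(rho ^+ 2)%:C].
Proof.
move=> H; have [N [z [zP ->]]] := wmean0_eq phi U rho.
rewrite divr_ge0 ?ler0n // sumr_ge0 // => i _.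
by rewrite mulr_ge0 ?sqr_ge0 // H // nc_circle.
Qed.

Lemma wmean0_le phi U (rho b : R) :
  (forall w, nc w = `|rho| -> phi.[pmod2 w] * nc U.[w] ^+ 2 <= b) ->
  Re (wmean 0 phi U U).[(rho ^+ 2)%:C] <= b.
Proof.
move=> H; have [N [z [zP ->]]] := wmean0_eq phi U rho.
rewrite ler_pdivrMr ?ltr0n // mulr_natr -[N.+1 in leRHS]card_ord -sumr_const.
by apply: ler_sum => i _; rewrite H // nc_circle.
Qed.

(** Termwise, [2 eta f u v <= f u^2 + eta^2 f v^2]. This trades the radial derivative of a mean
    involving [Q] for a mean of [|w P'|^2], which is itself a derivative and can be integrated. *)
Lemma wmean_AMGM k phi U V (rho eta B : R) : 0 < eta ->
  (forall w, nc w = `|rho| -> 0 <= phi.[pmod2 w]) ->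
  (forall w, nc w = `|rho| -> phi.[pmod2 w] * nc U.[w] ^+ 2 <= B * eta ^+ 2) ->
  nc ((wmean k phi U V).[(rho ^+ 2)%:C]) * `|rho| ^+ k <=
    eta / 2 * (Re (wmean 0 phi V V).[(rho ^+ 2)%:C] + B).
Proof.
move=> eta0 phi0 HU.
have [N1 HN1] := wmean_avg k phi U V rho.
have [N2 HN2] := wmean_avg 0 phi V V rho.
pose N := (N1 + N2).+1; have [|z zP] := @exists_prim_root R N; first by [].
have := HN1 N z (leqW (leq_addr _ _)) zP.
move/(congr1 (@nc R)); rewrite ncM ncX nc_real => ->.
have := HN2 N z (leqW (leq_addl _ _)) zP; rewrite expr0 mulr1 => ->.
under [X in _ <= _ * (Re (_ * X) + _)]eq_bigr do rewrite expr0 divr1 mulc_conj -rmorphM /=.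
rewrite -rmorph_sum -(rmorph_nat (real_complex R)) -fmorphV -rmorphM /=.
rewrite ncM nc_real ger0_norm ?invr_ge0 ?ler0n //.
have -> : B = N%:R^-1 * \sum_(i < N) B.
  by rewrite sumr_const card_ord -[B *+ N]mulr_natl mulKf // pnatr_eq0.
rewrite -mulrDr mulrCA ler_pM2l ?invr_gt0 ?ltr0n // -big_split mulr_sumr.
apply: le_trans (nc_sum _ _ _) _; apply: ler_sum => i _ /=.
set w := _ * z ^+ i.
have w1 : nc w = `|rho| by rewrite ncM circle_root // mulr1 nc_real.
rewrite !ncM ncV ncX circle_root // expr1n invr1 mulr1 nc_conj nc_real.
rewrite ger0_norm ?phi0 //.
move: (phi0 _ w1) (HU _ w1) (nc_ge0 U.[w]) (nc_ge0 V.[w]).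
set f := phi.[_]; set u := nc U.[w]; set v := nc V.[w] => f0 fu u0 v0.
rewrite -(ler_pM2r eta0).
have : 0 <= f * (u - eta * v) ^+ 2 by rewrite mulr_ge0 // sqr_ge0.
nra.
Qed.

Lemma X_deriv_expS l : 'X * (P ^+ l.+1)^`() = ('X * P^`()) * P ^+ l *+ l.+1.
Proof. by rewrite deriv_exp /= mulrnAr mulrA. Qed.

Lemma coef_derivXM phi l : (('X * phi)^`())`_l = phi`_l *+ l.+1.
Proof. by rewrite coef_deriv coefXM. Qed.

(** Since [V = P], the monomial of degree [l] of the weight carries [cj (P ^ l.+1)]; its derivative
    brings out [l.+1], which produces the derivative of ['X * phi]. *)
Lemma wmean_derivr k phi U :
  'X * (wmean k phi U P)^`() = wmean k ('X * phi)^`() U ('X * P^`()).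
Proof.
pose n := (size phi + size ('X * phi)^`())%N.
rewrite !(@wmean_widen _ _ _ _ n) ?leq_addl ?leq_addr //.
rewrite raddf_sum /= mulr_sumr; apply: eq_bigr => l _.
rewrite derivZ -scalerAr cmean_derivr -exprS X_deriv_expS coef_derivXM.
rewrite rmorphMn -scalerMnl scalerMnr; congr (_ *: _).
by apply/polyP => b; rewrite coefMn !cmeanE coefMn conjMn mulrnAr.
Qed.

Lemma wmean_derivl phi V :
  'X * (wmean 0 phi P V)^`() = wmean 0 ('X * phi)^`() ('X * P^`()) V.
Proof.
pose n := (size phi + size ('X * phi)^`())%N.
rewrite !(@wmean_widen _ _ _ _ n) ?leq_addl ?leq_addr //.
rewrite raddf_sum /= mulr_sumr; apply: eq_bigr => l _.
rewrite derivZ -scalerAr cmean_derivl -exprS X_deriv_expS coef_derivXM.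
rewrite rmorphMn -scalerMnl scalerMnr; congr (_ *: _).
by apply/polyP => b; rewrite coefMn !cmeanE coefMn mulrnAl.
Qed.

(** Two logarithmic radial derivatives, this one and then [wmean_derivl], turn a mean of a function
    of [|P|^2] into a mean of [|w P'|^2] with a new weight: this is the computation of a
    Laplacian. *)
Lemma wmean_deriv1 phi :
  'X * (wmean 0 phi 1 1)^`() = wmean 0 phi^`() P ('X * P^`()).
Proof.
pose n := (size phi + size phi^`())%N.
rewrite (@wmean_widen _ phi _ _ n.+1) ?leqW ?leq_addr //.
rewrite (@wmean_widen _ phi^`() _ _ n) ?leq_addl //.
rewrite raddf_sum /= mulr_sumr big_ord_recl /= derivZ -scalerAr cmean_derivr.
rewrite !expr0 mulr1 -polyC1 derivC mulr0 (_ : cmean _ _ 0 = 0) ?scaler0 ?add0r.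
  apply: eq_bigr => l _; rewrite /bump /= add1n.
  rewrite derivZ -scalerAr cmean_derivr !mul1r X_deriv_expS coef_deriv.
  rewrite rmorphMn -scalerMnl scalerMnr -exprS; congr (_ *: _).
  by apply/polyP => b; rewrite coefMn !cmeanE coefMn conjMn mulrnAr.
by apply/polyP => b; rewrite cmeanE !coef0 conj0 mulr0.
Qed.

End CircleMean.

(** * Polynomial approximations of the inverse *)

Section Cutoff.
Local Open Scope complex_scope.
Variable R : realType.
Implicit Types (x p q eta : R) (M K j : nat).

(* On [0, 1] the polynomial [chi M] approximates [1 / x], see [XchiE]; [theta M] is its
   primitive vanishing at [0], which replaces the logarithm. *)
Definition chi M : {poly R} := \sum_(i < M) (1 - 'X) ^+ i.
Definition theta M : {poly R} :=
  \sum_(i < M) (i.+1%:R^-1) *: (1 - (1 - 'X) ^+ i.+1).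
Definition harm M : R := \sum_(i < M) i.+1%:R^-1.

Lemma XchiE M : 'X * chi M = 1 - (1 - 'X) ^+ M.
Proof.
have := subrXX 1 (1 - 'X : {poly R}) M; rewrite expr1n => ->; rewrite subKr.
by congr (_ * _); apply: eq_bigr => i _; rewrite expr1n mul1r.
Qed.

Lemma deriv_1X_exp n : ((1 - 'X : {poly R}) ^+ n)^`() = - (n%:R *: (1 - 'X) ^+ n.-1).
Proof.
by rewrite deriv_exp derivB -polyC1 derivC derivX sub0r mulN1r mulNrn scaler_nat.
Qed.

(** On [0, 1] the product [x * chi x] rises from 0 to 1, and this slope is concentrated where [x] is
    at most of order [1 / M]: the radial derivative of the means essentially sees only points with
    [|P|^2] of that size. *)
Lemma deriv_Xchi M : ('X * chi M)^`() = M%:R *: (1 - 'X) ^+ M.-1.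
Proof. by rewrite XchiE derivB -{1}polyC1 derivC sub0r deriv_1X_exp opprK. Qed.

Lemma deriv_theta M : (theta M)^`() = chi M.
Proof.
rewrite raddf_sum /=; apply: eq_bigr => i _.
rewrite derivZ derivB -{1}polyC1 derivC sub0r deriv_1X_exp opprK scalerA.
by rewrite mulVf ?scale1r // pnatr_eq0.
Qed.

Lemma horner_Xchi M x : x * (chi M).[x] = 1 - (1 - x) ^+ M.
Proof. by have := congr1 (horner^~ x) (XchiE M); rewrite !hornerE. Qed.

Lemma horner_kap M x : (('X * chi M)^`()).[x] = M%:R * (1 - x) ^+ M.-1.
Proof. by rewrite deriv_Xchi !hornerE. Qed.

Lemma chiE M x : (chi M).[x] = \sum_(i < M) (1 - x) ^+ i.
Proof. by rewrite horner_sum; apply: eq_bigr => i _; rewrite !hornerE. Qed.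

Lemma chi_ge0 M x : x <= 1 -> 0 <= (chi M).[x].
Proof. by move=> x1; rewrite chiE sumr_ge0 // => i _; rewrite exprn_ge0 // subr_ge0. Qed.

Lemma chi_le M x : 0 <= x <= 1 -> (chi M).[x] <= M%:R.
Proof.
move=> /andP[x0 x1]; rewrite chiE -[M in M%:R]card_ord -sumr_const.
by apply: ler_sum => i _; rewrite exprn_ile1 ?subr_ge0 // lerBlDr lerDl.
Qed.

Lemma chi_mono M M' x : x <= 1 -> (M <= M')%N -> (chi M).[x] <= (chi M').[x].
Proof.
move=> x1 MM; rewrite !chiE (big_ord_widen _ (fun i => (1 - x) ^+ i) MM) big_mkcond.
by apply: ler_sum => i _; case: ifP => // _; rewrite exprn_ge0 // subr_ge0.
Qed.

Lemma theta_itv M x : 0 <= x <= 1 -> 0 <= (theta M).[x] <= harm M.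
Proof.
move=> /andP[x0 x1]; rewrite horner_sum; apply/andP; split.
  apply: sumr_ge0 => i _; rewrite !hornerE mulr_ge0 ?invr_ge0 ?ler0n // subr_ge0.
  by rewrite exprn_ile1 ?subr_ge0 // lerBlDr lerDl.
apply: ler_sum => i _; rewrite !hornerE ler_piMr ?invr_ge0 ?ler0n //.
by rewrite lerBlDr lerDl exprn_ge0 // subr_ge0.
Qed.

Lemma harm_exp2 n : harm (2 ^ n) <= n.+1%:R.
Proof.
elim: n => [|n IH]; first by rewrite /harm expn0 big_ord1 invr1.
rewrite /harm expnS mul2n -addnn big_split_ord /=.
rewrite -(addn1 n.+1) natrD lerD //.
apply: (@le_trans _ _ (\sum_(i < 2 ^ n) ((2 ^ n)%:R)^-1)).
  apply: ler_sum => i _; rewrite lef_pV2 ?posrE ?ltr0n ?expn_gt0 //.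
  by rewrite ler_nat leqW // leq_addr.
by rewrite sumr_const card_ord -[_ *+ _]mulr_natr mulVf // pnatr_eq0 expn_eq0.
Qed.

Lemma exp1Bx_le n x : 0 <= x <= 1 -> (1 - x) ^+ n * (1 + n%:R * x) <= 1.
Proof.
move=> /andP[x0 x1]; elim: n => [|n IH]; first by rewrite expr0 mul0r addr0 mulr1.
apply: le_trans IH; rewrite exprS -mulrA mulrCA ler_wpM2l ?exprn_ge0 ?subr_ge0 //.
rewrite -(addn1 n) natrD; have : 0 <= n%:R :> R by rewrite ler0n.
nra.
Qed.

(** Quadratic decay in [K x] comes from splitting the exponent [2 K - 1] as [K + (K - 1)] and
    spending the linear bound [exp1Bx_le] once on each part; this is why the order of [chi] is kept
    even. *)
Lemma kernel_sq_bound K x : (2 <= K)%N -> 0 <= x <= 1 ->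
  ((K.*2)%:R * x) ^+ 2 * (1 - x) ^+ (K.*2).-1 <= 8.
Proof.
case: K => [|[|K]] // _ x01; have /andP[x0 x1] := x01.
have := exp1Bx_le K.+2 x01; have := exp1Bx_le K.+1 x01.
rewrite (_ : (K.+2.*2).-1 = (K.+2 + K.+1)%N); last by lia.
rewrite exprD (_ : (K.+2.*2)%:R = 2 * (K%:R + 2) :> R); last first.
  by rewrite -mul2n natrM -[in LHS](addn2 K) natrD.
rewrite -[in K.+2%:R](addn2 K) -[in K.+1%:R](addn1 K) !natrD.
have : 0 <= (1 - x) ^+ K.+1 by rewrite exprn_ge0 // subr_ge0.
have : 0 <= (1 - x) ^+ K.+2 by rewrite exprn_ge0 // subr_ge0.
have : 0 <= K%:R :> R by rewrite ler0n.
set a := _ ^+ K.+1; set b := _ ^+ K.+2; set n := K%:R => n0 b0 a0 Ha Hb.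
have h1 : b * ((n + 2) * x) <= 1 by nra.
have h2 : a * ((n + 2) * x) <= 2 by nra.
have h0 : 0 <= b * ((n + 2) * x) by apply: mulr_ge0 => //; apply: mulr_ge0 => //; lra.
have h3 : 0 <= a * ((n + 2) * x) by apply: mulr_ge0 => //; apply: mulr_ge0 => //; lra.
have : (b * ((n + 2) * x)) * (a * ((n + 2) * x)) <= 1 * 2 by apply: ler_pM.
nra.
Qed.

Section Pointwise.
Variables (j : nat) (p q eta : R).
Hypotheses (j0 : (0 < j)%N) (p01 : 0 <= p <= 1) (q0 : 0 <= q) (eta0 : 0 < eta).
Hypothesis Hq : q ^+ j <= p ^+ j.+1 + (eta ^+ j) ^+ j.+1.
Let p0 : 0 <= p. Proof. by case/andP: p01. Qed.
Let p1 : p <= 1. Proof. by case/andP: p01. Qed.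
Let x01 : 0 <= p ^+ 2 <= 1.
Proof. by rewrite sqr_ge0 exprn_ile1. Qed.
Let tau0 : 0 < eta ^+ j. Proof. exact: exprn_gt0. Qed.

Let q_le y : p <= y -> eta ^+ j <= y -> q ^+ j <= 2 * y ^+ j.+1.
Proof.
move=> py ty; apply: le_trans Hq _; rewrite mulr_natl mulr2n lerD //.
  by rewrite ler_pXn2r // nnegrE ?(le_trans p0).
by rewrite ler_pXn2r // nnegrE ?ltW // (lt_le_trans tau0).
Qed.

(** Here [p = |P|], [q = |Q|], and [t = eta ^ j] is the cutoff for [|P|]. The [j]-th power of the
    left side is at most [4 t^2 * a ^ j.+1 * c ^ j] with [a = m * max (p, t)^2 >= 1]; as
    [j.+1 <= 2 j], the quadratic decay [a^2 c <= 8] absorbs it. *)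
Lemma kernel_bound K : (2 <= K)%N -> (K.*2)%:R * (eta ^+ j) ^+ 2 = 1 ->
  (K.*2)%:R * (1 - p ^+ 2) ^+ (K.*2).-1 * q ^+ 2 <= 32 * eta ^+ 2.
Proof.
move=> K2; set m := (K.*2)%:R; set t := eta ^+ j => mt.
have m0 : 0 <= m by rewrite ler0n.
set c := (1 - p ^+ 2) ^+ _.
have c0 : 0 <= c by rewrite exprn_ge0 // subr_ge0; case/andP: x01.
have c1 : c <= 1 by rewrite exprn_ile1 ?subr_ge0 ?lerBlDr ?lerDl; case/andP: x01.
pose y := Num.max p t; have py : p <= y by rewrite le_max lexx.
have ty : t <= y by rewrite le_max lexx orbT.
have y0 : 0 <= y by apply: le_trans py.
pose a := m * y ^+ 2.
have a1 : 1 <= a by rewrite /a -mt ler_wpM2l // ler_pXn2r ?nnegrE // ltW.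
have a8 : a ^+ 2 * c <= 8.
  have [tp|pt] := leP t p.
    rewrite /a (_ : y = p); last by apply/max_idPl.
    exact: kernel_sq_bound.
  rewrite /a (_ : y = t); last by apply/max_idPr/ltW.
  by rewrite mt expr1n mul1r; apply: le_trans c1 _; rewrite ler1n.
clearbody c; have e0 := ltW eta0.
rewrite -(@ler_pXn2r _ j) // ?nnegrE ?mulr_ge0 ?sqr_ge0 //.
rewrite 2!exprMn [(q ^+ 2) ^+ j]exprAC.
apply: (@le_trans _ _ (m ^+ j * c ^+ j * (2 * y ^+ j.+1) ^+ 2)).
  apply: ler_wpM2l; first by rewrite mulr_ge0 ?exprn_ge0.
  rewrite ler_pXn2r ?nnegrE ?exprn_ge0 //; first exact: q_le.
  by rewrite mulr_ge0 // exprn_ge0.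
have -> : m ^+ j * c ^+ j * (2 * y ^+ j.+1) ^+ 2 = 4 * t ^+ 2 * (a ^+ j.+1 * c ^+ j).
  transitivity (4 * (m ^+ j * c ^+ j * y ^+ j.+1 ^+ 2) * (m * t ^+ 2)).
    by rewrite mt mulr1 exprMn; ring.
  by rewrite /a exprMn -!exprM mulnC (exprS m); ring.
clearbody a; have jj : (j.+1 <= 2 * j)%N by clear -j0; lia.
apply: (@le_trans _ _ (4 * t ^+ 2 * (8 ^+ j))).
  apply: ler_wpM2l; first by rewrite mulr_ge0 // sqr_ge0.
  apply: (@le_trans _ _ ((a ^+ 2 * c) ^+ j)); last first.
    by rewrite ler_pXn2r ?nnegrE //; apply: mulr_ge0 => //; exact: sqr_ge0.
  rewrite exprMn; apply: ler_wpM2r; first by rewrite exprn_ge0.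
  by rewrite -exprM; apply: ler_weXn2l.
rewrite /t exprAC [(32 * _) ^+ j]exprMn.
have -> : (32 : R) ^+ j = 4 ^+ j * 8 ^+ j by rewrite -exprMn; congr (_ ^+ _); ring.
rewrite -mulrA -mulrA [_ * 8 ^+ j]mulrC ler_wpM2r ?mulr_ge0 ?exprn_ge0 ?sqr_ge0 //.
by rewrite -{1}(expr1 4) ler_weXn2l // ler1n.
Qed.

(** Above the cutoff, [chi (p^2) <= 1 / p^2] leaves [q / p], whose [j]-th power is at most [2 p];
    below it, [chi <= M] and [M t^2 = 1] give [2 t]. *)
Lemma cutoff_bound M : M%:R * (eta ^+ j) ^+ 2 = 1 ->
  (q * p * (chi M).[p ^+ 2]) ^+ j <= 2 * Num.max p (eta ^+ j).
Proof.
set t := eta ^+ j => mt; have c0 := chi_ge0 M (proj2 (andP x01)).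
have [tp|pt] := leP t p.
  have pp : 0 < p by apply: lt_le_trans tp.
  have H : q * p * (chi M).[p ^+ 2] <= q / p.
    rewrite -mulrA ler_wpM2l // -(ler_pM2l pp) mulfV ?gt_eqF // mulrA -expr2.
    by rewrite horner_Xchi lerBlDr lerDl exprn_ge0 // subr_ge0; case/andP: x01.
  apply: (@le_trans _ _ ((q / p) ^+ j)).
    by rewrite ler_pXn2r ?nnegrE ?mulr_ge0 ?invr_ge0.
  rewrite expr_div_n ler_pdivrMr ?exprn_gt0 // -mulrA -exprS.
  exact: q_le.
apply: (@le_trans _ _ ((q * (t * M%:R)) ^+ j)).
  rewrite ler_pXn2r ?nnegrE ?mulr_ge0 ?ler0n ?(ltW tau0) // -mulrA ler_wpM2l //.
  by rewrite ler_pM // ?(ltW pt) // chi_le.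
rewrite exprMn; apply: (@le_trans _ _ (2 * t ^+ j.+1 * (t * M%:R) ^+ j)).
  by rewrite ler_wpM2r ?q_le // ?(ltW pt) // exprn_ge0 // mulr_ge0 // ltW.
rewrite exprS mulrA -mulrA -exprMn (_ : t * (t * M%:R) = 1); last first.
  by rewrite mulrA -expr2 mulrC mt.
by rewrite expr1n mulr1.
Qed.

End Pointwise.

(** Below the larger cutoff [eta ^ j] each of the two terms is separately of order [eta]. Above it
    both [chi] approximate [1 / p^2], and their difference is at most [(1 - p^2) ^ M / p^2]. *)
Lemma switch_bound j (p q eta eta' : R) M M' :
  (0 < j)%N -> 0 <= p <= 1 -> 0 <= q -> 0 < eta' -> eta' <= eta ->
  q ^+ j <= p ^+ j.+1 + (eta' ^+ j) ^+ j.+1 ->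
  M%:R * (eta ^+ j) ^+ 2 = 1 -> M'%:R * (eta' ^+ j) ^+ 2 = 1 -> (M <= M')%N ->
  q * p * ((chi M').[p ^+ 2] - (chi M).[p ^+ 2]) <= 4 * eta.
Proof.
move=> j0 p01 q0 e0' ee Hq' mt mt' MM; have /andP[p0 p1] := p01.
have x01 : 0 <= p ^+ 2 <= 1 by rewrite sqr_ge0 exprn_ile1.
have [x0 x1] := andP x01.
have e0 : 0 < eta by apply: lt_le_trans ee.
have tt : eta' ^+ j <= eta ^+ j by rewrite ler_pXn2r // nnegrE ltW.
have t0 : 0 < eta ^+ j by rewrite exprn_gt0.
have Hq : q ^+ j <= p ^+ j.+1 + (eta ^+ j) ^+ j.+1.
  by apply: le_trans Hq' _; rewrite lerD2l ler_pXn2r // nnegrE exprn_ge0 // ltW.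
have c0 := chi_ge0 M x1; have c0' := chi_ge0 M' x1.
have d0 : 0 <= (chi M').[p ^+ 2] - (chi M).[p ^+ 2] by rewrite subr_ge0 chi_mono.
have [tp|pt] := leP (eta ^+ j) p.
  have pp : 0 < p by apply: lt_le_trans tp.
  apply: (@le_trans _ _ eta); last by move: e0; clear; lra.
  have e00 := ltW e0; rewrite -(@ler_pXn2r _ j) ?nnegrE ?mulr_ge0 //.
  apply: (@le_trans _ _ ((q / p * (1 - p ^+ 2) ^+ M) ^+ j)).
    rewrite ler_pXn2r ?nnegrE ?mulr_ge0 ?invr_ge0 ?exprn_ge0 ?subr_ge0 ?chi_mono //.
    rewrite -!mulrA ler_wpM2l // -(ler_pM2l pp) mulrA -expr2 mulrBr !horner_Xchi.
    rewrite mulrA mulfV ?gt_eqF // mul1r.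
    have : 0 <= (1 - p ^+ 2) ^+ M' by rewrite exprn_ge0 // subr_ge0.
    set a := _ ^+ M'; set b := _ ^+ M; lra.
  rewrite exprMn expr_div_n.
  apply: (@le_trans _ _ (2 * p * (1 - p ^+ 2) ^+ M)).
    apply: ler_pM => //; rewrite ?mulr_ge0 ?invr_ge0 ?exprn_ge0 ?subr_ge0 //.
      rewrite ler_pdivrMr ?exprn_gt0 // -mulrA -exprS.
      apply: le_trans Hq _; rewrite mulr_natl mulr2n lerD //.
      by rewrite ler_pXn2r // nnegrE ltW.
    rewrite -[leRHS]expr1 ler_wiXn2l ?exprn_ge0 ?subr_ge0 //.
    by rewrite exprn_ile1 ?subr_ge0 // lerBlDr lerDl.
  (* As [m t^2 = 1], AM-GM applied to [1 + m p^2] turns this bound into [2 p (1 - p^2) ^ M <= t]. *)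
  have := exp1Bx_le M x01.
  have : 0 <= (1 - p ^+ 2) ^+ M by rewrite exprn_ge0 // subr_ge0.
  move: mt t0; set t := eta ^+ j; set b := _ ^+ M; set m := M%:R => mt t0 b0 Hb.
  have : 0 <= b * (1 - p * (m * t)) ^+ 2 by rewrite mulr_ge0 // sqr_ge0.
  have : b * (1 + m * p ^+ 2) * t <= 1 * t by rewrite ler_wpM2r // ltW.
  have E : (m * t) * t = 1 by rewrite -mt; ring.
  move: E; set u := m * t => E.
  have -> : b * (1 + m * p ^+ 2) * t = b * t + b * u * p ^+ 2 by rewrite /u; ring.
  move=> h1 h2.
  have h3 : 0 <= b * (1 - p * u) ^+ 2 * t by rewrite mulr_ge0 // ltW.
  have E2 : b * (1 - p * u) ^+ 2 * t = b * t - 2 * (b * p) * (u * t) + b * p ^+ 2 * u * (u * t).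
    ring.
  move: h3; rewrite E2 E !mulr1; nra.
have B1 : q * p * (chi M).[p ^+ 2] <= 2 * eta.
  rewrite -(@ler_pXn2r _ j) ?nnegrE ?mulr_ge0 ?(ltW e0) //.
  have := cutoff_bound j0 p01 q0 e0 Hq mt.
  rewrite (_ : Num.max _ _ = eta ^+ j); last by apply/max_idPr/ltW.
  move=> H; apply: le_trans H _; rewrite exprMn ler_wpM2r ?(ltW t0) //.
  by rewrite -{1}(expr1 2) ler_weXn2l // ler1n.
have B2 : q * p * (chi M').[p ^+ 2] <= 2 * eta.
  rewrite -(@ler_pXn2r _ j) ?nnegrE ?mulr_ge0 ?(ltW e0) //.
  have := cutoff_bound j0 p01 q0 e0' Hq' mt'.
  have : Num.max p (eta' ^+ j) <= eta ^+ j by rewrite ge_max (ltW pt).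
  move=> H1 H2; apply: le_trans H2 _; rewrite exprMn.
  apply: ler_pM => //; first by rewrite le_max p0.
  by rewrite -{1}(expr1 2) ler_weXn2l // ler1n.
have : 0 <= q * p * (chi M).[p ^+ 2] by rewrite !mulr_ge0.
move: B1 B2; rewrite mulrBr; set a := q * p * _; set b := q * p * _; lra.
Qed.

End Cutoff.

(** * Oscillation of the means within one scale *)

Section RealPart.
Local Open Scope complex_scope.
Local Notation Re := complex.Re.
Variable R : realType.
Local Notation C := R[i].

Definition Rep (p : {poly C}) : {poly R} := \poly_(i < size p) Re p`_i.

Lemma coef_Rep (p : {poly C}) i : (Rep p)`_i = Re p`_i.
Proof. by rewrite coef_poly; case: ltnP => // H; rewrite nth_default. Qed.

Lemma horner_Rep (p : {poly C}) x : (Rep p).[x] = Re p.[x%:C].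
Proof.
rewrite horner_poly horner_coef Re_sum; apply: eq_bigr => i _.
by rewrite -RealCX cReM.
Qed.

Lemma Re_natmul (z : C) n : Re (z *+ n) = Re z *+ n.
Proof. by elim: n => [|n IH]; rewrite ?mulr0n // !mulrS cReD IH. Qed.

Lemma deriv_Rep (p : {poly C}) : (Rep p)^`() = Rep p^`().
Proof. by apply/polyP => i; rewrite coef_deriv !coef_Rep coef_deriv Re_natmul. Qed.

Lemma Rep_XM (p : {poly C}) : 'X * Rep p = Rep ('X * p).
Proof. by apply/polyP => i; rewrite coef_Rep !coefXM coef_Rep; case: i. Qed.

Lemma poly_nondecr (p : {poly R}) (a b : R) : a <= b ->
  (forall x, a < x < b -> 0 <= p^`().[x]) -> p.[a] <= p.[b].
Proof.
rewrite le_eqVlt => /predU1P[-> //|ab] H.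
have [c + E] := poly_mvt p ab; rewrite in_itv /= => /H c0.
by rewrite -subr_ge0 E mulr_ge0 // subr_ge0 ltW.
Qed.

(** After a rotation by [u] the increment of [J] is real and equals its modulus; then [L - Re (u J)]
    is nondecreasing. *)
Lemma poly_mean_value (J : {poly C}) (L : {poly R}) (a b : R) : a <= b ->
  (forall x, a < x < b -> nc J^`().[x%:C] <= L^`().[x]) ->
  nc (J.[b%:C] - J.[a%:C]) <= L.[b] - L.[a].
Proof.
move=> ab H; have [u u1 <-] := rotation (J.[b%:C] - J.[a%:C]).
rewrite mulrBr cReB -!hornerZ -!horner_Rep.
have := @poly_nondecr (L - Rep (u *: J)) a b ab; rewrite !hornerD !hornerN.
set A := L.[a]; set B := L.[b]; set A' := _.[a]; set B' := _.[b] => K.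
suff : A - A' <= B - B' by lra.
apply: K => x xab; rewrite derivB deriv_Rep derivZ hornerD hornerN horner_Rep hornerZ subr_ge0.
by apply: le_trans (H _ xab); rewrite (le_trans (Re_le_nc _)) // ncM u1 mul1r.
Qed.

End RealPart.

Section SingleScale.
Local Open Scope complex_scope.
Local Notation Re := complex.Re.
Variable R : realType.
Local Notation C := R[i].
Variables (P Q : {poly C}) (j k K : nat) (s eta : R).
Hypotheses (j0 : (0 < j)%N) (K2 : (2 <= K)%N) (s0 : 0 < s) (eta0 : 0 < eta).
Hypothesis MKeta : (K.*2)%:R * (eta ^+ j) ^+ 2 = 1.
Hypothesis HP : forall w, nc w <= s -> nc P.[w] <= 1.
Hypothesis HQ : forall w, nc w <= s ->
  nc Q.[w] ^+ j <= nc P.[w] ^+ j.+1 + (eta ^+ j) ^+ j.+1.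

Let M := K.*2.
Let J := wmean P k (chi R M) Q P.
Let m := Rep (wmean P 0 (theta R M) 1 1).
Let Y := 'X * m^`().

Let x01 w : nc w <= s -> 0 <= pmod2 P w <= 1.
Proof. by move=> ws; rewrite sqr_ge0 exprn_ile1 ?nc_ge0 ?HP. Qed.

Let m_itv (rho : R) : 0 <= rho <= s -> 0 <= m.[rho ^+ 2] <= harm R M.
Proof.
move=> /andP[r0 rs]; rewrite /m horner_Rep.
have T w : nc w = `|rho| -> 0 <= (theta R M).[pmod2 P w] <= harm R M.
  by move=> wr; apply: theta_itv; apply: x01; rewrite wr ger0_norm.
apply/andP; split; first by apply: wmean0_ge0 => w /T /andP[].
apply: wmean0_le => w /T /andP[_]; by rewrite hornerC nc1 expr1n mulr1.
Qed.

(** [m] is the mean of the regularized logarithm of [|P|^2], and [Y = r m']. The second logarithmic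
    derivative of [m] is a mean of a nonnegative kernel times [|w P'|^2], so [Y] is
    nondecreasing. *)
Let YE x : Y^`().[x] * x = Re (wmean P 0 ('X * chi R M)^`() ('X * P^`()) ('X * P^`())).[x%:C].
Proof.
rewrite -wmean_derivl hornerM hornerX cReZ mulrC; congr (_ * _).
have -> : Y = Rep (wmean P 0 (chi R M) P ('X * P^`())).
  by rewrite -deriv_theta -wmean_deriv1 /Y /m deriv_Rep Rep_XM.
by rewrite deriv_Rep horner_Rep.
Qed.

Let Y'_ge0 x : 0 < x <= s ^+ 2 -> 0 <= Y^`().[x].
Proof.
move=> /andP[x0 xs]; rewrite -(pmulr_lge0 _ x0) YE -(sqr_sqrtr (ltW x0)).
have H : Num.sqrt x <= s.
  by rewrite -(@ler_pXn2r _ 2) ?nnegrE ?sqrtr_ge0 ?(ltW s0) // sqr_sqrtr ?(ltW x0).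
apply: wmean0_ge0 => w wr; rewrite horner_kap mulr_ge0 ?ler0n // exprn_ge0 // subr_ge0.
by have /andP[] : 0 <= pmod2 P w <= 1 by apply: x01; rewrite wr ger0_norm ?sqrtr_ge0.
Qed.

Let Y_mono a b : 0 <= a -> a <= b -> b <= s ^+ 2 -> Y.[a] <= Y.[b].
Proof.
move=> a0 ab bs; apply: poly_nondecr => // x /andP[ax xb]; apply: Y'_ge0.
by rewrite (le_lt_trans a0 ax) (le_trans (ltW xb)).
Qed.

Let Y0 : Y.[0] = 0. Proof. by rewrite /Y hornerM hornerX mul0r. Qed.

(** As [Y] is nondecreasing, its value at half the radius is controlled by the increment of [m] up
    to the full radius, which is at most [harm M]. The squared radii differ by [3/4 s^2], hence the
    constant [4 / 3]. *)
Let Y_le : Y.[(s / 2) ^+ 2] <= 4 / 3 * harm R M.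
Proof.
set b := (s / 2) ^+ 2; have bs : b < s ^+ 2 by rewrite /b exprMn; have := exprn_gt0 2 s0; lra.
have b0 : 0 <= b by apply: sqr_ge0.
have [xi + E] := poly_mvt m bs; rewrite in_itv /= => /andP[bx xs].
have x0 : 0 < xi by apply: le_lt_trans bx.
have H1 : m.[s ^+ 2] <= harm R M by have /andP[] := @m_itv s (ltac:(by rewrite lexx ltW)).
have hs : 0 <= s / 2 <= s by apply/andP; split; have := s0; lra.
have H2 : 0 <= m.[b] by have /andP[] := m_itv hs.
have H3 := Y_mono b0 (ltW bx) (ltW xs).
have YX : Y.[xi] = xi * m^`().[xi] by rewrite /Y hornerM hornerX.
have d0 : 0 <= m^`().[xi].
  by rewrite -(pmulr_rge0 _ x0) -YX (le_trans _ H3) // -Y0 Y_mono // ltW.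
move: E H1 H2 H3; rewrite YX (_ : s ^+ 2 - b = s ^+ 2 * (3 / 4)); last by rewrite /b; field.
move: d0 xs; set u := m.[_]; set v := m.[b]; set y := Y.[b]; set d := m^`().[_]; set t := s ^+ 2.
move=> d0 xt E H1 H2 H3.
have : xi * d <= t * d by rewrite ler_wpM2r // ltW.
nra.
Qed.

(* [J] is nearly independent of the radius where [|P|] is large; its radial derivative is bounded
   by AM-GM through the derivative of [Y], which is nonnegative and has bounded integral. *)
Lemma scale_step_le : nc (J.[((s / 2) ^+ 2)%:C] - J.[((s / 4) ^+ 2)%:C]) <=
  (4 / s) ^+ k * (eta / 2) * (4 / 3 * harm R M + 96).
Proof.
pose c := (4 / s) ^+ k * (eta / 2).
have c0 : 0 < c by rewrite mulr_gt0 ?exprn_gt0 ?divr_gt0.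
(* A primitive of the bound for [J']: AM-GM gives [eta / 2 * (x Y' + 32)] with 32 from
   [kernel_bound], and [32 <= 512 / s^2 * x] since [x >= (s / 4)^2]. Over the interval the linear
   term adds [512 * (1/4 - 1/16) = 96]. The factor [(4 / s) ^ k] in [c] bounds [rho ^- k]. *)
pose L := c *: (Y + (512 / s ^+ 2) *: 'X).
have s20 : 0 < s ^+ 2 by rewrite exprn_gt0.
have ab : (s / 4) ^+ 2 <= (s / 2) ^+ 2.
  by rewrite !exprMn; move: s20; set t := s ^+ 2; lra.
apply: (@le_trans _ _ (L.[(s / 2) ^+ 2] - L.[(s / 4) ^+ 2])); last first.
  rewrite !hornerZ -mulrBr; apply: ler_wpM2l; first exact: ltW.
  rewrite !hornerD !hornerZ !hornerX.
  have -> : 96 = 512 / s ^+ 2 * (s / 2) ^+ 2 - 512 / s ^+ 2 * (s / 4) ^+ 2 :> R.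
    by field; rewrite gt_eqF.
  have : 0 <= Y.[(s / 4) ^+ 2].
    by rewrite -Y0; apply: Y_mono; rewrite ?sqr_ge0 // !exprMn; lra.
  have := Y_le; set y := Y.[_]; set y' := Y.[_]; lra.
apply: poly_mean_value => // x /andP[ax xb].
have x0 : 0 < x by apply: le_lt_trans ax; rewrite sqr_ge0.
have xs : x <= s ^+ 2 by apply: (le_trans (ltW xb)); rewrite exprMn; lra.
pose rho := Num.sqrt x; have r2 : rho ^+ 2 = x by rewrite sqr_sqrtr // ltW.
have r0 : 0 < rho by rewrite sqrtr_gt0.
have rs : rho <= s by rewrite -(@ler_pXn2r _ 2) ?nnegrE ?(ltW r0) ?(ltW s0) // r2.
have r4 : s / 4 <= rho.
  by rewrite -(@ler_pXn2r _ 2) ?nnegrE ?(ltW r0) ?divr_ge0 ?(ltW s0) // r2 ltW.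
have := @wmean_AMGM R P k ('X * chi R M)^`() Q ('X * P^`()) rho eta 32 eta0.
rewrite -wmean_derivr r2 hornerM hornerX ncM nc_real -YE (gtr0_norm x0) (gtr0_norm r0).
rewrite -/J => H.
have {}H : x * nc J^`().[x%:C] * rho ^+ k <= eta / 2 * (Y^`().[x] * x + 32).
  apply: H => w wr; have ws : nc w <= s by rewrite wr.
    rewrite horner_kap mulr_ge0 ?ler0n // exprn_ge0 // subr_ge0.
    by case/andP: (x01 ws).
  rewrite horner_kap; apply: (@kernel_bound _ j) => //; rewrite ?nc_ge0 ?HP //.
  exact: HQ.
have d0 := nc_ge0 J^`().[x%:C]; have y0 : 0 <= Y^`().[x] by apply: Y'_ge0; rewrite x0.
rewrite derivZ derivD derivZ derivX !hornerE.
have rk : (rho ^+ k)^-1 <= (4 / s) ^+ k.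
  rewrite -exprVn; apply: lerXn2r; rewrite ?nnegrE ?invr_ge0 ?divr_ge0 ?(ltW s0) ?(ltW r0) //.
  by rewrite -[4 / s]invrK lef_pV2 ?posrE ?invr_gt0 ?divr_gt0 // invf_div.
have rk0 : 0 < rho ^+ k by rewrite exprn_gt0.
rewrite -(ler_pM2l x0) -(ler_pM2r rk0); apply: le_trans H _.
have -> : x * (c * (Y^`().[x] + 512 / s ^+ 2)) * rho ^+ k =
  eta / 2 * (Y^`().[x] * x + 512 / s ^+ 2 * x) * ((4 / s) ^+ k * rho ^+ k).
  by rewrite /c; ring.
have h1 : 1 <= (4 / s) ^+ k * rho ^+ k by rewrite -ler_pdivrMr // div1r.
have h2 : 32 <= 512 / s ^+ 2 * x.
  have -> : 32 = 512 / s ^+ 2 * (s / 4) ^+ 2 :> R by field; rewrite gt_eqF.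
  have s2i : 0 <= 512 / s ^+ 2 by apply: divr_ge0; [exact: ler0n|exact: ltW].
  exact: (ler_wpM2l s2i (ltW ax)).
have yx : 0 <= Y^`().[x] * x by rewrite mulr_ge0 // ltW.
apply: (@le_trans _ _ (eta / 2 * (Y^`().[x] * x + 512 / s ^+ 2 * x))).
  have e2 : 0 <= eta / 2 by apply: divr_ge0; [exact: ltW|exact: ler0n].
  by apply: (ler_wpM2l e2); rewrite lerD2l.
apply: ler_peMr; last exact: h1.
apply: mulr_ge0; first by apply: divr_ge0; [exact: ltW|exact: ler0n].
by apply: addr_ge0; [exact: yx|apply: le_trans h2; exact: ler0n].
Qed.

End SingleScale.

(** * Coefficients of a quotient *)

Lemma le_of_eq (R : realType) (x y : R) : x = y -> x <= y.
Proof. by move->. Qed.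

Section WeightedNorm.
Local Open Scope complex_scope.
Variable R : realType.
Local Notation C := R[i].
Implicit Types (p q : {poly C}) (rho : R).

(** The l^1 norm of the coefficients at radius [rho]: it bounds the sup norm on the disc, is
    submultiplicative, and turns vanishing low coefficients into smallness near 0
    ([horner_le_tail]). *)
Definition wnorm rho p : R := \sum_(i < size p) nc p`_i * rho ^+ i.

Lemma wnorm_widen rho p n : (size p <= n)%N ->
  wnorm rho p = \sum_(i < n) nc p`_i * rho ^+ i.
Proof.
move=> sn; rewrite /wnorm (big_ord_widen _ (fun i => nc p`_i * rho ^+ i) sn).
rewrite big_mkcond; apply: eq_bigr => l _; case: ltnP => // H.
by rewrite nth_default // nc0 mul0r.
Qed.

Lemma wnorm_ge0 rho p : 0 <= rho -> 0 <= wnorm rho p.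
Proof. by move=> r0; apply: sumr_ge0 => i _; rewrite mulr_ge0 ?nc_ge0 ?exprn_ge0. Qed.

Lemma wnormD rho p q : 0 <= rho -> wnorm rho (p + q) <= wnorm rho p + wnorm rho q.
Proof.
move=> r0; pose n := (size (p + q)%R + size p + size q)%N.
have [s1 s2 s3] : [/\ size (p + q)%R <= n, size p <= n & size q <= n]%N by rewrite /n; split; lia.
rewrite (wnorm_widen _ s1) (wnorm_widen _ s2) (wnorm_widen _ s3) -big_split.
by apply: ler_sum => i _ /=; rewrite -mulrDl coefD ler_wpM2r ?exprn_ge0 // ncD.
Qed.

Lemma wnormN rho p : wnorm rho (- p) = wnorm rho p.
Proof. by rewrite /wnorm size_polyN; apply: eq_bigr => i _; rewrite coefN ncN. Qed.

Lemma wnormB rho p q : 0 <= rho -> wnorm rho (p - q) <= wnorm rho p + wnorm rho q.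
Proof. by move=> r0; rewrite -(wnormN rho q) wnormD. Qed.

Lemma wnorm0 rho : wnorm rho 0 = 0.
Proof. by rewrite /wnorm size_poly0 big_ord0. Qed.

Lemma wnorm1 rho : wnorm rho 1 = 1.
Proof. by rewrite /wnorm size_poly1 big_ord1 coef1 eqxx nc1 expr0 mulr1. Qed.

Lemma wnorm_sum rho I (r : seq I) (P : pred I) (F : I -> {poly C}) : 0 <= rho ->
  wnorm rho (\sum_(i <- r | P i) F i) <= \sum_(i <- r | P i) wnorm rho (F i).
Proof.
move=> r0; apply: (big_ind2 (fun a b => wnorm rho a <= b)) => [|a b c e ab ce|//].
  by rewrite wnorm0.
by apply: le_trans (wnormD _ _ r0) _; exact: lerD.
Qed.

Lemma wnormXn rho p n : wnorm rho ('X^n * p) = rho ^+ n * wnorm rho p.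
Proof.
rewrite (@wnorm_widen _ _ (n + size p)); last first.
  by apply: leq_trans (size_polyMleq _ _) _; rewrite size_polyXn.
rewrite big_split_ord /= big1 ?add0r => [|i _]; last first.
  by rewrite coefXnM ltn_ord nc0 mul0r.
rewrite /wnorm mulr_sumr; apply: eq_bigr => i _.
by rewrite coefXnM ltnNge leq_addr /= addKn exprD mulrCA.
Qed.

Lemma wnormZ rho a p : wnorm rho (a *: p) = nc a * wnorm rho p.
Proof.
rewrite (@wnorm_widen _ (a *: p) (size p)) ?size_scale_leq // mulr_sumr.
by apply: eq_bigr => i _; rewrite coefZ ncM mulrA.
Qed.

Lemma wnormM rho p q : 0 <= rho -> wnorm rho (p * q) <= wnorm rho p * wnorm rho q.
Proof.
move=> r0; rewrite -{1}[p]coefK poly_def mulr_suml mulr_suml.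
apply: le_trans (wnorm_sum _ _ _ r0) _; apply: ler_sum => i _.
by rewrite -scalerAl wnormZ wnormXn mulrA.
Qed.

Lemma wnormX rho p n : 0 <= rho -> wnorm rho (p ^+ n) <= wnorm rho p ^+ n.
Proof.
move=> r0; elim: n => [|n IH]; first by rewrite !expr0 wnorm1.
rewrite !exprS; apply: le_trans (wnormM _ _ r0) _.
by rewrite ler_wpM2l ?wnorm_ge0.
Qed.

Lemma horner_le_tail rho p w m : 0 < rho -> nc w <= rho ->
  (forall i, (i < m)%N -> p`_i = 0) ->
  nc p.[w] <= (nc w / rho) ^+ m * wnorm rho p.
Proof.
move=> r0 wr pm; rewrite horner_coef; apply: le_trans (nc_sum _ _ _) _.
rewrite mulr_sumr; apply: ler_sum => i _; rewrite ncM ncX.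
have [im|mi] := ltnP i m; first by rewrite pm // nc0 !mul0r mulr0.
rewrite mulrCA ler_wpM2l ?nc_ge0 //.
have -> : nc w ^+ i = (nc w / rho) ^+ i * rho ^+ i.
  by rewrite -exprMn divfK // gt_eqF.
rewrite ler_wpM2r ?exprn_ge0 ?(ltW r0) //.
apply: ler_wiXn2l => //; first by rewrite divr_ge0 ?nc_ge0 // ltW.
by rewrite ler_pdivrMr // mul1r.
Qed.

Lemma horner_le_wnorm rho p w : 0 < rho -> nc w <= rho -> nc p.[w] <= wnorm rho p.
Proof.
move=> r0 wr; have := @horner_le_tail rho p w 0 r0 wr (fun i H => ltac:(by [])).
by rewrite expr0 mul1r.
Qed.

End WeightedNorm.

(** In powers of 2 this says [2 ^ i * rho ^- k <= M i] for the radius [rho = 2 ^- (i + 4)], with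
    [M i] the order of [chi] at scale [i]. *)
Lemma scale_exponent_le i j k l : (0 < j)%N -> (0 < l)%N -> (k <= l)%N ->
  (i + (i + 3).+1 * k <= 4 * j * l * i.+1)%N.
Proof.
move=> j0 l0 kl; apply: (@leq_trans (4 * l * i.+1)); last first.
  by rewrite -!mulnA leq_mul2l leq_pmull ?orbT.
have h : ((i + 3).+1 * k <= (i + 3).+1 * l)%N by rewrite leq_mul2l kl orbT.
have il : (i <= i * l)%N by rewrite leq_pmulr.
by move: h; rewrite mulSn mulnDl [(_ * i.+1)%N]mulnS; lia.
Qed.

Section QuotientCoef.
Local Open Scope complex_scope.
Local Notation cj := (@conjc _).
Variable R : realType.
Local Notation C := R[i].
Variables (P Q F : {poly C}) (j l k n : nat).
Hypotheses (j0 : (0 < j)%N) (l0 : (0 < l)%N) (kl : (k <= l)%N).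
Hypothesis (nl : (2 * j * j.+1 * l <= n.+1)%N).
Hypotheses (wP : wnorm 2^-1 P <= 1) (wQ : wnorm 2^-1 Q <= 1).
Hypothesis P0 : P`_0 != 0.
Hypothesis PQ : forall i, (i <= n)%N -> (P ^+ j.+1 - Q ^+ j)`_i = 0.
Hypothesis PF : forall i, (i <= k)%N -> (P * F)`_i = Q`_i.

Let half : R := 2^-1.
Let h0 : 0 < half. Proof. by rewrite invr_gt0. Qed.
Let h0' : 0 <= half. Proof. exact: ltW. Qed.

Let s (i : nat) : R := half ^+ (i + 3).
(** On the disc of radius [s i] the truncation error is at most [2 * (2 s) ^ n.+1 <= (4 s) ^ n.+1],
    which explains the 4; as [2 j (j + 1) l <= n + 1], it does not exceed [(eta ^ j) ^ j.+1]. Then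
    [K] is forced by [2 K * (eta ^ j) ^ 2 = 1]. *)
Let eta (i : nat) : R := (4 * s i) ^+ (2 * l).
Let K (i : nat) : nat := (2 ^ (4 * j * l * i.+1).-1)%N.
Let M i := (K i).*2.

Let ME i : M i = (2 ^ (4 * j * l * i.+1))%N.
Proof.
rewrite /M /K -mul2n -expnS prednK //.
by rewrite !muln_gt0 j0 l0.
Qed.

Let s0 i : 0 < s i. Proof. exact: exprn_gt0. Qed.
Let sS i : s i.+1 = s i / 2. Proof. by rewrite /s addSn exprS mulrC. Qed.
Let s4 i : 4 * s i = half ^+ i.+1.
Proof. by rewrite /s exprD [half ^+ i.+1]exprS; set x := half ^+ i; rewrite /half; field. Qed.
Let etaE i : eta i = half ^+ (2 * l * i.+1).
Proof. by rewrite /eta s4 -exprM mulnC. Qed.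
Let eta0 i : 0 < eta i. Proof. by rewrite etaE exprn_gt0. Qed.
Let half_le1 : half <= 1. Proof. by rewrite /half invf_le1 ?ler1n. Qed.
Let s_le i : s i <= half.
Proof. by rewrite /s -[leRHS]expr1 ler_wiXn2l // addnC. Qed.
Let s4_le i : 4 * s i <= 1.
Proof. by rewrite s4 exprn_ile1. Qed.
Let Meta i : (M i)%:R * (eta i ^+ j) ^+ 2 = 1.
Proof.
rewrite ME etaE -!exprM natrX.
have -> : (2 * l * i.+1 * (j * 2) = 4 * j * l * i.+1)%N by lia.
by rewrite -exprMn /half mulfV ?expr1n // pnatr_eq0.
Qed.
Let K2 i : (2 <= K i)%N.
Proof.
have : (1 < 4 * j * l * i.+1)%N by have := muln_gt0 j l; rewrite j0 l0 /=; nia.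
rewrite /K; case: (4 * j * l * i.+1)%N => [//|[//|m]] _ /=.
by rewrite expnS leq_pmulr // expn_gt0.
Qed.

Let HP i w : nc w <= s i -> nc P.[w] <= 1.
Proof.
move=> ws; apply: le_trans wP; apply: horner_le_wnorm => //.
exact: le_trans ws (s_le i).
Qed.

Let HQ i w : nc w <= s i ->
  nc Q.[w] ^+ j <= nc P.[w] ^+ j.+1 + (eta i ^+ j) ^+ j.+1.
Proof.
move=> ws; have wh : nc w <= half := le_trans ws (s_le i).
set E := P ^+ j.+1 - Q ^+ j.
have -> : nc Q.[w] ^+ j = nc (P.[w] ^+ j.+1 - E.[w]).
  by rewrite /E !hornerE opprB addrC subrK ncX.
apply: le_trans (ncB _ _) _; rewrite ncX lerD2l.
apply: le_trans (horner_le_tail h0 wh (m := n.+1) _) _; first by move=> a /PQ.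
have wE : wnorm half E <= 2.
  apply: le_trans (wnormB _ _ h0') _; rewrite -[2]/(1 + 1) lerD //.
    by apply: le_trans (wnormX _ _ h0') _; rewrite exprn_ile1 ?wnorm_ge0.
  by apply: le_trans (wnormX _ _ h0') _; rewrite exprn_ile1 ?wnorm_ge0.
have w2 : nc w / half <= 2 * s i by rewrite /half invrK mulrC ler_pM2l.
have w20 : 0 <= nc w / half by rewrite divr_ge0 ?nc_ge0.
apply: (@le_trans _ _ ((2 * s i) ^+ n.+1 * 2 ^+ n.+1)).
  apply: ler_pM => //; rewrite ?exprn_ge0 ?wnorm_ge0 //.
    by apply: lerXn2r; rewrite ?nnegrE // mulr_ge0 // ltW.
  by apply: le_trans wE _; rewrite -{1}[2]expr1 ler_weXn2l // ler1n.
rewrite -exprMn -mulrA [s i * 2]mulrC mulrA (_ : 2 * 2 = 4); last by ring.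
rewrite /eta -!exprM; apply: ler_wiXn2l => //.
  by rewrite mulr_ge0 // ltW.
by apply: leq_trans nl; apply: eq_leq; ring.
Qed.

(* [J i] is an average of [Q * cj P * chi (|P|^2) * w ^- k], hence close to the average of
   [Q / P * w ^- k], which is [F`_k] on small circles where [P] has no zeros. *)
Let J i := wmean P k (chi R (M i)) Q P.
Let a i := (J i).[((s i / 2) ^+ 2)%:C].

Let step_scale i : nc (a i - (J i).[((s i.+1 / 2) ^+ 2)%:C]) <=
  (4 / s i) ^+ k * (eta i / 2) * (4 / 3 * harm R (M i) + 96).
Proof.
rewrite /a sS -mulrA (_ : 2^-1 / 2 = 4^-1); last by field.
exact: (@scale_step_le R P Q j k (K i) (s i) (eta i) j0 (K2 i) (s0 i) (eta0 i) (Meta i) (@HP i) (@HQ i)).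
Qed.

Lemma wmeanB phi psi U V :
  wmean P k (phi - psi) U V = wmean P k phi U V - wmean P k psi U V.
Proof.
pose N := (size (phi - psi)%R + size phi + size psi)%N.
have [s1 s2 s3] : [/\ size (phi - psi)%R <= N, size phi <= N & size psi <= N]%N.
  by rewrite /N; split; lia.
rewrite (wmean_widen _ _ _ _ s1) (wmean_widen _ _ _ _ s2) (wmean_widen _ _ _ _ s3) -sumrB.
by apply: eq_bigr => b _; rewrite coefB rmorphB scalerBl.
Qed.

Let step_switch i :
  nc ((J i).[((s i.+1 / 2) ^+ 2)%:C] - a i.+1) <= (4 / s i) ^+ k * (4 * eta i).
Proof.
have r0 : 0 < s i.+1 / 2 by rewrite divr_gt0.
rewrite nc_dist /a -hornerN -hornerD /J -wmeanB.
have -> : (4 / s i) ^+ k = ((s i.+1 / 2) ^+ k)^-1.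
  by rewrite -[RHS]exprVn; congr (_ ^+ _); rewrite sS !invfM !invrK; field; rewrite gt_eqF.
rewrite [leRHS]mulrC ler_pdivlMr ?exprn_gt0 //.
have := @wmean_le R P k (chi R (M i.+1) - chi R (M i)) Q P (s i.+1 / 2) (4 * eta i).
rewrite gtr0_norm //; apply => w wr.
have ws : nc w <= s i.+1 by rewrite wr; have := s0 i.+1; lra.
have x1 : pmod2 P w <= 1 by rewrite exprn_ile1 ?nc_ge0 // (HP ws).
have MM : (M i <= M i.+1)%N by rewrite !ME leq_exp2l // leq_mul2l leqnSn orbT.
rewrite hornerD hornerN ger0_norm ?subr_ge0 ?chi_mono // mulrC.
apply: (@switch_bound R j (nc P.[w]) (nc Q.[w]) (eta i) (eta i.+1)) => //.
- by rewrite nc_ge0 (HP ws).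
- exact: nc_ge0.
- by rewrite !etaE ler_wiXn2l // leq_mul2l leqnSn orbT.
- exact: HQ.
Qed.

(** The balance of exponents: with [k <= l], the factor [s ^- k] uses up only [l] of the [2 l]
    powers of [s] in [eta]; the other [l] still leave [2 ^- i]. *)
Let scale_le i : (4 / s i) ^+ k * eta i <= 8 ^+ l * half ^+ i.
Proof.
have e5 : 4 / s i = 2 ^+ (i + 5).
  by rewrite /s /half exprVn invrK !exprD; ring.
have b1 : 1 <= 4 / s i :> R by rewrite e5 exprn_ege1 // ler1n.
apply: (@le_trans _ _ ((4 / s i) ^+ l * eta i)).
  by rewrite ler_wpM2r ?(ltW (eta0 i)) // ler_weXn2l.
rewrite e5 etaE -!exprM.
have -> : (2 * l * i.+1 = (i + 2) * l + i * l)%N by lia.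
have -> : ((i + 5) * l = (i + 2) * l + 3 * l)%N by lia.
rewrite !exprD mulrACA -exprMn (_ : 2 * half = 1); last by rewrite /half mulfV.
rewrite expr1n mul1r expr0 mulr1 -!exprMn (_ : 2 * (2 * 2) = 8); last by ring.
rewrite ler_wpM2l ?exprn_ge0 // ler_wiXn2l // leq_pmulr //.
Qed.

(** [harm_exp2] bounds [harm (M i)] by [4 j l (i + 1) + 1], essentially the binary logarithm of
    [M i]; this linear growth is harmless against [2 ^- i]. In the proof, [52 = 96 / 2 + 4], the 4
    coming from the change of [chi]. *)
Let step i : nc (a i - a i.+1) <= 57 * (j * l)%:R * 8 ^+ l * (i.+1%:R * half ^+ i).
Proof.
rewrite -(subrK (J i).[((s i.+1 / 2) ^+ 2)%:C] (a i)) -addrA.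
apply: le_trans (ncD _ _) _; apply: le_trans (lerD (step_scale i) (step_switch i)) _.
have H : harm R (M i) <= (4 * j * l * i.+1).+1%:R by rewrite ME; exact: harm_exp2.
have H0 : 0 <= harm R (M i) by apply: sumr_ge0 => b _; rewrite invr_ge0 ler0n.
have H1 : 4 / 3 * harm R (M i) / 2 + 52 <= 57 * (j * l)%:R * i.+1%:R.
  have -> : 57 * (j * l)%:R * i.+1%:R = 4 * (j * l * i.+1)%:R + 53 * (j * l * i.+1)%:R :> R.
    by rewrite natrM; ring.
  have : 1 <= (j * l * i.+1)%:R :> R by rewrite ler1n !muln_gt0 j0 l0.
  have E : (4 * j * l * i.+1).+1%:R = 4 * (j * l * i.+1)%:R + 1 :> R.
    by rewrite -addn1 natrD -!mulnA natrM.
  move: H H0; rewrite E; set u := (_ * _)%:R; set v := harm R _ => *; lra.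
apply: (@le_trans _ _ ((4 / s i) ^+ k * eta i * (57 * (j * l)%:R * i.+1%:R))).
  have c0 : 0 <= (4 / s i) ^+ k * eta i.
    by rewrite mulr_ge0 ?(ltW (eta0 i)) // exprn_ge0 // divr_ge0 // ltW.
  apply: le_trans (ler_wpM2l c0 H1).
  by apply: le_of_eq; field.
have w0 : 0 <= 57 * (j * l)%:R * i.+1%:R :> R.
  by apply: mulr_ge0; [apply: mulr_ge0|]; exact: ler0n.
apply: le_trans (ler_wpM2r w0 (scale_le i)) _.
by apply: le_of_eq; ring.
Qed.

Let sum_half m : \sum_(i < m) (i.+1%:R * half ^+ i) <= 4.
Proof.
suff E : \sum_(i < m) (i.+1%:R * half ^+ i) = 4 - (2 * m + 4)%:R * half ^+ m.
  by rewrite E lerBlDr lerDl mulr_ge0 ?ler0n ?exprn_ge0.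
elim: m => [|m IH]; first by rewrite big_ord0 expr0 mulr1 muln0 add0n subrr.
rewrite big_ord_recr /= IH !natrD !natrM exprS -!natr1.
by set x := half ^+ m; rewrite /half; field.
Qed.

(** The outermost circle has radius [s 0 / 2 = 1 / 16]; there the integrand without [w ^- k] is
    bounded by 2, and [w ^- k] costs [16 ^ k]. *)
Let a0_le : nc (a 0) <= 2 * 16 ^+ l.
Proof.
have r0 : 0 < s 0 / 2 by rewrite divr_gt0.
have e16 : s 0 / 2 = 16^-1 by rewrite /s /half; field.
have H : nc (a 0) * (s 0 / 2) ^+ k <= 2.
  have := @wmean_le R P k (chi R (M 0)) Q P (s 0 / 2) 2.
  rewrite gtr0_norm //; apply => w wr.
  have ws : nc w <= s 0 by rewrite wr; have := s0 0; lra.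
  have p01 : 0 <= nc P.[w] <= 1 by rewrite nc_ge0 (HP ws).
  have x1 : pmod2 P w <= 1 by rewrite exprn_ile1 ?nc_ge0 // (HP ws).
  rewrite ger0_norm ?chi_ge0 // mulrC.
  rewrite -(@ler_pXn2r _ j) ?nnegrE ?mulr_ge0 ?nc_ge0 ?chi_ge0 //.
  apply: le_trans (cutoff_bound j0 p01 (nc_ge0 _) (eta0 0) (HQ ws) (Meta 0)) _.
  apply: (@le_trans _ _ 2); last by rewrite -{1}[2]expr1 ler_weXn2l // ler1n.
  rewrite ler_piMr // ge_max (HP ws) exprn_ile1 ?(ltW (eta0 0)) //.
  by rewrite etaE exprn_ile1.
rewrite -ler_pdivlMr ?exprn_gt0 // e16 exprVn invrK in H.
apply: le_trans H _; rewrite ler_pM2l // ler_weXn2l // ler1n //.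
Qed.

Let aN_le m : nc (a 0 - a m) <= 228 * (j * l)%:R * 8 ^+ l.
Proof.
have -> : a 0 - a m = \sum_(i < m) (a i - a i.+1).
  rewrite -(big_mkord xpredT (fun i => a i - a i.+1)).
  rewrite (@telescope_sumr_eq _ 0 m (fun i => - a i)) // => [|i _].
    by rewrite opprK addrC.
  by rewrite opprK addrC.
apply: le_trans (nc_sum _ _ _) _.
apply: (@le_trans _ _ (\sum_(i < m) 57 * (j * l)%:R * 8 ^+ l * (i.+1%:R * half ^+ i))).
  by apply: ler_sum => i _; exact: step.
rewrite -mulr_sumr.
have c0 : 0 <= 57 * (j * l)%:R * 8 ^+ l :> R.
  by apply: mulr_ge0; [apply: mulr_ge0; exact: ler0n|apply: exprn_ge0].
apply: le_trans (ler_wpM2l c0 (sum_half m)) _.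
by apply: le_of_eq; ring.
Qed.

Let Fk : {poly C} := take_poly k.+1 F.
Let V : {poly C} := drop_poly k.+1 (Q - P * Fk).

Let QV : Q = P * Fk + V * 'X^(k.+1).
Proof.
suff : take_poly k.+1 (Q - P * Fk) = 0.
  by move=> T; have := poly_take_drop k.+1 (Q - P * Fk);
     rewrite T add0r => ->; rewrite addrC subrK.
apply/polyP => i; rewrite coef0 coef_take_poly; case: ltnP => // ik.
rewrite coefB; apply/eqP; rewrite subr_eq0; apply/eqP.
rewrite -PF // !coefM; apply: eq_bigr => b _; congr (_ * _).
by rewrite coef_take_poly ifT // ltnS (leq_trans (leq_subr _ _)).
Qed.

Let p0 : R := nc P`_0.
Let p0_gt0 : 0 < p0.
Proof. by rewrite lt_def nc_ge0 nc_eq0 P0. Qed.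

Let P_ge w : nc w <= p0 / 4 -> p0 / 2 <= nc P.[w].
Proof.
move=> w4; have w2 : p0 <= 1.
  apply: le_trans wP; rewrite (@wnorm_widen _ _ _ (size P).+1) // big_ord_recl.
  rewrite expr0 mulr1 lerDl; apply: sumr_ge0 => i _.
  by rewrite mulr_ge0 ?nc_ge0 ?exprn_ge0.
have wh : nc w <= half by apply: le_trans w4 _; rewrite /half; lra.
set D := P - (P`_0)%:P.
have D0 i : (i < 1)%N -> D`_i = 0.
  by case: i => // _; rewrite coefB coefC eqxx subrr.
have := horner_le_tail h0 wh D0; rewrite expr1 /half invrK => H1.
have wD : wnorm half D <= 1.
  apply: le_trans wP; rewrite !(@wnorm_widen _ _ _ (size P).+1) //; last first.
    apply: leq_trans (size_polyD _ _) _; rewrite size_polyN geq_max leqnSn.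
    by apply: leq_trans (size_polyC_leq1 _) _.
  apply: ler_sum => i _; rewrite ler_wpM2r ?exprn_ge0 // coefB coefC.
  by case: (i : nat) => [|b] /=; rewrite ?subrr ?nc0 ?nc_ge0 // subr0.
have H2 : nc D.[w] <= nc w * 2.
  apply: le_trans H1 _; rewrite ler_piMr // mulr_ge0 ?nc_ge0 //.
have : p0 <= nc P.[w] + nc D.[w].
  have -> : p0 = nc (P.[w] - D.[w]) by rewrite !hornerE opprB addrC subrK.
  exact: ncB.
move: H2 w4; set x := nc w; set y := nc D.[w]; set z := nc P.[w]; lra.
Qed.

(** On small circles [|P| >= p0 / 2], and [chi (|P|^2) * cj P = (1 - (1 - |P|^2) ^ M) / P].
    Inserting [Q = P * Fk + V * w ^ k.+1] compares [J] with the mean of [Fk * w ^- k], which is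
    exactly the [k]-th coefficient of [F]. One error decays because [M] grows, the other because of
    the extra factor [w]. The constants depend on [p0] but disappear in the limit. *)
Let limit_bound i : s i <= p0 / 4 ->
  nc (a i - F`_k) <= (4 * wnorm half Fk / p0 ^+ 2 + 2 * wnorm half V / p0) * half ^+ i.
Proof.
move=> sp; have r0 : 0 < s i / 2 by rewrite divr_gt0.
set rho := s i / 2; have rs : rho <= s i by rewrite /rho; have := s0 i; lra.
have [N1 HN1] := wmean_avg P k (chi R (M i)) Q P rho.
have [N2 HN2] := wmean_avg P k 1 Fk 1 rho.
have [|z zP] := @exists_prim_root R (N1 + N2).+1; first by [].
have E1 := HN1 _ z (leqW (leq_addr _ _)) zP.
have E2 := HN2 _ z (leqW (leq_addl _ _)) zP.
have E3 : (wmean P k 1 Fk 1).[(rho ^+ 2)%:C] = F`_k.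
  rewrite /wmean size_poly1 big_ord1 coef1 eqxx scale1r !expr0 !mulr1.
  rewrite /cmean size_poly1 horner_poly big_ord1 coef1 eqxx expr0 mulr1 add0n.
  by rewrite (_ : cj 1 = 1) ?mulr1 ?coef_take_poly ?ltnSn //; exact: conj_real.
rewrite E3 in E2.
set D := 4 * _ / _ + _.
have H : nc (a i - F`_k) * rho ^+ k <= D * half ^+ i * rho ^+ k; last first.
  by rewrite ler_pM2r ?exprn_gt0 in H.
have -> : nc (a i - F`_k) * rho ^+ k = nc (a i * rho%:C ^+ k - F`_k * rho%:C ^+ k).
  by rewrite -mulrBl ncM ncX nc_real gtr0_norm.
rewrite /a -/rho /J E1 E2 -mulrBr -sumrB ncM ncV nc_nat mulrC ler_pdivrMr ?ltr0n //.
apply: le_trans (nc_sum _ _ _) _.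
apply: (@le_trans _ _ (\sum_(i0 < (N1 + N2).+1) D * half ^+ i * rho ^+ k)); last first.
  by rewrite sumr_const card_ord mulr_natr.
apply: ler_sum => b _; rewrite -mulrBl ncM ncV ncX circle_root // expr1n invr1 mulr1.
set w := rho%:C * z ^+ b.
have wr : nc w = rho by rewrite (nc_circle _ _ zP) gtr0_norm.
have ws : nc w <= s i by rewrite wr.
have wh : nc w <= half by apply: le_trans ws (s_le i).
have pw : p0 / 2 <= nc P.[w] by apply: P_ge; apply: le_trans ws sp.
have pw0 : 0 < nc P.[w] by apply: lt_le_trans pw; rewrite divr_gt0.
have x01 : 0 <= pmod2 P w <= 1 by rewrite sqr_ge0 exprn_ile1 ?nc_ge0 // (HP ws).
set c := (chi R (M i)).[_].
have c0 : 0 <= c by apply: chi_ge0; case/andP: x01.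
have cx : pmod2 P w * c = 1 - (1 - pmod2 P w) ^+ M i by apply: horner_Xchi.
have -> : c%:C * (Q.[w] * cj P.[w]) - (1 : {poly R}).[pmod2 P w]%:C * (Fk.[w] * cj (1 : {poly C}).[w]) =
   - ((1 - pmod2 P w) ^+ M i)%:C * Fk.[w] + c%:C * cj P.[w] * V.[w] * w ^+ k.+1.
  rewrite !hornerC (_ : cj 1 = 1) ?mulr1; last exact: conj_real.
  rewrite mul1r {1}QV hornerD !hornerM hornerXn.
  have -> : (1 - pmod2 P w) ^+ M i = 1 - pmod2 P w * c by rewrite cx; ring.
  rewrite rmorphB rmorphM /= /pmod2 -mulc_conj; ring.
apply: le_trans (ncD _ _) _.
rewrite !ncM ncN !nc_real nc_conj ncX wr ger0_norm; last first.
  by rewrite exprn_ge0 // subr_ge0; case/andP: x01.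
rewrite (ger0_norm c0).
have f0 := wnorm_ge0 Fk h0'; have v0 := wnorm_ge0 V h0'.
have fw := horner_le_wnorm Fk h0 wh; have vw := horner_le_wnorm V h0 wh.
have Mi0 : 0 < (M i)%:R :> R by rewrite ME ltr0n expn_gt0.
have rk : 0 < rho ^+ k by rewrite exprn_gt0.
(* [exp1Bx_le] gives [(1 - x) ^ M <= 1 / (M x)], and [M] is at least [2 ^ i * rho ^- k]: even after
   division by [rho ^ k] the error is of order [2 ^- i]. *)
have decay : (1 - pmod2 P w) ^+ M i <= 4 / p0 ^+ 2 * (half ^+ i * rho ^+ k).
  have B := exp1Bx_le (M i) x01.
  have xp : (p0 / 2) ^+ 2 <= pmod2 P w.
    by apply: lerXn2r; rewrite ?nnegrE ?nc_ge0 // divr_ge0 // ltW.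
  have Z0 : 0 <= (1 - pmod2 P w) ^+ M i.
    by rewrite exprn_ge0 // subr_ge0; case/andP: x01.
  have M1 : 1 <= (M i)%:R * (half ^+ i * rho ^+ k).
    rewrite /rho /s -[_ / 2]/(_ * half) -exprSr -exprM -exprD ME natrX.
    apply: (@le_trans _ _ (2 ^+ (4 * j * l * i.+1) * half ^+ (4 * j * l * i.+1))).
      by rewrite -exprMn /half mulfV ?pnatr_eq0 // expr1n.
    rewrite ler_pM2l ?exprn_gt0 //; apply: ler_wiXn2l => //.
    exact: scale_exponent_le.
  move: B Z0 M1 xp; set Z := (1 - _) ^+ _; set t := half ^+ i * _; set x := pmod2 P w.
  set m := (M i)%:R => B Z0 M1 xp.
  rewrite mulrAC ler_pdivlMr ?exprn_gt0 //.
  have t0 : 0 < t by rewrite mulr_gt0 ?exprn_gt0.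
  have B1 : Z * (m * x) <= 1 by move: B; rewrite mulrDr mulr1; lra.
  have B2 : Z * (m * (p0 / 2) ^+ 2) <= 1.
    by apply: le_trans B1; rewrite ler_wpM2l // ler_wpM2l // ltW.
  have B3 : Z * (p0 / 2) ^+ 2 <= Z * (p0 / 2) ^+ 2 * (m * t).
    by rewrite ler_peMr // mulr_ge0 ?sqr_ge0.
  have B4 : Z * (m * (p0 / 2) ^+ 2) * t <= 1 * t by rewrite ler_wpM2r // ltW.
  have -> : Z * p0 ^+ 2 = 4 * (Z * (p0 / 2) ^+ 2) by field.
  rewrite ler_pM2l //; apply: le_trans B3 _; move: B4; rewrite mul1r => B4.
  by apply: le_trans B4; apply: le_of_eq; ring.
have cP : c * nc P.[w] <= 2 / p0.
  rewrite ler_pdivlMr //.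
  have : nc P.[w] * (nc P.[w] * c) <= 1.
    rewrite mulrA -expr2 -[_ ^+ 2]/(pmod2 P w) cx lerBlDr lerDl exprn_ge0 //.
    by rewrite subr_ge0; case/andP: x01.
  have : p0 / 2 * (nc P.[w] * c) <= nc P.[w] * (nc P.[w] * c).
    by apply: ler_wpM2r pw; rewrite mulr_ge0 // ltW.
  rewrite [c * _]mulrC; set y := nc P.[w] * c; lra.
have -> : D * half ^+ i * rho ^+ k = 4 / p0 ^+ 2 * (half ^+ i * rho ^+ k) * wnorm half Fk
   + 2 / p0 * wnorm half V * (half ^+ i * rho ^+ k).
  by rewrite /D; ring.
apply: lerD.
  apply: ler_pM => //; last exact: nc_ge0.
  by rewrite exprn_ge0 // subr_ge0; case/andP: x01.
apply: ler_pM; rewrite ?mulr_ge0 ?nc_ge0 ?exprn_ge0 ?(ltW r0) //.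
  by apply: ler_pM; rewrite ?mulr_ge0 ?nc_ge0 // ltW.
rewrite exprS ler_pM2r //; apply: le_trans rs _; rewrite /s.
by apply: ler_wiXn2l => //; rewrite leq_addr.
Qed.

Lemma half_exp_small (e : R) : 0 < e -> exists N, forall i, (N <= i)%N -> 2^-1 ^+ i < e.
Proof.
move=> e0; exists (Num.bound e^-1) => i Ni.
rewrite exprVn invf_plt ?posrE ?exprn_gt0 //.
apply: lt_le_trans (archi_boundP _) _; first by rewrite invr_ge0 ltW.
by rewrite -natrX ler_nat (leq_trans Ni) // ltnW // ltn_expl.
Qed.

(** [a 0] is bounded outright, [a 0 - a i] by a convergent series, and [a i] tends to the
    coefficient. The value of [P] at 0 influences only the speed of this convergence, so it is
    absent from the bound. *)
Lemma quotient_coef_le : nc F`_k <= (230 * j)%:R * 32 ^+ l.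
Proof.
set D := 4 * wnorm half Fk / p0 ^+ 2 + 2 * wnorm half V / p0.
suff H : nc F`_k <= 228 * (j * l)%:R * 8 ^+ l + 2 * 16 ^+ l.
  apply: le_trans H _.
  have h1 : l%:R * 8 ^+ l <= 16 ^+ l :> R.
    rewrite (_ : 16 = 2 * 8) ?exprMn; last by ring.
    by rewrite ler_wpM2r ?exprn_ge0 // -natrX ler_nat ltnW // ltn_expl.
  have h2 : 16 ^+ l <= 32 ^+ l :> R.
    by apply: lerXn2r; rewrite ?nnegrE ?ler0n // ler_nat.
  have h3 : 1 <= j%:R :> R by rewrite ler1n.
  have h4 : 0 <= 16 ^+ l :> R by apply: exprn_ge0; exact: ler0n.
  rewrite !natrM; move: h1 h2 h3 h4.
  set A := 16 ^+ l; set B := 32 ^+ l; set c := 8 ^+ l; set u := l%:R; set v := j%:R => h1 h2 h3 h4.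
  have g1 : v * (u * c) <= v * A by apply: ler_wpM2l h1; exact: ler0n.
  have g2 : v * A <= v * B by apply: ler_wpM2l h2; exact: ler0n.
  have g3 : A <= v * A by rewrite ler_peMl.
  have -> : 228 * (v * u) * c = 228 * (v * (u * c)) by ring.
  by rewrite -mulrA; lra.
have D0 : 0 <= D.
  by apply: addr_ge0; rewrite !(mulr_ge0, invr_ge0, exprn_ge0) ?wnorm_ge0 ?(ltW p0_gt0).
apply/ler_addgt0Pr => e e0.
have [N1 HN1] := half_exp_small (divr_gt0 p0_gt0 (ltr0Sn R 3)).
have D1 : 0 < D + 1 by rewrite ltr_wpDl.
have [N2 HN2] := half_exp_small (divr_gt0 e0 D1).
pose i := (N1 + N2)%N.
have si : s i <= p0 / 4.
  by rewrite ltW // HN1 // /i -!addnA leq_addr.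
have di : D * half ^+ i <= e.
  have : half ^+ i < e / (D + 1) by apply: HN2; rewrite leq_addl.
  rewrite ltr_pdivlMr // => /ltW; apply: le_trans; rewrite mulrC ler_pM2l ?exprn_gt0 //.
  by rewrite lerDl.
have -> : F`_k = a 0 - (a 0 - a i) - (a i - F`_k) by rewrite !opprB; ring.
apply: le_trans (ncB _ _) _; apply: lerD; last exact: le_trans (limit_bound si) di.
apply: le_trans (ncB _ _) _; rewrite addrC; apply: lerD; [exact: aN_le|exact: a0_le].
Qed.

End QuotientCoef.

(** * Weight sequences and formal series *)

Lemma expn_fact_le N k : (N ^ k * N`! <= (N + k)`!)%N.
Proof.
elim: k => [|k IH]; first by rewrite expn0 mul1n addn0.
by rewrite expnS -mulnA addnS factS leq_mul // leqW // leq_addr.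
Qed.

Lemma bin_le_exp2 n m : ('C(n, m) <= 2 ^ n)%N.
Proof.
elim: n m => [|n IH] [|m] //; first by rewrite bin0 expn_gt0.
by rewrite binS expnS mul2n -addnn leq_add.
Qed.

(** A crude Stirling bound: [N ^ k * N! <= (N + k)!], and the binomial coefficient
    [(N + k)! / (N! k!)] is at most [2 ^ (2 N)]. *)
Lemma expn_le_fact N k : (k <= N)%N -> (N ^ k <= k`! * 4 ^ N)%N.
Proof.
move=> kN; rewrite -(@leq_pmul2r N`!) ?fact_gt0 //.
apply: leq_trans (expn_fact_le _ _) _.
have := bin_fact (leq_addl N k); rewrite addnK => <-.
rewrite [(k`! * _ * _)%N]mulnAC [leqLHS]mulnC leq_mul //.
apply: leq_trans (bin_le_exp2 _ _) _.
by rewrite (_ : 4 = 2 ^ 2)%N // -expnM leq_exp2l // mul2n -addnn leq_add2l.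
Qed.

Lemma fact_le_expn n : (n`! <= n ^ n)%N.
Proof.
elim: n => // n IH; rewrite factS expnS leq_mul //.
by apply: leq_trans IH _; case: n => // n; rewrite leq_exp2r.
Qed.

Lemma fact_expn_le b l : (l`! ^ b <= (b * l)`!)%N.
Proof.
elim: b => [|b IH]; first by rewrite expn0 mul0n.
have := bin_fact (leq_addr (b * l)%N l); rewrite addKn => E.
rewrite mulSn -E expnS; apply: leq_trans (leq_pmull _ _); last first.
  by rewrite bin_gt0 leq_addr.
by rewrite leq_mul.
Qed.

Section Weights.
Variable R : realType.
Variable M : nat -> R.
Hypothesis HM : weight_seq M.

Lemma weight0 : M 0%N = 1. Proof. by case: HM. Qed.
Lemma weight_gt0 k : 0 < M k. Proof. by case: HM => _ []. Qed.

Lemma mu_mono i k : (i <= k)%N -> mu M i <= mu M k.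
Proof.
case: HM => _ [_ [H _]]; elim: k => [|k IH]; first by rewrite leqn0 => /eqP ->.
rewrite leq_eqVlt => /predU1P[->//|]; rewrite ltnS => /IH; move/le_trans; exact.
Qed.

Lemma weightS k : M k.+1 = mu M k.+1 * M k.
Proof. by rewrite /= divfK // gt_eqF // weight_gt0. Qed.

Lemma mu_gt0 k : 0 < mu M k.
Proof. by case: k => [|k] //=; rewrite divr_gt0 ?weight_gt0. Qed.

Lemma weight_le_mu k n : (k <= n)%N -> M k <= mu M n ^+ k.
Proof.
elim: k => [|k IH] kn; first by rewrite weight0 expr0.
rewrite weightS exprS ler_pM ?(ltW (mu_gt0 _)) ?(ltW (weight_gt0 _)) //.
  exact: mu_mono.
by apply: IH; exact: ltnW.
Qed.

Lemma weight_log_convex k n : (k <= n)%N -> M k ^+ n <= M n ^+ k.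
Proof.
elim: n => [|n IH]; first by rewrite leqn0 => /eqP ->.
rewrite leq_eqVlt => /predU1P[-> //|]; rewrite ltnS => kn.
rewrite exprS weightS exprMn ler_pM ?exprn_ge0 ?(ltW (weight_gt0 _)) //.
  exact: weight_le_mu (leqW kn).
exact: IH.
Qed.

(* The radius [r] at which the top term [M N / N! * r ^+ N] equals 1 controls all lower
   terms, because [M] is log-convex. *)
Lemma weight_radius N : (0 < N)%N -> exists r : R,
  [/\ 0 < r, r ^+ N * M N = N`!%:R &
     forall k, (k <= N)%N -> M k / k`!%:R * r ^+ k <= 4 ^+ N].
Proof.
move=> N0; pose x : R := N`!%:R / M N.
have x0 : 0 < x by rewrite divr_gt0 ?weight_gt0 // ltr0n fact_gt0.
pose r := x `^ (N%:R^-1); have r0 : 0 < r by rewrite powR_gt0.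
have rN : r ^+ N = x.
  by rewrite -powR_mulrn ?(ltW r0) // -powRrM mulVf ?powRr1 ?(ltW x0) // pnatr_eq0 -lt0n.
exists r; split => // [|k kN]; first by rewrite rN divfK // gt_eqF // weight_gt0.
rewrite mulrAC ler_pdivrMr ?ltr0n ?fact_gt0 //.
have k0 : 0 <= 4 ^+ N * k`!%:R :> R by rewrite mulr_ge0 ?exprn_ge0 ?ler0n.
have M0 := ltW (weight_gt0 k).
rewrite -(@ler_pXn2r _ N) ?nnegrE ?mulr_ge0 ?exprn_ge0 ?(ltW r0) //.
rewrite exprMn -exprM mulnC exprM rN.
apply: (@le_trans _ _ (M N ^+ k * x ^+ k)).
  by rewrite ler_wpM2r ?exprn_ge0 ?(ltW x0) // weight_log_convex.
rewrite -exprMn /x mulrC divfK ?gt_eqF ?weight_gt0 // -!natrX -natrM -natrX ler_nat.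
apply: (@leq_trans ((N ^ N) ^ k)); first by case: (k) => [|k'] //; rewrite leq_exp2r ?fact_le_expn.
by rewrite -expnM mulnC expnM leq_exp2r // mulnC expn_le_fact.
Qed.

End Weights.

Section ModerateGrowth.
Variable R : realType.
Variable WM : set (nat -> R).
Hypotheses (HW : weight_matrix WM) (HG : R_moderate_growth WM).

Lemma moderate_growth M : WM M -> exists2 N, WM N & exists2 c : R, 1 <= c &
  forall i k, M (i + k)%N <= c ^+ (i + k) * (N i * N k).
Proof.
move=> WMM; have [N [WN mgN]] := HG WMM.
exists N => //.
have N0 k : 0 < N k by apply: weight_gt0; apply: HW.1.
have M0 k : 0 < M k by apply: weight_gt0; apply: HW.1.
have [c0 Hc] : exists c, (mg M N <= c%:E)%E.
  move: mgN; case: (mg M N) => [r _|//|_]; first by exists r; exact: lexx.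
  by exists 0; exact: leNye.
exists (Num.max 1 c0); first by rewrite le_max lexx.
move=> i k; have [ik|] := posnP (i + k)%N.
  move/eqP: ik; rewrite addn_eq0 => /andP[/eqP -> /eqP ->].
  by rewrite addn0 expr0 (weight0 (HW.1 _ WMM)) (weight0 (HW.1 _ WN)) !mul1r.
move=> ik; rewrite -ler_pdivrMr ?mulr_gt0 //.
set x := _ / _; have x0 : 0 < x by rewrite divr_gt0 ?mulr_gt0.
have : x `^ ((i + k)%:R^-1) <= Num.max 1 c0.
  rewrite le_max; apply/orP; right; rewrite -lee_fin.
  by apply: le_trans Hc; apply: ereal_sup_ubound; exists i, k.
set y := _ `^ _ => yc.
have -> : x = y ^+ (i + k).
  rewrite -powR_mulrn ?powR_ge0 // -powRrM mulVf ?powRr1 ?(ltW x0) //.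
  by rewrite pnatr_eq0 -lt0n.
by apply: lerXn2r => //; rewrite nnegrE ?powR_ge0 // le_max ler01.
Qed.

(** Doubling [a] times, each time passing to another sequence of the matrix. A coefficient of order
    [l] will be estimated from a truncation at order [2 ^ a * l]. *)
Lemma moderate_growth_iter M a : WM M -> exists2 N, WM N & exists2 c : R, 1 <= c &
  forall l, M (2 ^ a * l)%N <= c ^+ l * N l ^+ (2 ^ a).
Proof.
elim: a M => [|a IH] M WMM.
  exists M => //; exists 1 => // l.
  by rewrite expn0 mul1n expr1n mul1r expr1.
have [N1 WN1 [c1 c11 H1]] := moderate_growth WMM.
have [N WN [c c1' H]] := IH _ WN1.
have N10 k : 0 < N1 k by apply: weight_gt0; apply: HW.1.
have N0 k : 0 < N k by apply: weight_gt0; apply: HW.1.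
exists N => //; exists (c1 ^+ (2 ^ a.+1) * c ^+ 2); first by rewrite mulr_ege1 ?exprn_ege1.
move=> l; rewrite [in M _]expnS mul2n -addnn mulnDl; apply: le_trans (H1 _ _) _.
rewrite exprMn -!exprM -mulrA -mulnDl addnn -mul2n -expnS; apply: ler_wpM2l.
  by rewrite exprn_ge0 // (le_trans _ c11).
rewrite mul2n -addnn exprD expnS mul2n -addnn exprD mulrACA.
by apply: ler_pM; rewrite ?(ltW (N10 _)).
Qed.

End ModerateGrowth.

(** * Formal division and weighted bounds for its coefficients *)

Section PolyScaling.
Local Open Scope complex_scope.
Variable R : realType.
Local Notation C := R[i].
Implicit Types (p : {poly C}) (G F H : nat -> C).

Definition trunc G n : {poly C} := \poly_(k < n) G k.

Lemma coef_trunc G n i : (trunc G n)`_i = if (i < n)%N then G i else 0.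
Proof. exact: coef_poly. Qed.

Lemma coef_comp_scale p c i : (p \Po (c *: 'X))`_i = c ^+ i * p`_i.
Proof.
rewrite comp_polyE coef_sum.
under eq_bigr do rewrite exprZn scalerA coefZ coefXn.
have [ip|pi] := ltnP i (size p).
  rewrite (bigD1 (Ordinal ip)) //= eqxx mulr1 big1 ?addr0 1?mulrC // => b /negPf.
  by rewrite -(inj_eq val_inj) /= eq_sym => ->; rewrite mulr0.
rewrite nth_default // mulr0 big1 // => b _.
by rewrite gtn_eqF ?mulr0 // (leq_trans (ltn_ord b)).
Qed.

Lemma series_div G H : G 0%N != 0 ->
  exists F, forall n i, (i < n)%N -> (trunc G n * trunc F n)`_i = H i.
Proof.
move=> G0.
pose next (s : seq C) := (H (size s) -
   \sum_(i < size s) G (size s - i)%N * nth 0 s i) / G 0%N.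
(* Each coefficient depends on all earlier ones, so the list of the first [n] coefficients is built
   and extended by one at each stage. *)
pose fl := fix fl n := if n is n'.+1 then rcons (fl n') (next (fl n')) else [::].
have sz n : size (fl n) = n by elim: n => //= n IH; rewrite size_rcons IH.
have nth_fl n i : (i < n)%N -> nth 0 (fl n) i = nth 0 (fl i.+1) i.
  elim: n => // n IH; rewrite ltnS leq_eqVlt => /predU1P[-> //|ilt].
  by rewrite /= nth_rcons sz ilt IH.
exists (fun k => nth 0 (fl k.+1) k) => n i ilt.
rewrite mulrC coefM big_ord_recr /= subnn !coef_trunc ilt (leq_ltn_trans _ ilt) //.
rewrite [X in _ + X * _]nth_rcons sz ltnn eqxx /next sz divfK // addrC.
rewrite -addrA [X in _ + X](_ : _ = 0) ?addr0 // addrC -sumrB big1 // => b _.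
rewrite !coef_trunc (ltn_trans (ltn_ord b) ilt).
rewrite (leq_ltn_trans (leq_subr _ _) ilt) [in X in X - _]mulrC.
by rewrite (nth_fl i b) // subrr.
Qed.

End PolyScaling.

Section CoefBound.
Local Open Scope complex_scope.
Variable R : realType.
Local Notation C := R[i].
Variables (M : nat -> R) (j : nat).
Hypotheses (HM : weight_seq M) (j0 : (0 < j)%N).
Variables (G H F : nat -> C) (A s : R).
Hypotheses (A1 : 1 <= A) (s0 : 0 < s).
Hypothesis (HG : forall k, nc (G k) <= A * s ^+ k * (M k / k`!%:R)).
Hypothesis (HH : forall k, nc (H k) <= A * s ^+ k * (M k / k`!%:R)).
Hypothesis G0 : G 0%N != 0.
Hypothesis GH : forall n i, (i < n)%N -> (trunc G n ^+ j.+1 - trunc H n ^+ j)`_i = 0.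
Hypothesis GF : forall n i, (i < n)%N -> (trunc G n * trunc F n)`_i = H i.

Lemma sum_half_le n : \sum_(i < n) (2^-1 : R) ^+ i <= 2.
Proof.
suff -> : \sum_(i < n) (2^-1 : R) ^+ i = 2 - 2 * 2^-1 ^+ n.
  by rewrite lerBlDr lerDl mulr_ge0 ?exprn_ge0 ?invr_ge0 ?ler0n.
elim: n => [|n IH]; first by rewrite big_ord0 expr0 mulr1 subrr.
by rewrite big_ord_recr /= IH exprS; field.
Qed.

Let wnorm_scaled (K : nat -> C) N r : (0 < N)%N -> 0 < r ->
  (forall k, (k <= N)%N -> M k / k`!%:R * r ^+ k <= 4 ^+ N) ->
  (forall k, nc (K k) <= A * s ^+ k * (M k / k`!%:R)) ->
  wnorm 2^-1 (trunc K N \Po ((r / s)%:C *: 'X)) <= 2 * A * 4 ^+ N.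
Proof.
move=> N0 r0 Mr HK; have A0 : 0 <= A by apply: le_trans A1.
rewrite (@wnorm_widen _ _ _ N); last first.
  apply/leq_sizeP => i Ni; rewrite coef_comp_scale coef_trunc ltnNge Ni /= mulr0 //.
apply: (@le_trans _ _ (\sum_(i < N) A * 4 ^+ N * 2^-1 ^+ i)).
  apply: ler_sum => i _; rewrite ler_wpM2r ?exprn_ge0 ?invr_ge0 ?ler0n //.
  rewrite coef_comp_scale coef_trunc ltn_ord ncM ncX nc_real ger0_norm; last first.
    by rewrite divr_ge0 // ltW.
  have rs : 0 <= (r / s) ^+ i by rewrite exprn_ge0 // divr_ge0 // ltW.
  apply: le_trans (ler_wpM2l rs (HK i)) _.
  have -> : (r / s) ^+ i * (A * s ^+ i * (M i / i`!%:R)) = A * (M i / i`!%:R * r ^+ i).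
    by rewrite expr_div_n; field; rewrite expf_neq0 // ?gt_eqF // pnatr_eq0 -lt0n fact_gt0.
  by rewrite ler_wpM2l // Mr // ltnW.
rewrite -mulr_sumr.
have c0 : 0 <= A * 4 ^+ N by rewrite mulr_ge0 // exprn_ge0 // ler0n.
apply: le_trans (ler_wpM2l c0 (sum_half_le N)) _; apply: le_of_eq; ring.
Qed.

(** Rescaling to the normalized situation. The factors [lam ^- j], [lam ^- j.+1] and [lam ^- 1] for
    [G], [H] and [F] are those of [f ^ j], [f ^ j.+1] and [f] when [f] is divided by [lam], so both
    identities persist; as [lam >= 1], the rescaled [G] and [H] have norm at most 1. *)
Lemma coef_bound_radius l k N r : (0 < l)%N -> (k <= l)%N -> (k < N)%N -> 0 < r ->
  (2 * j * j.+1 * l <= N)%N ->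
  (forall k, (k <= N)%N -> M k / k`!%:R * r ^+ k <= 4 ^+ N) ->
  nc (F k) * (r / s) ^+ k <= (230 * j)%:R * 32 ^+ l * (2 * A * 4 ^+ N).
Proof.
move=> l0 kl kN r0 lN Mr.
pose lam : R := 2 * A * 4 ^+ N.
have lam1 : 1 <= lam.
  by rewrite /lam mulr_ege1 ?exprn_ege1 ?ler1n // mulr_ege1 ?ler1n.
have lam0 : 0 < lam by apply: lt_le_trans lam1.
pose c := (r / s)%:C.
pose sc (e : nat) (K : nat -> C) := ((lam ^- e)%:C *: (trunc K N \Po (c *: 'X)) : {poly C}).
have N0 : (0 < N)%N by apply: leq_ltn_trans kN.
have lamV e : 0 <= lam ^- e by rewrite invr_ge0 exprn_ge0 // ltW.
have wsc e K : (0 < e)%N -> (forall k, nc (K k) <= A * s ^+ k * (M k / k`!%:R)) ->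
    wnorm 2^-1 (sc e K) <= 1.
  move=> e0 HK; rewrite wnormZ nc_real ger0_norm //.
  have := wnorm_scaled N0 r0 Mr HK; rewrite -/lam -/c => W.
  rewrite mulrC ler_pdivrMr ?exprn_gt0 // mul1r; apply: le_trans W _.
  by rewrite -{1}[lam]expr1 ler_weXn2l.
have scX e K m : (sc e K) ^+ m = (lam ^- (e * m))%:C *: ((trunc K N ^+ m) \Po (c *: 'X)).
  by rewrite /sc exprZn -RealCX (rmorphXn (comp_poly _)) exprVn exprM.
have lamC : lam%:C != 0 by rewrite (inj_eq (@complexI R)) gt_eqF.
have := @quotient_coef_le R (sc j G) (sc j.+1 H) (sc 1%N F) j l k N.-1 j0 l0 kl.
rewrite prednK // => /(_ lN (wsc j G j0 HG) (wsc j.+1 H (ltn0Sn j) HH)).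
have fk : nc (sc 1%N F)`_k = nc (F k) * (r / s) ^+ k / lam.
  rewrite /sc coefZ coef_comp_scale coef_trunc kN !ncM ncX !nc_real expr1.
  by rewrite !ger0_norm ?invr_ge0 ?divr_ge0 ?(ltW lam0) ?(ltW r0) ?(ltW s0) //; ring.
rewrite fk ler_pdivrMr // => H1; apply: H1.
- rewrite /sc coefZ coef_comp_scale coef_trunc N0 expr0 mul1r mulf_neq0 //.
  by rewrite (inj_eq (@complexI R)) invr_eq0 expf_neq0 // gt_eqF.
- move=> i iN; rewrite !scX mulnC -scalerBr coefZ -comp_polyB coef_comp_scale GH ?mulr0 //.
  by rewrite -(prednK N0) ltnS.
- move=> i ik; have iN : (i < N)%N by apply: leq_ltn_trans kN.
  rewrite /sc -scalerAl -scalerAr scalerA !coefZ -comp_polyM !coef_comp_scale GF //.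
  rewrite coef_trunc iN -rmorphM; congr (_%:C * _).
  by rewrite expr1 -invfM -exprSr.
Qed.

End CoefBound.

Section Weighted.
Local Open Scope complex_scope.
Variable R : realType.
Local Notation C := R[i].
Variables (WM : set (nat -> R)) (M : nat -> R) (j : nat).
Hypotheses (HW : weight_matrix WM) (HG : R_moderate_growth WM).
Hypotheses (WMM : WM M) (j0 : (0 < j)%N).

(** For the coefficient of order [k > 0] the truncation is at [b * k], with the radius [r] of
    [weight_radius]. The lower terms are then at most [4 ^ (b k)], geometric in [k], and moderate
    growth turns [r ^- k] into [c ^ k * N k / k!]. *)
Lemma coef_bound : exists2 N, WM N & exists2 T : R, 1 <= T &
  forall (G H F : nat -> C) (A s : R), 1 <= A -> 0 < s ->
  (forall k, nc (G k) <= A * s ^+ k * (M k / k`!%:R)) ->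
  (forall k, nc (H k) <= A * s ^+ k * (M k / k`!%:R)) ->
  G 0%N != 0 ->
  (forall n i, (i < n)%N -> (trunc G n ^+ j.+1 - trunc H n ^+ j)`_i = 0) ->
  (forall n i, (i < n)%N -> (trunc G n * trunc F n)`_i = H i) ->
  forall k, nc (F k) <= A * T * (T * s) ^+ k * (N k / k`!%:R).
Proof.
(* [b >= a] makes the truncation long enough for the quotient bound, and as a power of 2 it suits
   the iterated moderate growth. *)
pose a := (2 * j * j.+1)%N; pose b := (2 ^ a)%N.
have ab : (a <= b)%N by rewrite ltnW // ltn_expl.
have b1 : (1 < b)%N by rewrite /b -[1%N]/(2 ^ 0)%N ltn_exp2l // !muln_gt0 j0.
have HM := HW.1 _ WMM.
have [N WN [c c1 Hc]] := moderate_growth_iter HW HG a WMM.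
have HN := HW.1 _ WN.
have j1 : 1 <= j%:R :> R by rewrite ler1n.
pose T1 : R := 32 * 4 ^+ b * c; pose T : R := 460 * j%:R * T1.
have T11 : 1 <= T1.
  apply: mulr_ege1 => [|//]; apply: mulr_ege1; first by rewrite ler1n.
  by apply: exprn_ege1; rewrite ler1n.
have T10 : 0 <= T1 by apply: le_trans T11; exact: ler01.
have T1T : T1 <= T.
  by apply: ler_peMl => [//|]; apply: mulr_ege1; rewrite ?ler1n.
have T0 : 1 <= T by apply: le_trans T1T.
exists N => //; exists T => // G H F A s A1 s0 HGk HHk G0 GH GF k.
have A0 : 0 < A by apply: lt_le_trans A1.
have X r l : (0 < l)%N -> (k <= l)%N -> (k < b * l)%N -> 0 < r ->
    (forall k, (k <= b * l)%N -> M k / k`!%:R * r ^+ k <= 4 ^+ (b * l)) ->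
    nc (F k) * (r / s) ^+ k <= 460 * j%:R * A * (32 * 4 ^+ b) ^+ l.
  move=> l0 kl kb r0 Mr.
  have lN : (2 * j * j.+1 * l <= b * l)%N by rewrite leq_mul2r ab orbT.
  apply: le_trans (coef_bound_radius j0 A1 s0 HGk HHk G0 GH GF l0 kl kb r0 lN Mr) _.
  by apply: le_of_eq; rewrite natrM exprMn exprM; ring.
(* The quotient bound requires [l > 0], so [k = 0] is treated with [l = 1]. *)
case: (posnP k) => [k0|k0].
  have [|r [r0 _ Mr]] := weight_radius HM (N := b * 1); first by rewrite muln1 ltnW.
  have := X r 1%N isT; rewrite k0 !expr0 => H1.
  have {H1} := H1 isT _ r0 Mr; rewrite muln1 ltnW // => /(_ isT).
  rewrite !mulr1 expr1 fact0 divr1 (weight0 HN) mulr1 => H1; apply: le_trans H1 _.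
  have -> : A * T = 460 * j%:R * A * (32 * 4 ^+ b) * c by rewrite /T /T1; ring.
  apply: ler_peMr; last exact: c1.
  apply: mulr_ge0; last by apply: mulr_ge0; [exact: ler0n|apply: exprn_ge0; exact: ler0n].
  by apply: mulr_ge0; [apply: mulr_ge0; exact: ler0n|exact: ltW].
have [|r [r0 rM Mr]] := weight_radius HM (N := b * k); first by rewrite muln_gt0 k0 ltnW.
have H1 := X r k k0 (leqnn k) (ltac:(by rewrite -[ltnLHS]mul1n ltn_pmul2r)) r0 Mr.
have Nk := weight_gt0 HN k; have kf : 0 < k`!%:R :> R by rewrite ltr0n fact_gt0.
have c0 : 0 <= c by apply: le_trans c1.
(* After taking [b]-th powers: [(k!) ^ b <= (b k)!], which is [r ^ (b k)] times the weight of order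
   [b k], and moderate growth bounds this weight; as [c >= 1], [c ^ k] may be raised to the power
   [b]. *)
have H2 : k`!%:R <= r ^+ k * c ^+ k * N k.
  rewrite -(@ler_pXn2r _ b) ?nnegrE ?mulr_ge0 ?exprn_ge0 ?(ltW r0) ?(ltW Nk) ?(ltW kf) //; last first.
    exact: ltnW.
  rewrite -natrX; apply: (@le_trans _ _ ((b * k)`!)%:R); first by rewrite ler_nat fact_expn_le.
  rewrite -rM !exprMn -exprM [(k * b)%N]mulnC -mulrA ler_wpM2l ?exprn_ge0 ?(ltW r0) //.
  apply: le_trans (Hc k) _; rewrite ler_wpM2r ?exprn_ge0 ?(ltW Nk) //.
  by rewrite -{1}[c ^+ k]expr1 ler_weXn2l ?exprn_ege1 // ltnW.
have rk : 0 < r ^+ k by rewrite exprn_gt0.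
have sk : 0 < s ^+ k by rewrite exprn_gt0.
set Y := 460 * _ * _ * _ in H1.
have Y0 : 0 <= Y.
  apply: mulr_ge0; last first.
    by apply: exprn_ge0; apply: mulr_ge0; [exact: ler0n|apply: exprn_ge0; exact: ler0n].
  by apply: mulr_ge0; [apply: mulr_ge0; exact: ler0n|exact: ltW].
have H3 : nc (F k) <= Y * s ^+ k * (c ^+ k * (N k / k`!%:R)).
  have {}H1 : nc (F k) * r ^+ k <= Y * s ^+ k by rewrite -ler_pdivrMr // -mulrA -expr_div_n.
  rewrite -(ler_pM2r rk).
  apply: le_trans H1 _.
  have -> : Y * s ^+ k * (c ^+ k * (N k / k`!%:R)) * r ^+ k =
     Y * s ^+ k * ((r ^+ k * c ^+ k * N k) / k`!%:R) by ring.
  apply: ler_peMr; first by apply: mulr_ge0; [exact: Y0|exact: ltW].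
  by rewrite ler_pdivlMr // mul1r.
apply: le_trans H3 _.
have Nf : 0 <= N k / k`!%:R by rewrite divr_ge0 // ltW.
rewrite mulrA ler_wpM2r //.
have -> : Y * s ^+ k * c ^+ k = A * (460 * j%:R) * (T1 * s) ^+ k.
  by rewrite /Y /T1 !exprMn; ring.
apply: ler_pM.
- by apply: mulr_ge0; [exact: ltW|apply: mulr_ge0; exact: ler0n].
- by apply: exprn_ge0; apply: mulr_ge0; [|exact: ltW].
- apply: ler_wpM2l; first exact: ltW.
  by apply: ler_peMr; [apply: mulr_ge0; exact: ler0n|exact: T11].
- by apply: lerXn2r; rewrite ?nnegrE ?mulr_ge0 ?(ltW s0) ?(le_trans _ T0) // ler_wpM2r // ltW.
Qed.

End Weighted.

(** * From formal series back to functions *)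

Section Valuation.
Local Open Scope complex_scope.
Variable R : realType.
Local Notation C := R[i].
Implicit Types (p q : {poly C}).

Definition vanish n p := forall i, (i < n)%N -> p`_i = 0.

Lemma vanishD n p q : vanish n p -> vanish n q -> vanish n (p + q).
Proof. by move=> hp hq i ilt; rewrite coefD hp // hq // addr0. Qed.
Lemma vanishM n p q : vanish n p -> vanish n (p * q).
Proof.
move=> hp i ilt; rewrite coefM big1 // => b _.
by rewrite hp ?mul0r // (leq_trans _ ilt) // ltnS -ltnS.
Qed.
Lemma vanish_div n p q : p`_0 != 0 -> vanish n (p * q) -> vanish n q.
Proof.
move=> p0 hpq; elim/ltn_ind => i IH ilt.
have := hpq _ ilt; rewrite coefM big_ord_recl /= subn0 big1 => [|b _].
  by rewrite addr0 => /eqP; rewrite mulf_eq0 (negPf p0) => /eqP.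
rewrite IH ?mulr0 //; first by rewrite /bump; have := ltn_ord b; lia.
by apply: leq_ltn_trans ilt; rewrite leq_subr.
Qed.

(** The bridge from estimates to formal identities. By induction: small [t] forces the constant
    coefficient to vanish, and then ['X] is divided out. *)
Lemma poly_small_vanish n p (K t0 : R) : 0 < t0 ->
  (forall t : R, 0 < t < t0 -> nc p.[t%:C] <= K * t ^+ n) -> vanish n p.
Proof.
elim: n p => [|n IH] p t00 H; first by [].
have p0 : p`_0 = 0.
  apply/eqP; rewrite -nc_eq0; apply/negPn/negP => pn.
  have pp : 0 < nc p`_0 by rewrite lt_def pn nc_ge0.
  set D := p - (p`_0)%:P.
  have D0 i : (i < 1)%N -> D`_i = 0 by case: i => // _; rewrite coefB coefC eqxx subrr.
  pose W := `|K| + wnorm 1 D + 1.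
  have wD : 0 <= wnorm 1 D by apply: wnorm_ge0.
  have W0 : 0 < W by rewrite /W; have := normr_ge0 K; lra.
  pose t := Num.min (Num.min (t0 / 2) 1) (nc p`_0 / (2 * W)).
  have W2 : 0 < 2 * W by rewrite mulr_gt0.
  have t_gt0 : 0 < t by rewrite !lt_min ltr01 !divr_gt0.
  have tt0 : t < t0.
    by rewrite (@le_lt_trans _ _ (t0 / 2)) ?ge_min ?lexx //; move: t00; lra.
  have t1 : t <= 1 by rewrite !ge_min lexx orbT.
  have tp : t * (2 * W) <= nc p`_0.
    by rewrite -ler_pdivlMr // ge_min lexx orbT.
  have h1 : nc p.[t%:C] <= `|K| * t.
    apply: (le_trans (H t (ltac:(by rewrite t_gt0)))).
    apply: (@le_trans _ _ (`|K| * t ^+ n.+1)).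
      by rewrite ler_wpM2r ?exprn_ge0 ?(ltW t_gt0) // ler_norm.
    by rewrite ler_wpM2l // -[leRHS]expr1 ler_wiXn2l // ltW.
  have nt : nc t%:C <= 1 by rewrite nc_real gtr0_norm.
  have := horner_le_tail (@ltr01 R) nt D0; rewrite divr1 expr1 nc_real gtr0_norm // => h2.
  have : nc p`_0 <= nc p.[t%:C] + nc D.[t%:C].
    have -> : p`_0 = p.[t%:C] - D.[t%:C] by rewrite !hornerE opprB addrC subrK.
    exact: ncB.
  have : t * 0 < t * W by rewrite ltr_pM2l.
  move: tp h1 h2; rewrite /W; set x := nc p`_0; set y := nc p.[_]; set z := nc D.[_].
  move=> *; nra.
pose q := drop_poly 1 p.
have pq : p = q * 'X.
  have := poly_take_drop 1 p; rewrite expr1 => {1}<-.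
  rewrite [take_poly _ _](_ : _ = 0) ?add0r //.
  apply/polyP => i; rewrite coef0 coef_take_poly; by case: i.
have /IH vq : 0 < t0 by [].
move=> [|i] // ilt; rewrite pq coefMX /=; apply: (vq q) => // t tt.
have t_gt0 : 0 < t by case/andP: tt.
have := H t tt; rewrite pq hornerM hornerX ncM nc_real gtr0_norm // exprSr mulrA.
by rewrite ler_pM2r.
Qed.

Lemma nc_pow_diff (x y : C) (W : R) m : 1 <= W -> nc x <= W -> nc y <= W ->
  nc (x ^+ m - y ^+ m) <= m%:R * W ^+ m * nc (x - y).
Proof.
move=> W1 xW yW; have W0 : 0 <= W by apply: le_trans W1.
rewrite subrXX ncM mulrC ler_wpM2r ?nc_ge0 //.
apply: le_trans (nc_sum _ _ _) _.
apply: (@le_trans _ _ (\sum_(i < m) W ^+ m)); last by rewrite sumr_const card_ord mulr_natl.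
apply: ler_sum => i _; rewrite ncM !ncX.
apply: (@le_trans _ _ (W ^+ (m.-1 - i) * W ^+ i)).
  by apply: ler_pM; rewrite ?exprn_ge0 ?nc_ge0 //; apply: lerXn2r; rewrite ?nnegrE ?nc_ge0.
by rewrite -exprD ler_weXn2l //; have := ltn_ord i; lia.
Qed.

(* [a ^ j] and [a ^ j.+1] determine [a] in a Hoelder continuous way, even near [a = 0]. *)
Lemma power_pair_holder (x y : C) (W e : R) j : (0 < j)%N -> 0 <= W -> nc x <= W -> nc y <= W ->
  nc (x ^+ j - y ^+ j) <= e -> nc (x ^+ j.+1 - y ^+ j.+1) <= e ->
  nc (x - y) ^+ j.+1 <= 2 ^+ j * (1 + W) * e.
Proof.
(* [u ^ j * (u - v)] is a combination of the two given differences; afterwards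
   [|u - v| <= 2 max (|u|, |v|)] supplies the other [j] factors. *)
have main (u v : C) : 0 <= W -> nc u <= W -> nc v <= W ->
    nc (u ^+ j - v ^+ j) <= e -> nc (u ^+ j.+1 - v ^+ j.+1) <= e ->
    nc u ^+ j * nc (u - v) <= (1 + W) * e.
  move=> W0 uW vW h1 h2.
  rewrite -ncX -ncM (_ : _ * _ = (u ^+ j.+1 - v ^+ j.+1) - v * (u ^+ j - v ^+ j)).
    apply: le_trans (ncB _ _) _; rewrite ncM mulrDl mul1r lerD //.
    by rewrite ler_pM ?nc_ge0.
  by rewrite !exprS; ring.
move=> j0 W0 xW yW h1 h2.
have e0 : 0 <= e by apply: le_trans h1; apply: nc_ge0.
have H1 := main x y W0 xW yW h1 h2.
have H2 : nc y ^+ j * nc (x - y) <= (1 + W) * e.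
  by rewrite nc_dist; apply: main => //; rewrite nc_dist.
rewrite exprSr -mulrA.
have [xy|yx] := leP (nc y) (nc x).
  apply: (@le_trans _ _ ((2 * nc x) ^+ j * nc (x - y))).
    rewrite ler_wpM2r ?nc_ge0 //; apply: lerXn2r; rewrite ?nnegrE ?mulr_ge0 ?nc_ge0 //.
    by apply: le_trans (ncB _ _) _; lra.
  by rewrite exprMn -mulrA ler_wpM2l // exprn_ge0.
apply: (@le_trans _ _ ((2 * nc y) ^+ j * nc (x - y))).
  rewrite ler_wpM2r ?nc_ge0 //; apply: lerXn2r; rewrite ?nnegrE ?mulr_ge0 ?nc_ge0 //.
  by apply: le_trans (ncB _ _) _; lra.
by rewrite exprMn -mulrA ler_wpM2l // exprn_ge0.
Qed.

End Valuation.

Section PowerRoots.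
Local Open Scope complex_scope.
Variable R : realType.
Local Notation C := R[i].
Variable j : nat.
Hypothesis j0 : (0 < j)%N.
Variables (G H F : nat -> C).

(** Modulo ['X ^ L], multiplying [T ^ j - P] by [P ^ j] gives [(P T) ^ j - P ^ j.+1 = Q ^ j - P ^
    j.+1 = 0], and [P ^ j] is invertible. *)
Lemma quotient_powers L : G 0%N != 0 ->
  (forall n i, (i < n)%N -> (trunc G n ^+ j.+1 - trunc H n ^+ j)`_i = 0) ->
  (forall n i, (i < n)%N -> (trunc G n * trunc F n)`_i = H i) ->
  vanish L (trunc F L ^+ j - trunc G L) /\ vanish L (trunc F L ^+ j.+1 - trunc H L).
Proof.
move=> G0 GH GF; case: L => [|L]; first by split => -[].
set P := trunc G L.+1; set Q := trunc H L.+1; set T := trunc F L.+1.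
have P0 : P`_0 != 0 by rewrite coef_trunc.
have PT : vanish L.+1 (P * T - Q).
  by move=> i iL; rewrite coefB GF // coef_trunc iL subrr.
have PQ : vanish L.+1 (P ^+ j.+1 - Q ^+ j) by move=> i iL; rewrite GH.
have P0j : (P ^+ j)`_0 != 0.
  by rewrite -horner_coef0 horner_exp horner_coef0 expf_neq0.
have H1 : vanish L.+1 (T ^+ j - P).
  apply: (vanish_div P0j).
  have -> : P ^+ j * (T ^+ j - P) = ((P * T) ^+ j - Q ^+ j) + (P ^+ j.+1 - Q ^+ j) * (-1).
    by rewrite exprMn exprSr; ring.
  apply: vanishD; last exact: vanishM.
  by rewrite subrXX; apply: vanishM.
split=> //.
have -> : T ^+ j.+1 - Q = (T ^+ j - P) * T + (P * T - Q) by rewrite exprSr; ring.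
by apply: vanishD => //; apply: vanishM.
Qed.

End PowerRoots.

Section Expansion.
Local Open Scope complex_scope.
Variable R : realType.
Local Notation C := R[i].
Variables (WM : set (nat -> R)) (M : nat -> R) (j : nat).
Hypotheses (HW : weight_matrix WM) (HG : R_moderate_growth WM).
Hypotheses (WMM : WM M) (j0 : (0 < j)%N).

(* [jet A s phi I G]: the formal series [G] is an [M]-regular Taylor expansion at [0] of
   [phi] on the parameter set [I]. *)
Definition jet (A s : R) (phi : R -> C) (I : R -> Prop) (G : nat -> C) : Prop :=
  (forall k, nc (G k) <= A * s ^+ k * (M k / k`!%:R)) /\
  (forall n t, I t -> nc (phi t - (trunc G n).[t%:C]) <= A * s ^+ n * (M n / n`!%:R) * `|t| ^+ n).

Let bnd (A s : R) (N : nat -> R) n : R := \sum_(k < n) A * s ^+ k * (N k / k`!%:R).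

Let bnd_ge0 A s N n : 0 <= A -> 0 <= s -> (forall k, 0 < N k) -> 0 <= bnd A s N n.
Proof.
move=> A0 s0 N0; apply: sumr_ge0 => k _.
by rewrite !mulr_ge0 ?exprn_ge0 ?invr_ge0 ?ler0n // ltW.
Qed.

Let wnorm_trunc A s N K n :
  (forall k, nc (K k) <= A * s ^+ k * (N k / k`!%:R)) ->
  wnorm 1 (trunc K n) <= bnd A s N n.
Proof.
move=> HK; rewrite (@wnorm_widen _ _ _ n); last exact: size_poly.
by apply: ler_sum => i _; rewrite coef_trunc ltn_ord expr1n mulr1.
Qed.

(** [phi] and its Taylor polynomial are compared through their powers. The Hoelder exponent
    [1 / (j + 1)] costs orders, so a remainder of order [q] is drawn from expansions of order
    [(j + 1) q]. The coefficients keep weighted bounds, from which the size of derivatives is read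
    off; the remainder constants [Kq] are merely uniform in [phi], which suffices for smoothness. *)
Lemma line_expansion : exists2 N, WM N & exists2 T : R, 1 <= T &
  forall A s B : R, 1 <= A -> 0 < s -> exists Kq : nat -> R,
  forall (phi : R -> C) (I : R -> Prop) (G H : nat -> C),
  (exists2 t0, 0 < t0 & forall t, 0 < t < t0 -> I t) ->
  (forall t, I t -> `|t| <= 1 /\ nc (phi t) <= B) ->
  jet A s (fun t => phi t ^+ j) I G -> jet A s (fun t => phi t ^+ j.+1) I H ->
  (G 0%N != 0 \/ forall k, G k = 0 /\ H k = 0) ->
  exists F : nat -> C, (forall k, nc (F k) <= A * T * (T * s) ^+ k * (N k / k`!%:R)) /\
    forall q t, I t -> nc (phi t - (trunc F q).[t%:C]) <= Kq q * `|t| ^+ q.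
Proof.
have [N WN [T T1 HT]] := coef_bound HW HG WMM j0.
have N0 k : 0 < N k by apply: weight_gt0; apply: HW.1.
have M0 k : 0 < M k by apply: weight_gt0; apply: HW.1.
have T0 : 0 <= T by apply: le_trans T1.
exists N => //; exists T => // A s B A1 s0.
have A0 : 0 <= A by apply: le_trans A1.
have s0' := ltW s0.
pose W q := `|B| + bnd A s M (j.+1 * q) + bnd (A * T) (T * s) N (j.+1 * q) + 1.
pose Dq q := A * s ^+ (j.+1 * q) * (M (j.+1 * q)%N / (j.+1 * q)`!%:R).
pose Y q := 2 ^+ j * (1 + W q) * (Dq q + W q ^+ j.+1 + W q).
exists (fun q => Y q + W q) => phi I G H [t0 t00 It0] HI [HGk HGr] [HHk HHr] GH0.
suff [F [Fk FG]] : exists F : nat -> C,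
    (forall k, nc (F k) <= A * T * (T * s) ^+ k * (N k / k`!%:R)) /\
    forall L, vanish L (trunc F L ^+ j - trunc G L) /\ vanish L (trunc F L ^+ j.+1 - trunc H L).
  exists F; split=> // q t It.
  have [t1 phB] := HI t It.
  set L := (j.+1 * q)%N; have [v1 v2] := FG L.
  have b1 := bnd_ge0 L A0 s0' M0.
  have b2 : 0 <= bnd (A * T) (T * s) N L by apply: bnd_ge0; rewrite ?mulr_ge0.
  have W1 : 1 <= W q by rewrite /W -/L; have := normr_ge0 B; lra.
  have W0 : 0 <= W q by apply: le_trans W1.
  have wF : wnorm 1 (trunc F L) <= W q.
    apply: le_trans (wnorm_trunc L Fk) _; rewrite /W -/L; have := normr_ge0 B; lra.
  have wG : wnorm 1 (trunc G L) <= W q.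
    apply: le_trans (wnorm_trunc L HGk) _; rewrite /W -/L; have := normr_ge0 B; lra.
  have wH : wnorm 1 (trunc H L) <= W q.
    apply: le_trans (wnorm_trunc L HHk) _; rewrite /W -/L; have := normr_ge0 B; lra.
  have nt : nc t%:C <= 1 by rewrite nc_real.
  have phW : nc (phi t) <= W q.
    by apply: le_trans phB _; rewrite /W -/L; have := ler_norm B; lra.
  have FW : nc (trunc F L).[t%:C] <= W q.
    by apply: le_trans (horner_le_wnorm _ ltr01 nt) wF.
  have D0 : 0 <= Dq q by rewrite /Dq !mulr_ge0 ?exprn_ge0 ?invr_ge0 ?ler0n // ltW.
  pose e := (Dq q + W q ^+ j.+1 + W q) * `|t| ^+ L.
  have WX m : (0 < m <= j.+1)%N -> wnorm 1 (trunc F L ^+ m) <= W q ^+ j.+1.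
    move=> /andP[m0 mj]; apply: le_trans (wnormX _ _ (@ler01 R)) _.
    apply: (@le_trans _ _ (W q ^+ m)); last by rewrite ler_weXn2l.
    by apply: lerXn2r; rewrite ?nnegrE ?wnorm_ge0.
  have bound m (K : nat -> C) : (0 < m <= j.+1)%N -> wnorm 1 (trunc K L) <= W q ->
     nc (phi t ^+ m - (trunc K L).[t%:C]) <= Dq q * `|t| ^+ L ->
     vanish L (trunc F L ^+ m - trunc K L) ->
     nc (phi t ^+ m - (trunc F L).[t%:C] ^+ m) <= e.
    move=> mj wK h1 vK.
    have := horner_le_tail ltr01 nt vK; rewrite divr1 nc_real => h2.
    have h3 : wnorm 1 (trunc F L ^+ m - trunc K L) <= W q ^+ j.+1 + W q.
      by apply: le_trans (wnormB _ _ (@ler01 R)) _; rewrite lerD // WX.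
    have -> : phi t ^+ m - (trunc F L).[t%:C] ^+ m =
       (phi t ^+ m - (trunc K L).[t%:C]) - (trunc F L ^+ m - trunc K L).[t%:C].
      by rewrite hornerD hornerN horner_exp; ring.
    apply: le_trans (ncB _ _) _; rewrite /e -addrA mulrDl lerD //.
    by apply: le_trans h2 _; rewrite mulrC ler_wpM2r ?exprn_ge0.
  have e1 := bound j G (ltac:(by rewrite j0 leqnSn)) wG (HGr L t It) v1.
  have e2 := bound j.+1 H (ltac:(by rewrite leqnn)) wH (HHr L t It) v2.
  have Hh := power_pair_holder j0 W0 phW FW e1 e2.
  have Y1 : 1 <= Y q.
    have WX0 := exprn_ge0 j.+1 W0.
    apply: mulr_ege1; last by lra.
    by apply: mulr_ege1; [apply: exprn_ege1; rewrite ler1n|lra].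
  have Y0 : 0 <= Y q by apply: le_trans Y1.
  have h5 : nc (phi t - (trunc F L).[t%:C]) <= Y q * `|t| ^+ q.
    have Yt0 : 0 <= Y q * `|t| ^+ q by apply: mulr_ge0 => //; exact: exprn_ge0.
    rewrite -(@ler_pXn2r _ j.+1) ?nnegrE ?nc_ge0 ?Yt0 //.
    apply: le_trans Hh _; rewrite /e mulrA -/(Y q) exprMn -exprM [(q * _)%N]mulnC.
    by rewrite ler_wpM2r ?exprn_ge0 // -{1}[Y q]expr1 ler_weXn2l.
  have qL : (q <= L)%N by rewrite /L leq_pmull.
  have vq : vanish q (trunc F L - trunc F q).
    by move=> i iq; rewrite coefB !coef_trunc iq (leq_trans iq qL) subrr.
  have := horner_le_tail ltr01 nt vq; rewrite divr1 nc_real => h6.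
  have h7 : wnorm 1 (trunc F L - trunc F q) <= W q.
    apply: le_trans wF; rewrite !(@wnorm_widen _ _ _ L) ?size_poly //; last first.
      apply: leq_trans (size_polyD _ _) _; rewrite size_polyN geq_max size_poly /=.
      by apply: leq_trans (size_poly _ _) qL.
    apply: ler_sum => i _; rewrite ler_wpM2r ?exprn_ge0 // coefB !coef_trunc ltn_ord.
    by case: ifP => _; rewrite ?subrr ?nc0 ?nc_ge0 // subr0.
  apply: (@le_trans _ _ (nc ((phi t - (trunc F L).[t%:C]) + (trunc F L - trunc F q).[t%:C]))).
    by apply: le_of_eq; congr nc; rewrite hornerD hornerN; ring.
  apply: le_trans (ncD _ _) _; rewrite mulrDl lerD //.
  by apply: le_trans h6 _; rewrite mulrC ler_wpM2r ?exprn_ge0.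
case: GH0 => [G0|GH0].
  (* The formal identity is inherited from [(phi ^ j) ^ j.+1 = (phi ^ j.+1) ^ j]: the difference of
     the truncated powers is [O(t ^ n)], so its low coefficients vanish. *)
  have GH n : vanish n (trunc G n ^+ j.+1 - trunc H n ^+ j).
    pose W' := `|B| ^+ j + `|B| ^+ j.+1 + bnd A s M n + 1.
    have b1 := bnd_ge0 n A0 s0' M0.
    have Bj : 0 <= `|B| ^+ j by rewrite exprn_ge0.
    have Bj1 : 0 <= `|B| ^+ j.+1 by rewrite exprn_ge0.
    have W1 : 1 <= W' by rewrite /W'; lra.
    have W0 : 0 <= W' by apply: le_trans W1.
    pose E := A * s ^+ n * (M n / n`!%:R).
    pose K := j.+1%:R * W' ^+ j.+1 * E + j%:R * W' ^+ j * E.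
    apply: (@poly_small_vanish R n _ K t0 t00) => t tt.
    have It := It0 t tt; have [t1 phB] := HI t It.
    have tp : 0 < t by case/andP: tt.
    have nt : nc t%:C <= 1 by rewrite nc_real.
    have phB' : nc (phi t) <= `|B| by apply: le_trans phB (ler_norm B).
    have -> : (trunc G n ^+ j.+1 - trunc H n ^+ j).[t%:C] =
      ((trunc G n).[t%:C] ^+ j.+1 - (phi t ^+ j) ^+ j.+1) -
      ((trunc H n).[t%:C] ^+ j - (phi t ^+ j.+1) ^+ j).
      by rewrite hornerD hornerN !horner_exp exprAC; ring.
    have gW K0 : (forall k, nc (K0 k) <= A * s ^+ k * (M k / k`!%:R)) ->
        nc (trunc K0 n).[t%:C] <= W'.
      move=> HK; apply: le_trans (horner_le_wnorm _ ltr01 nt) _.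
      by apply: le_trans (wnorm_trunc n HK) _; rewrite /W'; lra.
    have pW m : nc (phi t ^+ m) <= `|B| ^+ m.
      by rewrite ncX; apply: lerXn2r; rewrite ?nnegrE ?nc_ge0.
    have pj : nc (phi t ^+ j) <= W' by apply: le_trans (pW _) _; rewrite /W'; lra.
    have pj1 : nc (phi t ^+ j.+1) <= W' by apply: le_trans (pW _) _; rewrite /W'; lra.
    apply: le_trans (ncB _ _) _; rewrite /K mulrDl; apply: lerD.
      apply: le_trans (nc_pow_diff j.+1 W1 (gW G HGk) pj) _.
      rewrite -[leRHS]mulrA; apply: ler_wpM2l; first by apply: mulr_ge0; [exact: ler0n|exact: exprn_ge0].
      rewrite nc_dist.
      by have := HGr n t It; rewrite gtr0_norm.
    apply: le_trans (nc_pow_diff j W1 (gW H HHk) pj1) _.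
    rewrite -[leRHS]mulrA; apply: ler_wpM2l; first by apply: mulr_ge0; [exact: ler0n|exact: exprn_ge0].
      rewrite nc_dist.
    by have := HHr n t It; rewrite gtr0_norm.
  have [F GF] := series_div H G0.
  exists F; split; first exact: (HT G H F A s A1 s0 HGk HHk G0 GH GF).
  by move=> L; apply: quotient_powers.
exists (fun=> 0); split.
  by move=> k; rewrite nc0 !mulr_ge0 ?exprn_ge0 ?mulr_ge0 ?invr_ge0 ?ler0n // ltW.
move=> L; have t0' (K0 : nat -> C) : (forall k, K0 k = 0) -> trunc K0 L = 0.
  by move=> K00; apply/polyP => i; rewrite coef_trunc K00 coef0 if_same.
rewrite (t0' (fun=> 0)) // (t0' G) => [|k]; last by case: (GH0 k).
rewrite (t0' H) => [|k]; last by case: (GH0 k).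
by rewrite !expr0n gtn_eqF // subrr; split => i _; rewrite coef0.
Qed.

End Expansion.

Local Open Scope classical_set_scope.
Local Open Scope ring_scope.

(** * Taylor expansions along lines *)

Section OneVariable.
Variable R : realType.

Lemma mean_value_01 (psi dpsi : R -> R) (b : R) : 0 <= b ->
  (forall t, 0 <= t <= b -> is_derive t 1 psi (dpsi t)) ->
  exists2 c, 0 <= c <= b & psi b - psi 0 = dpsi c * b.
Proof.
move=> b0 H; have [//| | |c] := @MVT_segment R psi dpsi 0 b.
- by move=> x; rewrite in_itv /= => /andP[x0 xb]; apply: H; rewrite !ltW.
- apply: continuous_in_subspaceT => x; rewrite inE /= in_itv /= => xb.
  apply: differentiable_continuous; apply/derivable1_diffP.
  by have := H x xb; case.
- by rewrite in_itv /= subr0 => cb E; exists c.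
Qed.

Lemma is_derive_horner (p : {poly R}) (x : R) : is_derive x 1 (horner p) (p^`()).[x].
Proof.
apply: DeriveDef; first exact: derivable_horner.
by rewrite -derive1E -derivE.
Qed.

Lemma is_derive_add (f g : R -> R) (t a b : R) :
  is_derive t 1 f a -> is_derive t 1 g b -> is_derive t 1 (fun x => f x + g x) (a + b).
Proof. by move=> hf hg; exact: (@is_deriveD _ _ _ f g t 1 a b). Qed.

Lemma is_derive_sub (f g : R -> R) (t a b : R) :
  is_derive t 1 f a -> is_derive t 1 g b -> is_derive t 1 (fun x => f x - g x) (a - b).
Proof. by move=> hf hg; exact: (@is_deriveB _ _ _ f g t 1 a b). Qed.

(** [phi k] stands for the [k]-th derivative. Induction bounds [|phi' - p'|] by [q']; by the mean
    value theorem both [q + (phi - p)] and [q - (phi - p)], which vanish at 0, are then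
    nonnegative. *)
Lemma taylor_bound n (phi : nat -> R -> R) (b B : R) : 0 <= b ->
  (forall k t, (k < n)%N -> 0 <= t <= b -> is_derive t 1 (phi k) (phi k.+1 t)) ->
  (forall t, 0 <= t <= b -> `|phi n t| <= B) ->
  `|phi 0%N b - (\poly_(k < n) (phi k 0 / k`!%:R)).[b]| <= B / n`!%:R * b ^+ n.
Proof.
elim: n phi b => [|n IH] phi b b0 dphi HB.
  rewrite poly_def big_ord0 horner0 subr0 fact0 divr1 expr0 mulr1.
  by apply: HB; rewrite b0 lexx.
set p : {poly R} := \poly_(k < n.+1) _.
pose q : {poly R} := (B / n.+1`!%:R) *: 'X^(n.+1).
have dp : p^`() = \poly_(k < n) (phi k.+1 0 / k`!%:R).
  apply/polyP => k; rewrite coef_deriv !coef_poly ltnS; case: ifP => _; rewrite ?mul0rn //.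
  rewrite -[LHS]mulr_natr -mulrA; congr (_ * _).
  by rewrite factS natrM invfM mulrAC mulVf ?mul1r // pnatr_eq0.
have dq x : q^`().[x] = B / n`!%:R * x ^+ n.
  rewrite derivZ derivXn hornerZ hornerMn hornerXn /= -[x ^+ n *+ _]mulr_natl.
  rewrite factS natrM invfM; have := pnatr_eq0 R n.+1; have := fact_gt0 n.
  rewrite lt0n -(pnatr_eq0 R); set y := n.+1%:R; set z := (n`!)%:R => z0 /= y0.
  clearbody y z; by field; rewrite y0 z0.
have step x : 0 <= x <= b -> `|phi 1%N x - p^`().[x]| <= q^`().[x].
  move=> /andP[x0 xb]; rewrite dp dq; apply: (IH (fun k => phi k.+1) x x0).
    by move=> k t kn /andP[t0 tx]; apply: dphi => //; rewrite t0 (le_trans tx).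
  by move=> t /andP[t0 tx]; apply: HB; rewrite t0 (le_trans tx).
have p0 : p.[0] = phi 0%N 0.
  by rewrite horner_coef0 coef_poly /= fact0 divr1.
have q0 : q.[0] = 0 by rewrite /q hornerZ hornerXn expr0n mulr0.
have -> : B / n.+1`!%:R * b ^+ n.+1 = q.[b] by rewrite /q hornerZ hornerXn.
have dphi0 x : 0 <= x <= b -> is_derive x 1 (phi 0%N) (phi 1%N x) by move=> ?; apply: dphi.
rewrite ler_norml; apply/andP; split.
  have [|c cb] := @mean_value_01 (fun x => (phi 0%N x - p.[x]) + q.[x])
     (fun x => (phi 1%N x - p^`().[x]) + q^`().[x]) b b0.
    move=> t tb; apply: is_derive_add (is_derive_horner q t).
    exact: is_derive_sub (dphi0 t tb) (is_derive_horner p t).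
  rewrite p0 q0 subrr addr0 subr0 => E.
  rewrite -subr_ge0 opprK E mulr_ge0 //.
  by have := step c cb; rewrite ler_norml => /andP[+ _]; rewrite -subr_ge0 opprK.
have [|c cb] := @mean_value_01 (fun x => q.[x] - (phi 0%N x - p.[x]))
   (fun x => q^`().[x] - (phi 1%N x - p^`().[x])) b b0.
  move=> t tb; apply: (is_derive_sub (is_derive_horner q t)).
  exact: is_derive_sub (dphi0 t tb) (is_derive_horner p t).
rewrite p0 q0 subrr subrr subr0 => E.
rewrite -subr_ge0 E mulr_ge0 //.
by have := step c cb; rewrite ler_norml => /andP[_ +]; rewrite -subr_ge0.
Qed.

End OneVariable.

Section Lines.
Variables (R : realType) (d : nat).
Local Notation pt := 'rV[R]_d.
Implicit Types (u : pt -> R) (x v : pt).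

Lemma is_derive_line u x v (c t : R) : derivable u (x + (t * c) *: v) v ->
  is_derive t 1 (fun s => u (x + (s * c) *: v)) (c * 'D_v u (x + (t * c) *: v)).
Proof.
move=> du.
have H : is_derive (t * c) 1 (fun s => u (x + s *: v)) ('D_v u (x + (t * c) *: v)).
  have E : (fun h : R => h^-1 *: (((fun s => u (x + s *: v)) \o shift (t * c)) (h *: 1) -
               u (x + (t * c) *: v))) =
           (fun h : R => h^-1 *: ((u \o shift (x + (t * c) *: v)) (h *: v) -
               u (x + (t * c) *: v))).
    apply/funext => h /=; congr (_ *: (u _ - _)).
    by rewrite [h%:A]mulr1 scalerDl addrCA.
  by apply: DeriveDef; rewrite /derivable /derive E.
have Hc : is_derive t 1 (fun s : R => s * c) c.
  have -> : (fun s : R => s * c) = horner (c *: 'X).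
    by apply/funext => s; rewrite hornerZ hornerX mulrC.
  apply: is_derive_eq (is_derive_horner _ _) _.
  by rewrite derivZ derivX hornerZ hornerC mulr1.
by have := @is_derive1_comp R _ _ t _ _ H Hc; rewrite mulrC.
Qed.

Lemma norm_coord x i : `|x 0 i| <= `|x|.
Proof.
rewrite [leRHS]/Num.norm /= mx_normrE.
exact: (@le_bigmax _ _ _ 0 (fun ij : 'I_1 * 'I_d => `|x ij.1 ij.2|) (0, i)).
Qed.

Lemma norm_lt_coord x (r : R) : 0 < r -> (`|x| < r) <-> (forall i, `|x 0 i| < r).
Proof.
move=> r0; split=> [xr i|H]; first by apply: le_lt_trans xr; exact: norm_coord.
rewrite [ltLHS]/Num.norm /= mx_normrE; apply/bigmax_ltP; split => // -[a i] _ /=.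
by rewrite ord1.
Qed.

Lemma norm_le_coord x (r : R) : 0 <= r -> (forall i, `|x 0 i| <= r) -> `|x| <= r.
Proof.
move=> r0 H; rewrite [leLHS]/Num.norm /= mx_normrE; apply/bigmax_leP; split => // -[a i] _ /=.
by rewrite ord1.
Qed.

Lemma ebaseE (i l : 'I_d) : (ebase R i) 0 l = (l == i)%:R.
Proof. by rewrite mxE eqxx. Qed.

Lemma norm_ebase_le1 (i : 'I_d) : `|ebase R i| <= 1.
Proof. by apply: norm_le_coord => // l; rewrite ebaseE; case: eqP; rewrite ?normr1 ?normr0. Qed.

Lemma Dseq_cat (s1 s2 : seq 'I_d) u : Dseq (s1 ++ s2) u = Dseq s1 (Dseq s2 u).
Proof. by rewrite /Dseq foldr_cat. Qed.

Lemma smooth_Dseq (V : set pt) s u : smooth_on_R V u -> smooth_on_R V (Dseq s u).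
Proof. by move=> H s' x Vx; rewrite -Dseq_cat; apply: H. Qed.

End Lines.

Lemma triangular_sum (V : nmodType) (F : nat -> nat -> V) n :
  \sum_(k < n) \sum_(a < k.+1) F a (k - a)%N = \sum_(a < n) \sum_(b < n - a) F a b.
Proof.
elim: n => [|n IH]; first by rewrite !big_ord0.
rewrite big_ord_recr /= IH [RHS]big_ord_recr /= subSnn big_ord1.
rewrite [\sum_(a < n.+1) F a _]big_ord_recr /= subnn addrA; congr (_ + _).
rewrite -big_split; apply: eq_bigr => a _ /=.
by rewrite subSn 1?ltnW // big_ord_recr.
Qed.

Lemma binomial_weights (R : realType) (m : R) n :
  \sum_(a < n.+1) (a`!%:R)^-1 * (m ^+ (n - a) / (n - a)`!%:R) = (m + 1) ^+ n / n`!%:R.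
Proof.
rewrite exprDn mulr_suml; apply: eq_bigr => a _.
have an : (a <= n)%N by rewrite -ltnS.
rewrite expr1n mulr1 -mulr_natr.
have f0 k : (k`!)%:R != 0 :> R by rewrite pnatr_eq0 -lt0n fact_gt0.
have -> : (n`!)%:R = ('C(n, a))%:R * ((a`!)%:R * ((n - a)`!)%:R) :> R.
  by rewrite -!natrM bin_fact.
have C0 : ('C(n, a))%:R != 0 :> R by rewrite pnatr_eq0 -lt0n bin_gt0.
by field; rewrite C0 !f0.
Qed.

Lemma flatten_nseq0 (T : Type) (s : seq T) : flatten [seq nseq 0 l | l <- s] = [::].
Proof. by elim: s. Qed.

Lemma sumn_map0 (T : Type) (s : seq T) : sumn [seq 0%N | l <- s] = 0%N.
Proof. by elim: s. Qed.

Section AxisJet.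
Variables (R : realType) (d : nat).
Local Notation pt := 'rV[R]_d.
Implicit Types (u : pt -> R) (x : pt) (w : 'I_d -> R) (L : seq 'I_d) (c : seq (nat * 'I_d)).

Definition cube (r : R) : set pt := [set x | `|x| < r].

Definition mono c : seq 'I_d := flatten [seq nseq p.1 p.2 | p <- c].
Definition deg c : nat := sumn (unzip1 c).
Definition vec L w : pt := \sum_(i <- L) w i *: ebase R i.

Lemma vec_coord L w l : uniq L -> (vec L w) 0 l = if l \in L then w l else 0.
Proof.
rewrite /vec summxE; elim: L => [|i L IH] /=; first by rewrite big_nil.
move=> /andP[iL uL]; rewrite big_cons IH // in_cons mxE ebaseE.
have [->|li] := eqVneq l i; first by rewrite mulr1 (negPf iL) addr0.
by rewrite mulr0 add0r.
Qed.

Lemma is_derive_scale (f : R -> R) (t a k : R) :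
  is_derive t 1 f a -> is_derive t 1 (fun s => k * f s) (k * a).
Proof. by move=> hf; exact: (@is_deriveZ _ _ _ f k t 1 a). Qed.

Lemma directional_taylor (r : R) u (y : pt) i (h B : R) n : 0 < r ->
  smooth_on_R (cube r) u -> `|y| < r -> `|y + h *: ebase R i| < r ->
  (forall z, `|z| < r -> `|Dseq (nseq n i) u z| <= B) ->
  `|u (y + h *: ebase R i) - \sum_(a < n) Dseq (nseq a i) u y / a`!%:R * h ^+ a|
    <= B / n`!%:R * `|h| ^+ n.
Proof.
move=> r0 su yr zr HB.
have seg t : 0 <= t <= 1 -> `|y + (t * h) *: ebase R i| < r.
  move=> /andP[t0 t1]; apply/(norm_lt_coord _ r0) => l; rewrite !mxE eqxx /=.
  have := (norm_lt_coord _ r0).1 yr l.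
  have := (norm_lt_coord _ r0).1 zr l; rewrite !mxE eqxx /=.
  set a := y 0 l; set b := h * _ => ab aa.
  have -> : a + t * h * (l == i)%:R = (1 - t) * a + t * (a + b) by rewrite /b; ring.
  apply: le_lt_trans (ler_normD _ _) _; rewrite !normrM (ger0_norm t0) ger0_norm ?subr_ge0 //.
  have [->|t1'] := eqVneq t 1; first by rewrite subrr mul0r add0r mul1r.
  have lt1 : 0 < 1 - t by rewrite subr_gt0 lt_neqAle t1' t1.
  have h1 : (1 - t) * `|a| < (1 - t) * r by rewrite ltr_pM2l.
  have h2 : t * `|a + b| <= t * r by rewrite ler_wpM2l // ltW.
  by rewrite (_ : r = (1 - t) * r + t * r); [exact: ltr_leD|ring].
pose phi k (t : R) := h ^+ k * Dseq (nseq k i) u (y + (t * h) *: ebase R i).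
have := @taylor_bound R n phi 1 (B * `|h| ^+ n) ler01.
rewrite /phi expr0 !mul1r mul0r scale0r addr0 expr1n mulr1 => T.
rewrite mulrAC; apply: le_trans (T _ _).
- apply: le_of_eq; congr (`|_ - _|); rewrite horner_poly; apply: eq_bigr => k _.
  by rewrite expr1n mulr1; ring.
- move=> k t kn t01; rewrite exprSr -mulrA; apply: is_derive_scale.
  by apply: is_derive_line; have [] := su (nseq k i) _ (seg t t01).
- move=> t t01; rewrite normrM normrX mulrC ler_wpM2r ?exprn_ge0 //.
  exact: HB (seg t t01).
Qed.

(* The increment is performed one coordinate at a time, the last one first: only derivatives
   in the sorted order of [mindex_seq] occur, so no symmetry of derivatives is needed. *)
Lemma axis_jet (r : R) L : 0 < r -> uniq L -> forall u (B : nat -> R),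
  smooth_on_R (cube r) u -> (forall k, 0 <= B k) ->
  (forall c x, unzip2 c = L -> `|x| < r -> `|Dseq (mono c) u x| <= B (deg c)) ->
  forall x w, `|x| < r -> (forall i, `|w i| <= 1) -> exists G : nat -> R,
    (forall k, `|G k| <= (size L)%:R ^+ k * (B k / k`!%:R)) /\
    forall n t, `|x + t *: vec L w| < r ->
      `|u (x + t *: vec L w) - \sum_(k < n) G k * t ^+ k| <=
        (size L)%:R ^+ n * (B n / n`!%:R) * `|t| ^+ n.
Proof.
move=> r0; elim/last_ind: L => [_|L i IH uLi] u B.
  move=> su B0 HB x w xr w1.
  have Bx : `|u x| <= B 0%N by apply: (HB [::]).
  exists (fun k => if k is 0%N then u x else 0); split=> [[|k]|[|n] t _].
  - by rewrite expr0 mul1r fact0 divr1.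
  - by rewrite normr0 mulr_ge0 ?exprn_ge0 ?ler0n // divr_ge0 ?ler0n.
  - by rewrite big_ord0 subr0 /vec big_nil scaler0 addr0 expr0 mul1r fact0 divr1 expr0 mulr1.
  - rewrite big_ord_recl big1 => [|k _]; last by rewrite mul0r.
    by rewrite expr0 mulr1 addr0 /vec big_nil scaler0 addr0 subrr normr0 exprS !mul0r.
move: uLi; rewrite rcons_uniq => /andP[iL uL] su B0 HB x w xr w1.
(* The induction hypothesis is applied to all pure derivatives in the last direction, with [B]
   shifted by [a]; the Cauchy product of their jets with the Taylor expansion in that direction is
   the jet sought. *)
have HBa a : exists G : nat -> R,
    (forall k, `|G k| <= (size L)%:R ^+ k * (B (k + a)%N / k`!%:R)) /\
    forall n t, `|x + t *: vec L w| < r ->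
      `|Dseq (nseq a i) u (x + t *: vec L w) - \sum_(k < n) G k * t ^+ k| <=
        (size L)%:R ^+ n * (B (n + a)%N / n`!%:R) * `|t| ^+ n.
  apply: (IH uL (Dseq (nseq a i) u) (fun k => B (k + a)%N)) => //.
    exact: smooth_Dseq.
  move=> c z cL zr; have := HB (rcons c (a, i)) z.
  rewrite /mono /deg /unzip2 /unzip1 !map_rcons flatten_rcons sumn_rcons /= -Dseq_cat.
  by apply => //; congr rcons.
have [G HG] := choice HBa.
pose m : R := (size L)%:R.
have m0 : 0 <= m by rewrite ler0n.
have mS : (size (rcons L i))%:R = m + 1 by rewrite size_rcons -natr1.
exists (fun k => \sum_(a < k.+1) w i ^+ a / a`!%:R * G a (k - a)%N).
have wa a : `|w i ^+ a / a`!%:R| <= (a`!%:R)^-1.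
  rewrite normrM normrX [`|_^-1|]ger0_norm ?invr_ge0 ?ler0n // ler_piMl ?invr_ge0 ?ler0n //.
  by rewrite exprn_ile1.
split=> [k|n t tr].
  apply: le_trans (ler_norm_sum _ _ _) _.
  apply: (@le_trans _ _ (\sum_(a < k.+1) (a`!%:R)^-1 * (m ^+ (k - a) / (k - a)`!%:R) * B k)).
    apply: ler_sum => a _; have ak : (a <= k)%N by rewrite -ltnS.
    rewrite normrM -mulrA; apply: ler_pM => //.
    by apply: le_trans ((HG a).1 _) _; rewrite subnK // mulrA mulrAC.
  by rewrite -mulr_suml binomial_weights mS; apply: le_of_eq; rewrite -mulrA [_^-1 * _]mulrC.
rewrite mS.
have tvec : x + t *: vec (rcons L i) w = (x + t *: vec L w) + (t * w i) *: ebase R i.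
  by rewrite /vec -cats1 big_cat big_seq1 scalerDr scalerA addrA.
(* The norm is the maximum over the coordinates: resetting the last one to its value at [x] stays in
   the cube. *)
have yr : `|x + t *: vec L w| < r.
  apply/(norm_lt_coord _ r0) => l; have := (norm_lt_coord _ r0).1 tr l.
  have := (norm_lt_coord _ r0).1 xr l.
  rewrite !mxE !vec_coord ?rcons_uniq ?iL // mem_rcons in_cons.
  have [->|li] := eqVneq l i; last by [].
  by rewrite (negPf iL) mulr0 addr0.
have := @directional_taylor r u (x + t *: vec L w) i (t * w i) (B n) n r0 su yr.
rewrite -tvec => /(_ tr).
have HBn z : `|z| < r -> `|Dseq (nseq n i) u z| <= B n.
  move=> zr; have := HB (rcons [seq (0%N, l) | l <- L] (n, i)) z.
  rewrite /mono /deg /unzip2 /unzip1 !map_rcons flatten_rcons sumn_rcons -!map_comp /=.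
  by rewrite flatten_nseq0 sumn_map0 map_id add0n; apply.
move=> /(_ HBn); set S1 := \sum_(a < n) _; set U := u _ => H1.
pose S2 := \sum_(a < n) w i ^+ a / a`!%:R * t ^+ a * \sum_(b < n - a) G a b * t ^+ b.
have -> : \sum_(k < n) (\sum_(a < k.+1) w i ^+ a / a`!%:R * G a (k - a)%N) * t ^+ k = S2.
  under eq_bigr do rewrite mulr_suml.
  pose T a b := w i ^+ a / a`!%:R * t ^+ a * (G a b * t ^+ b).
  transitivity (\sum_(k < n) \sum_(a < k.+1) T a (k - a)%N).
    apply: eq_bigr => k _; apply: eq_bigr => a _; rewrite /T.
    have ak : (a <= k)%N by rewrite -ltnS.
    have -> : t ^+ k = t ^+ a * t ^+ (k - a) by rewrite -exprD subnKC.
    ring.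
  by rewrite (triangular_sum T); apply: eq_bigr => a _; rewrite mulr_sumr.
have -> : U - S2 = (U - S1) + (S1 - S2) by ring.
apply: le_trans (ler_normD _ _) _.
apply: (@le_trans _ _ (B n / n`!%:R * `|t| ^+ n +
   \sum_(a < n) (a`!%:R)^-1 * (m ^+ (n - a) / (n - a)`!%:R) * (B n * `|t| ^+ n))).
  apply: lerD.
    apply: le_trans H1 _; rewrite ler_wpM2l ?divr_ge0 ?ler0n //.
    by apply: lerXn2r; rewrite ?nnegrE // normrM ler_piMr.
  rewrite -sumrB; apply: le_trans (ler_norm_sum _ _ _) _; apply: ler_sum => a _.
  have an : (a <= n)%N by rewrite ltnW.
  set D := Dseq _ _ _; set S := \sum_(b < _) _.
  have -> : D / a`!%:R * (t * w i) ^+ a - w i ^+ a / a`!%:R * t ^+ a * S =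
     (w i ^+ a / a`!%:R) * (t ^+ a * (D - S)) by rewrite exprMn; ring.
  rewrite normrM -mulrA; apply: ler_pM => //.
  rewrite normrM normrX.
  apply: (@le_trans _ _ (`|t| ^+ a * (m ^+ (n - a) * (B (n - a + a)%N / (n - a)`!%:R) * `|t| ^+ (n - a)))).
    by rewrite ler_wpM2l ?exprn_ge0 //; exact: ((HG a).2 _ _ yr).
  have -> : `|t| ^+ n = `|t| ^+ a * `|t| ^+ (n - a) by rewrite -exprD subnKC.
  by rewrite subnK //; apply: le_of_eq; ring.
rewrite -mulr_suml.
have := binomial_weights m n; rewrite big_ord_recr /= subnn expr0 fact0 divr1 mulr1.
set Z := \sum_(a < n) _ => E.
apply: le_of_eq; transitivity ((Z + n`!%:R^-1) * (B n * `|t| ^+ n)); first by ring.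
by rewrite E; ring.
Qed.

End AxisJet.

Section ComplexJet.
Local Open Scope complex_scope.
Variables (R : realType) (d : nat).
Local Notation pt := 'rV[R]_d.

Lemma unzip_enum (c : seq (nat * 'I_d)) : unzip2 c = enum 'I_d ->
  exists alpha : 'I_d -> nat, mono c = mindex_seq alpha /\ deg c = mabs alpha.
Proof.
move=> uc; pose alpha i := nth 0%N (unzip1 c) (index i (enum 'I_d)).
have cE : c = [seq (alpha i, i) | i <- enum 'I_d].
  have sz : size c = size (enum 'I_d) by rewrite -uc size_map.
  case: c => [|p c] in uc alpha sz *.
    by move: sz; case: (enum 'I_d).
  apply: (@eq_from_nth _ p); first by rewrite size_map.
  move=> k kc; rewrite (nth_map p.2) -?sz // /alpha index_uniq ?enum_uniq -?sz //.
  rewrite -uc (nth_map p) // (nth_map p) //; by case: (nth _ _ _).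
exists alpha; split; first by rewrite {1}cE /mono -map_comp.
by rewrite {1}cE /deg /unzip1 -map_comp /mabs sumnE big_map big_enum.
Qed.

Lemma vec_enum (v : pt) : vec (enum 'I_d) (fun i => v 0 i) = v.
Proof.
apply/rowP => l; rewrite vec_coord ?enum_uniq // mem_enum //.
Qed.

Lemma smooth_jet (M : nat -> R) (f : pt -> R[i]) (rho sigma : R) :
  0 < rho -> 0 < sigma -> (forall k, 0 < M k) -> B_M_sigma M sigma (cube rho) f ->
  exists2 A : R, 1 <= A & forall x v : pt, `|x| < rho -> `|v| <= 1 -> exists G,
    jet M A (d%:R * sigma) (fun t => f (x + t *: v)) (fun t => `|t| <= 1 /\ `|x + t *: v| < rho) G.
Proof.
move=> r0 s0 M0 [[sR sI] [C HC]].
pose B k := (`|C| + 1) * (sigma ^+ k * M k).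
have B0 k : 0 <= B k.
  by rewrite /B mulr_ge0 ?addr_ge0 // mulr_ge0 ?exprn_ge0 ?(ltW s0) // ltW.
have bound c x : unzip2 c = enum 'I_d -> `|x| < rho ->
    `|Dseq (mono c) (ReF f) x| <= B (deg c) /\ `|Dseq (mono c) (ImF f) x| <= B (deg c).
  move=> /unzip_enum[alpha [-> ->]] xr.
  have := HC x alpha xr; rewrite nc_normE lecR => H.
  have {}H : nc (pderiv alpha f x) <= B (mabs alpha).
    apply: le_trans H _; rewrite ler_wpM2r ?mulr_ge0 ?exprn_ge0 ?(ltW s0) ?(ltW (M0 _)) //.
    by have := ler_norm C; lra.
  split; first exact: le_trans (normRe_le (pderiv alpha f x)) H.
  exact: le_trans (normIm_le (pderiv alpha f x)) H.
exists (2 * (`|C| + 1)); first by have := normr_ge0 C; lra.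
move=> x v xr v1.
have w1 i : `|v 0 i| <= 1 by apply: le_trans (norm_coord _ _) v1.
have bR c x0 : unzip2 c = enum 'I_d -> `|x0| < rho -> `|Dseq (mono c) (ReF f) x0| <= B (deg c).
  by move=> h1 h2; case: (bound c x0 h1 h2).
have bI c x0 : unzip2 c = enum 'I_d -> `|x0| < rho -> `|Dseq (mono c) (ImF f) x0| <= B (deg c).
  by move=> h1 h2; case: (bound c x0 h1 h2).
have [GR [GRk GRr]] := axis_jet r0 (enum_uniq _) sR B0 bR xr w1.
have [GI [GIk GIr]] := axis_jet r0 (enum_uniq _) sI B0 bI xr w1.
rewrite vec_enum size_enum_ord in GRk GRr GIk GIr.
have BE k : 2 * (d%:R ^+ k * (B k / k`!%:R)) =
   2 * (`|C| + 1) * (d%:R * sigma) ^+ k * (M k / k`!%:R) :> R.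
  by rewrite /B exprMn; ring.
exists (fun k => Complex (GR k) (GI k)); split=> [k|n t [_ tr]].
  apply: le_trans (nc_le_ReIm _) _ => /=; rewrite -BE mulr_natl mulr2n.
  by apply: lerD; [exact: GRk|exact: GIk].
apply: le_trans (nc_le_ReIm _) _; rewrite -BE.
have hP : (trunc (fun k => Complex (GR k) (GI k)) n).[t%:C] =
   Complex (\sum_(k < n) GR k * t ^+ k) (\sum_(k < n) GI k * t ^+ k).
  rewrite horner_poly; elim: n {GRr GIr} => [|n IH]; first by rewrite !big_ord0.
  rewrite !big_ord_recr /= IH -RealCX.
  by apply/eqP; rewrite eq_complex /= mulr0 subr0 mulr0 add0r !eqxx.
rewrite hP; have := GRr n t tr; have := GIr n t tr.
rewrite /ReF /ImF; case: (f _) => a b /= h1 h2.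
by apply: le_trans (lerD h2 h1) _; apply: le_of_eq; ring.
Qed.

End ComplexJet.

(** * Mixed differences *)

Section AltSum.
Variable R : realType.

(* [altsum [:: z1; ...; zq] Phi] is the sum over the subsets [I] of the indices of
   [(-1) ^ (q - #|I|) * Phi (\sum_(i in I) zi)], the mixed difference of [Phi] at [0]. *)
Fixpoint altsum (Z : zmodType) (zs : seq Z) (Phi : Z -> R) : R :=
  if zs is z :: zs' then altsum zs' (fun y => Phi (z + y)) - altsum zs' Phi else Phi 0.

Lemma eq_altsum (Z : zmodType) (zs : seq Z) (Phi Psi : Z -> R) :
  Phi =1 Psi -> altsum zs Phi = altsum zs Psi.
Proof. by move=> E; congr altsum; apply/funext. Qed.

Lemma altsum_sum (Z : zmodType) (zs : seq Z) n (c : nat -> R) (Phi : nat -> Z -> R) :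
  altsum zs (fun y => \sum_(k < n) c k * Phi k y) = \sum_(k < n) c k * altsum zs (Phi k).
Proof.
elim: zs Phi => [//|z zs IH] Phi /=; rewrite !IH (IH (fun k y => Phi k (z + y))) -sumrB.
by apply: eq_bigr => k _; rewrite mulrBr.
Qed.

Lemma altsumD (Z : zmodType) (zs : seq Z) (Phi Psi : Z -> R) :
  altsum zs (fun y => Phi y + Psi y) = altsum zs Phi + altsum zs Psi.
Proof.
elim: zs Phi Psi => [//|z zs IH] Phi Psi /=.
by have := IH (fun y => Phi (z + y)) (fun y => Psi (z + y)) => /= ->; rewrite IH; ring.
Qed.

Lemma altsum_invariant (Z : zmodType) (zs : seq Z) (z : Z) (Phi : Z -> R) : z \in zs ->
  (forall y, Phi (z + y) = Phi y) -> altsum zs Phi = 0.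
Proof.
elim: zs Phi => [//|z' zs IH] Phi; rewrite in_cons => /predU1P[<-|zin] H /=.
  by rewrite (eq_altsum _ (Psi := Phi)) ?subrr.
by rewrite !IH ?subrr // => y; rewrite addrCA H.
Qed.

Lemma altsum_map (Z Z' : zmodType) (f : Z -> Z') (zs : seq Z) (Phi : Z' -> R) :
  f 0 = 0 -> (forall x y, f (x + y) = f x + f y) ->
  altsum [seq f z | z <- zs] Phi = altsum zs (fun y => Phi (f y)).
Proof.
move=> f0 fD; elim: zs Phi => [|z zs IH] Phi /=; first by rewrite f0.
by rewrite !IH; congr (_ - _); apply: eq_altsum => y; rewrite fD.
Qed.

Lemma altsum_le (Z : zmodType) (N : Z -> R) (a B : R) (zs : seq Z) (Phi : Z -> R) :
  N 0 <= 0 -> (forall x y, N (x + y) <= N x + N y) -> 0 <= a ->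
  (forall z, z \in zs -> N z <= a) ->
  (forall y, N y <= a * (size zs)%:R -> `|Phi y| <= B) ->
  `|altsum zs Phi| <= 2 ^+ size zs * B.
Proof.
move=> N0 ND a0; elim: zs Phi => [|z zs IH] Phi Nz HB /=.
  by rewrite expr0 mul1r; apply: HB; rewrite mulr0.
apply: le_trans (ler_normB _ _) _; rewrite exprS -mulrA mulr_natl mulr2n.
have Nz' z' : z' \in zs -> N z' <= a by move=> zin; apply: Nz; rewrite in_cons zin orbT.
apply: lerD; apply: IH => // y Ny; apply: HB; rewrite /= -natr1 mulrDr mulr1.
  by rewrite addrC (le_trans (ND _ _)) // lerD // Nz // mem_head.
by rewrite (le_trans Ny) // lerDl.
Qed.

End AltSum.

Section Djokovic.
Variables (R : realType) (d : nat).
Local Notation pt := 'rV[R]_d.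
Implicit Types (u : pt -> R) (x v w : pt).

Definition pdiff q u (b w : pt) : R :=
  \sum_(k < q.+1) (-1) ^+ k * ('C(q, k))%:R * u (b + k%:R *: w).

(** Working on pairs lets one mixed difference move the base point and the step of a pure difference
    together. The divisor is [k + 1] because increments are numbered from 0. *)
Definition djok (vs : seq pt) : seq (pt * pt) :=
  [seq (nth 0 vs k, (k.+1%:R : R)^-1 *: nth 0 vs k) | k <- iota 0 (size vs)].

(* Djokovic's polarization identity: in the expansion of the pure differences on the
   right, the term of index [k > 0] is invariant under the [k]-th increment. *)
Lemma mixed_pure_difference (vs : seq pt) u x :
  altsum vs (fun y => u (x + y)) =
  altsum (djok vs) (fun y => pdiff (size vs) u (x + y.1) (- y.2)).
Proof.
pose q := size vs.
rewrite (altsum_sum (djok vs) q.+1 (fun k => (-1) ^+ k * ('C(q, k))%:R)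
   (fun k y => u (x + y.1 + k%:R *: - y.2))) big_ord_recl big1 => [|k _].
  rewrite expr0 bin0 mulr1 mul1r addr0.
  have -> : altsum vs (fun y => u (x + y)) = altsum [seq z.1 | z <- djok vs] (fun y => u (x + y)).
    congr altsum; rewrite /djok -map_comp /comp /=.
    by rewrite -/(mkseq _ _) mkseq_nth.
  by rewrite altsum_map //; apply: eq_altsum => y; rewrite scale0r addr0.
rewrite (@altsum_invariant _ _ _ (nth 0 vs k, (k.+1%:R : R)^-1 *: nth 0 vs k)) ?mulr0 //.
  by apply/mapP; exists (k : nat) => //; rewrite mem_iota /= add0n.
move=> y /=; congr u; rewrite /bump /= add1n opprD scalerDr scalerN scalerA.
rewrite mulfV ?pnatr_eq0 // scale1r.
by rewrite [_ + y.1]addrC !addrA addrK.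
Qed.

End Djokovic.

(** By Pascal's rule the alternating sum of order [q + 1] of [p] is the one of order [q] of
    [p - p (X + 1)], in which the leading terms cancel. *)
Lemma alternating_binomial_poly (R : realType) q (p : {poly R}) : (size p <= q)%N ->
  \sum_(k < q.+1) (-1) ^+ k * ('C(q, k))%:R * p.[k%:R] = 0.
Proof.
elim: q p => [|q IH] p sp.
  move: sp; rewrite leqn0 size_poly_eq0 => /eqP ->.
  by rewrite big1 // => k _; rewrite horner0 mulr0.
have sr : (size (p \Po ('X + 1%:P)) <= q.+1)%N.
  by rewrite size_comp_poly2 // size_XaddC.
have H p1 : \sum_(k < q.+2) (-1) ^+ k * ('C(q.+1, k))%:R * p1.[k%:R] =
    \sum_(k < q.+1) (-1) ^+ k * ('C(q, k))%:R * (p1 - (p1 \Po ('X + 1%:P))).[k%:R] :> R.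
  have -> : \sum_(k < q.+1) (-1) ^+ k * ('C(q, k))%:R * (p1 - (p1 \Po ('X + 1%:P))).[k%:R] =
     \sum_(k < q.+1) (-1) ^+ k * ('C(q, k))%:R * p1.[k%:R] -
     \sum_(k < q.+1) (-1) ^+ k * ('C(q, k))%:R * p1.[k.+1%:R].
    rewrite -sumrB; apply: eq_bigr => k _.
    by rewrite hornerD hornerN horner_comp hornerD hornerX hornerC natr1 mulrBr.
  rewrite big_ord_recl /= [X in _ = X - _]big_ord_recl /= !bin0 -addrA; congr (_ + _).
  under eq_bigr => k _.
    rewrite /bump /= add1n binS natrD exprS.
    have -> : -1 * (-1) ^+ k * (('C(q, k.+1))%:R + ('C(q, k))%:R) * p1.[k.+1%:R] =
      (-1) ^+ k.+1 * ('C(q, k.+1))%:R * p1.[k.+1%:R] - (-1) ^+ k * ('C(q, k))%:R * p1.[k.+1%:R].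
      by rewrite exprS; ring.
    over.
  rewrite sumrB; congr (_ - _).
  by rewrite big_ord_recr /= bin_small // mulr0 mul0r addr0; apply: eq_bigr => k _.
rewrite H; apply: IH; apply/leq_sizeP => k.
rewrite leq_eqVlt => /predU1P[<-|qk]; last first.
  by rewrite coefB (leq_sizeP _ _ sp _ qk) (leq_sizeP _ _ sr _ qk) subrr.
have [qp|pq] := leqP (size p) q.
  have sr' : (size (p \Po ('X + 1%:P)) <= q)%N by rewrite size_comp_poly2 // size_XaddC.
  by rewrite coefB (leq_sizeP _ _ qp _ (leqnn q)) (leq_sizeP _ _ sr' _ (leqnn q)) subrr.
have sq : size p = q.+1 by apply/eqP; rewrite eqn_leq sp.
have sq' : size (p \Po ('X + 1%:P)) = q.+1 by rewrite size_comp_poly2 // size_XaddC.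
have := @lead_coef_comp R p ('X + 1%:P); rewrite size_XaddC => /(_ isT).
by rewrite lead_coefXaddC expr1n mulr1 !lead_coefE sq sq' /= coefB => ->; rewrite subrr.
Qed.

Section PureDifferences.
Variables (R : realType) (d : nat).
Local Notation pt := 'rV[R]_d.
Implicit Types (u : pt -> R) (x v w b : pt).

Definition expands (r : R) (K : nat -> R) u x v (a : nat -> R) :=
  forall q t, `|t| <= 1 -> `|x + t *: v| < r ->
    `|u (x + t *: v) - \sum_(k < q) a k * t ^+ k| <= K q * `|t| ^+ q.

(** The difference of order [q] kills the Taylor polynomial of degree below [q]; only remainders at
    the points [x + k w] are left, at distance at most [q |w|]. *)
Lemma pdiff_le_expands r K u x q w : (forall q, 0 <= K q) ->
  (forall v, `|v| <= 1 -> exists a, expands r K u x v a) ->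
  `|w| * q%:R <= 1 -> (forall k, (k <= q)%N -> `|x + k%:R *: w| < r) ->
  `|pdiff q u x w| <= 2 ^+ q * (q%:R ^+ q * K q) * `|w| ^+ q.
Proof.
move=> K0 Hx wq wr; pose t := `|w|; pose v := t^-1 *: w.
have wv k : k%:R *: w = (k%:R * t) *: v.
  rewrite /v scalerA; have [t0|t0] := eqVneq t 0; last by rewrite mulfK.
  by rewrite (normr0_eq0 t0) !scaler0.
have v1 : `|v| <= 1.
  rewrite normrZ normfV normr_id; have [t0|t0] := eqVneq t 0.
    by rewrite -/t t0 mulr0.
  by rewrite mulVf.
have [a Ha] := Hx v v1.
pose p := \poly_(i < q) (a i * t ^+ i).
have pE k : p.[k%:R] = \sum_(i < q) a i * (k%:R * t) ^+ i.
  by rewrite horner_poly; apply: eq_bigr => i _; rewrite exprMn; ring.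
have -> : pdiff q u x w =
   \sum_(k < q.+1) (-1) ^+ k * ('C(q, k))%:R * (u (x + k%:R *: w) - p.[k%:R]).
  have := alternating_binomial_poly (size_poly q (fun i => a i * t ^+ i)); rewrite -/p => E.
  by under [RHS]eq_bigr do rewrite mulrBr; rewrite sumrB E subr0.
apply: le_trans (ler_norm_sum _ _ _) _.
have -> : 2 ^+ q = \sum_(k < q.+1) ('C(q, k))%:R :> R.
  have := exprDn (1 : R) 1 q; rewrite -(natrD _ 1 1) => ->; apply: eq_bigr => k _.
  by rewrite !expr1n mulr1.
rewrite !mulr_suml; apply: ler_sum => k _.
have kq : (k <= q)%N by rewrite -ltnS.
rewrite normrM normrM normrX normrN1 expr1n mul1r normr_nat -mulrA.
apply: ler_wpM2l; first exact: ler0n.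
have t0 : 0 <= t by rewrite normr_ge0.
have kt : k%:R * t <= q%:R * t by rewrite ler_wpM2r // ler_nat.
rewrite pE wv; apply: le_trans (Ha q _ _ _) _.
- rewrite ger0_norm ?mulr_ge0 //; apply: le_trans kt _; by rewrite mulrC.
- by rewrite -wv; apply: wr.
rewrite ger0_norm ?mulr_ge0 // -/t [_ * K q]mulrC -mulrA -exprMn.
by apply: ler_wpM2l => //; apply: lerXn2r; rewrite // nnegrE mulr_ge0.
Qed.

Definition dense_in (r : R) (G : set pt) :=
  forall x (B : set pt), `|x| < r -> nbhs x B -> exists2 y, B y & G y.

Lemma continuous_le_dense r (G : set pt) (F : pt -> R) (B : R) (V : set pt) x :
  dense_in r G -> `|x| < r -> {for x, continuous F} -> nbhs x V ->
  (forall y, G y -> V y -> `|F y| <= B) -> `|F x| <= B.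
Proof.
move=> dG xr cF VN HB; rewrite leNgt; apply/negP => lt.
have N : nbhs x [set y | B < `|F y|].
  have cN : {for x, continuous (fun y => `|F y|)}.
    by apply: continuous_comp => //; exact: norm_continuous.
  by apply: (cN [set z | B < z]); apply: open_nbhs_nbhs; split; [exact: open_gt|].
have [y [Vy Ny] Gy] := dG x _ xr (filterI VN N).
by have := HB y Gy Vy; rewrite leNgt; move/negP; apply.
Qed.

Lemma continuous_at_sum n (F : 'I_n -> pt -> R) x :
  (forall k, {for x, continuous (F k)}) ->
  {for x, continuous (fun y => \sum_(k < n) F k y)}.
Proof.
elim: n F => [|n IH] F H.
  have -> : (fun y => \sum_(k < 0) F k y) = fun=> 0 by apply/funext => y; rewrite big_ord0.
  exact: cst_continuous.
have -> : (fun y => \sum_(k < n.+1) F k y) =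
    (fun y => \sum_(k < n) F (widen_ord (leqnSn n) k) y) \+ F ord_max.
  by apply/funext => y; rewrite big_ord_recr.
by apply: continuousD; [apply: IH => k; exact: H|exact: H].
Qed.

Lemma nbhs_norm_lt (r : R) (w x : pt) : `|x + w| < r -> nbhs x [set y | `|y + w| < r].
Proof.
move=> xr.
have cN : {for x, continuous (fun y : pt => `|y + w|)}.
  apply: continuous_comp; last exact: norm_continuous.
  by apply: continuousD; [exact: id|exact: cst_continuous].
by apply: (cN [set z | z < r]); apply: open_nbhs_nbhs; split; [exact: open_lt|].
Qed.

(** With the step [w] fixed, the pure difference is continuous in the base point, so the uniform
    bound at base points in [G] extends to all admissible ones. *)
Lemma pdiff_le r K u (G : set pt) q b w : (forall q, 0 <= K q) -> dense_in r G ->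
  (forall x, `|x| < r -> {for x, continuous u}) ->
  (forall x v, G x -> `|v| <= 1 -> exists a, expands r K u x v a) ->
  `|w| * q%:R <= 1 -> (forall k, (k <= q)%N -> `|b + k%:R *: w| < r) ->
  `|pdiff q u b w| <= 2 ^+ q * (q%:R ^+ q * K q) * `|w| ^+ q.
Proof.
move=> K0 dG cu HG wq wr.
have br : `|b| < r by have := wr 0%N isT; rewrite scale0r addr0.
apply: (@continuous_le_dense r G (fun b => pdiff q u b w) _
   [set y | forall k : 'I_q.+1, `|y + (k : nat)%:R *: w| < r]) => //.
- have cuk (k : 'I_q.+1) : {for b, continuous (fun y : pt => u (y + (k : nat)%:R *: w))}.
    apply: (@continuous_comp _ _ _ (fun y : pt => y + (k : nat)%:R *: w) u).
      by apply: continuousD; [exact: id|exact: cst_continuous].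
    by apply: cu; apply: wr; rewrite -ltnS.
  have cterm (k : 'I_q.+1) : {for b, continuous (fun y : pt =>
      (-1) ^+ k * ('C(q, k))%:R * u (y + (k : nat)%:R *: w))}.
    by apply: continuousM; [exact: cst_continuous|exact: cuk].
  exact: (continuous_at_sum cterm).
- apply: (@filter_forall pt _ (fun k : 'I_q.+1 => [set y | `|y + (k : nat)%:R *: w| < r]) _
    (nbhs_filter b)) => k.
  by apply: nbhs_norm_lt; apply: wr; rewrite -ltnS.
move=> y Gy /= yk; apply: (pdiff_le_expands K0) => //.
  by move=> v; apply: HG.
by move=> k kq; have := yk (Ordinal (kq : (k < q.+1)%N)).
Qed.

End PureDifferences.

(** * Smoothness from bounds on differences *)

Section SecondDifferences.
Variable R : realType.
Implicit Types (g : R -> R) (K r : R).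

Lemma first_differences_step g K e m : 0 <= K -> 0 < e ->
  (forall k, (k.+2 <= m)%N ->
    `|g (k.+2%:R * e) - 2 * g (k.+1%:R * e) + g (k%:R * e)| <= K * e ^+ 2) ->
  forall k, (k <= m)%N -> `|(g (k%:R * e) - g 0) - k%:R * (g e - g 0)| <= K * (k%:R * e) ^+ 2.
Proof.
move=> K0 e0 H.
have D k : (k < m)%N -> `|(g (k.+1%:R * e) - g (k%:R * e)) - (g e - g 0)| <= k%:R * (K * e ^+ 2).
  elim: k => [|k IH] km; first by rewrite !mul0r mul1r subrr normr0.
  have -> : g (k.+2%:R * e) - g (k.+1%:R * e) - (g e - g 0) =
     (g (k.+2%:R * e) - 2 * g (k.+1%:R * e) + g (k%:R * e)) +
     (g (k.+1%:R * e) - g (k%:R * e) - (g e - g 0)) by ring.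
  apply: le_trans (ler_normD _ _) _; 
  have -> : k.+1%:R * (K * e ^+ 2) = K * e ^+ 2 + k%:R * (K * e ^+ 2) by rewrite -natr1; ring.
  by apply: lerD; [exact: H|apply: IH; exact: ltnW].
elim=> [|k IH] km; first by rewrite !mul0r !subrr normr0 expr0n mulr0.
have -> : g (k.+1%:R * e) - g 0 - k.+1%:R * (g e - g 0) =
   (g (k%:R * e) - g 0 - k%:R * (g e - g 0)) +
   (g (k.+1%:R * e) - g (k%:R * e) - (g e - g 0)) by rewrite -natr1; ring.
apply: le_trans (ler_normD _ _) _.
apply: (@le_trans _ _ (K * (k%:R * e) ^+ 2 + k%:R * (K * e ^+ 2))).
  by apply: lerD; [apply: IH; exact: ltnW|exact: D].
rewrite -natr1; have k0 : 0 <= k%:R :> R by [].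
have : 0 <= K * e ^+ 2 * (k%:R + 1) by do 2!apply: mulr_ge0 => //; rewrite ?sqr_ge0 ?addr_ge0.
set z : R := k%:R in k0 * => h.
rewrite -subr_ge0; have -> : K * ((z + 1) * e) ^+ 2 - (K * (z * e) ^+ 2 + z * (K * e ^+ 2)) =
  K * e ^+ 2 * (z + 1) by ring.
exact: h.
Qed.

(** Both steps are replaced by multiples of a small [e], exactly for [h = m e] and up to less than
    [e] for [h']. Along multiples of [e] the second differences are summed; the first-difference
    bound pays for the mismatch, which tends to 0 with [e]. *)
Lemma quotient_compare g K r h h' : 0 <= K ->
  (forall a e, 0 <= a -> 0 < e -> a + e <= r -> `|g (a + e) - g a| <= K * e) ->
  (forall a e, 0 <= a -> 0 < e -> a + 2 * e <= r ->
     `|g (a + 2 * e) - 2 * g (a + e) + g a| <= K * e ^+ 2) ->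
  0 < h <= r -> 0 < h' <= r ->
  `|h' * (g h - g 0) - h * (g h' - g 0)| <= K * (h * h' * (h + h')).
Proof.
move=> K0 H1 H2 /andP[h0 hr] /andP[h'0 h'r].
apply/ler_addgt0Pr => eps eps0.
pose m := (Num.truncn (2 * K * h ^+ 2 / eps)).+1.
have mP : 2 * K * h ^+ 2 / eps < m%:R by rewrite /m truncnS_gt.
have m0 : 0 < m%:R :> R by rewrite ltr0n.
have [e eE] : exists e, e = h / m%:R by exists (h / m%:R).
have e0 : 0 < e by rewrite eE divr_gt0.
have me : m%:R * e = h by rewrite eE mulrC mulfVK ?gt_eqF.
pose n := Num.truncn (h' / e).
have he0 : 0 <= h' / e by rewrite divr_ge0 // ltW.
have nle : n%:R * e <= h' by rewrite -ler_pdivlMr // truncn_le.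
have nlt : h' < n.+1%:R * e by rewrite -ltr_pdivrMr // truncnS_gt.
have G k (c : R) : k%:R * e <= c -> c <= r ->
    `|(g (k%:R * e) - g 0) - k%:R * (g e - g 0)| <= K * (k%:R * e) ^+ 2.
  move=> kc cr; apply: (first_differences_step K0 e0 (m := k)) => // l lk.
  have le0 : 0 <= l%:R * e by rewrite mulr_ge0 // ltW.
  have := H2 (l%:R * e) e le0 e0.
  have -> : l%:R * e + 2 * e = l.+2%:R * e by rewrite -!natr1; ring.
  have -> : l%:R * e + e = l.+1%:R * e by rewrite -!natr1; ring.
  apply; apply: le_trans _ cr; apply: le_trans _ kc; by rewrite ler_pM2r // ler_nat.
have Gn := G n h' nle h'r; have Gm := G m h; rewrite me lexx in Gm; have {}Gm := Gm isT hr.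
have ne0 : 0 <= n%:R * e by rewrite mulr_ge0 // ltW.
have near : `|g h' - g (n%:R * e)| <= K * e.
  have [E|nh] := eqVneq h' (n%:R * e); first by rewrite {1}E subrr normr0 mulr_ge0 // ltW.
  have lt : 0 < h' - n%:R * e by rewrite subr_gt0 lt_neqAle eq_sym nh.
  have := H1 (n%:R * e) (h' - n%:R * e) ne0 lt; rewrite subrKC => /(_ h'r) E.
  apply: le_trans E _; apply: ler_wpM2l => //; rewrite lerBlDl ltW //.
  by move: nlt; rewrite -natr1 mulrDl mul1r.
have full : `|g h - g 0| <= K * h.
  by have := H1 0 h (lexx _) h0; rewrite add0r => /(_ hr).
have -> : h' * (g h - g 0) - h * (g h' - g 0) =
   (n%:R * e) * ((g h - g 0) - m%:R * (g e - g 0))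
   - h * ((g (n%:R * e) - g 0) - n%:R * (g e - g 0))
   + (h' - n%:R * e) * (g h - g 0) - h * (g h' - g (n%:R * e)).
  have key : n%:R * e * (m%:R * (g e - g 0)) = h * (n%:R * (g e - g 0)).
    by transitivity (m%:R * e * (n%:R * (g e - g 0))); [ring|rewrite me].
  have -> : n%:R * e * (g h - g 0 - m%:R * (g e - g 0)) =
      n%:R * e * (g h - g 0) - h * (n%:R * (g e - g 0)) by rewrite mulrBr key.
  by ring.
apply: le_trans (ler_normB _ _) _; apply: le_trans (lerD (ler_normD _ _) (lexx _)) _.
apply: le_trans (lerD (lerD (ler_normB _ _) (lexx _)) (lexx _)) _.
rewrite !normrM normr_nat (gtr0_norm h0) (gtr0_norm e0).
have -> : `|h' - n%:R * e| = h' - n%:R * e by rewrite ger0_norm // subr_ge0.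
have p1 : n%:R * e * `|g h - g 0 - m%:R * (g e - g 0)| <= h' * (K * h ^+ 2).
  by apply: ler_pM => //.
have p2 : h * `|g (n%:R * e) - g 0 - n%:R * (g e - g 0)| <= h * (K * h' ^+ 2).
  apply: ler_wpM2l; first exact: ltW.
  apply: le_trans Gn _; apply: ler_wpM2l => //; apply: lerXn2r => //; by rewrite nnegrE // ltW.
have p3 : (h' - n%:R * e) * `|g h - g 0| <= e * (K * h).
  apply: ler_pM => //; first by rewrite subr_ge0.
  by rewrite lerBlDl ltW //; move: nlt; rewrite -natr1 mulrDl mul1r.
have p4 : h * `|g h' - g (n%:R * e)| <= h * (K * e) by apply: ler_wpM2l => //; exact: ltW.
apply: le_trans (lerD (lerD (lerD p1 p2) p3) p4) _.
have q : 2 * K * h * e <= eps.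
  rewrite eE mulrA ler_pdivrMr // [eps * _]mulrC.
  move: mP; rewrite ltr_pdivrMr // => mP; apply: le_trans (ltW mP).
  by apply: le_of_eq; ring.
have -> : h' * (K * h ^+ 2) + h * (K * h' ^+ 2) + e * (K * h) + h * (K * e) =
  K * (h * h' * (h + h')) + 2 * K * h * e by ring.
by rewrite lerD2l.
Qed.

(** By [quotient_compare], [q h - K h <= q h' + K h'] for any two steps; the supremum of the left
    sides separates the two families and is the derivative. *)
Lemma right_derivative g K r : 0 <= K -> 0 < r ->
  (forall a e, 0 <= a -> 0 < e -> a + e <= r -> `|g (a + e) - g a| <= K * e) ->
  (forall a e, 0 <= a -> 0 < e -> a + 2 * e <= r ->
     `|g (a + 2 * e) - 2 * g (a + e) + g a| <= K * e ^+ 2) ->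
  exists L, forall h, 0 <= h <= r -> `|g h - g 0 - h * L| <= K * h ^+ 2.
Proof.
move=> K0 r0 H1 H2.
pose q h := (g h - g 0) / h.
have qq h h' : 0 < h <= r -> 0 < h' <= r -> q h - K * h <= q h' + K * h'.
  move=> hr h'r; have := quotient_compare K0 H1 H2 hr h'r.
  case/andP: hr => h0 _; case/andP: h'r => h'0 _.
  move=> /ler_normlP[_]; rewrite /q => E.
  rewrite -subr_ge0 -(pmulr_rge0 _ (mulr_gt0 h0 h'0)).
  have -> : h * h' * ((g h' - g 0) / h' + K * h' - ((g h - g 0) / h - K * h)) =
    K * (h * h' * (h + h')) - (h' * (g h - g 0) - h * (g h' - g 0)).
    by field; rewrite !gt_eqF.
  by rewrite subr_ge0.
pose S := [set q h - K * h | h in [set h | 0 < h <= r]].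
have S0 : S !=set0 by exists (q r - K * r); exists r; rewrite //= r0 lexx.
have ubS h : 0 < h <= r -> ubound S (q h + K * h).
  by move=> hr _ [h' h'r <-]; exact: qq.
exists (sup S) => h /andP[h0 hr].
have [->|hn0] := eqVneq h 0; first by rewrite subrr mul0r subr0 normr0 expr0n mulr0.
have hp : 0 < h <= r by rewrite lt_neqAle eq_sym hn0 h0.
have up : sup S <= q h + K * h by apply: ge_sup => //; exact: ubS.
have lo : q h - K * h <= sup S.
  by apply: ub_le_sup; [exists (q h + K * h); exact: ubS|exists h].
have -> : g h - g 0 - h * sup S = h * (q h - sup S) by rewrite /q; field.
have -> : K * h ^+ 2 = h * (K * h) by ring.
rewrite normrM ger0_norm //; apply: ler_wpM2l => //.
by rewrite ler_norml; apply/andP; split; lra.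
Qed.

(** The one-sided derivatives are matched at 0 by the second difference centred there. *)
Lemma two_sided_derivative g K r : 0 <= K -> 0 < r ->
  (forall a e, - r <= a -> 0 < e -> a + e <= r -> `|g (a + e) - g a| <= K * e) ->
  (forall a e, - r <= a -> 0 < e -> a + 2 * e <= r ->
     `|g (a + 2 * e) - 2 * g (a + e) + g a| <= K * e ^+ 2) ->
  exists D, forall t, `|t| <= r -> `|g t - g 0 - t * D| <= K * `|t| ^+ 2.
Proof.
move=> K0 r0 H1 H2.
have [||D HD] := @right_derivative g K r K0 r0.
- by move=> a e a0; apply: H1; lra.
- by move=> a e a0; apply: H2; lra.
have [||D' HD'] := @right_derivative (fun t => g (- t)) K r K0 r0.
- move=> a e a0 e0 ae; have := H1 (- (a + e)) e; rewrite distrC.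
  by have -> : - (a + e) + e = - a by [ring|]; apply; lra.
- move=> a e a0 e0 ae; have := H2 (- (a + 2 * e)) e.
  have -> : - (a + 2 * e) + 2 * e = - a by ring.
  have -> : - (a + 2 * e) + e = - (a + e) by ring.
  have -> : g (- (a + 2 * e)) - 2 * g (- (a + e)) + g (- a) =
    g (- a) - 2 * g (- (a + e)) + g (- (a + 2 * e)) by ring.
  by apply; lra.
have E : D' = - D.
  apply/eqP; rewrite -subr_eq0 opprK -normr_le0; apply/ler_addgt0Pr => eps eps0.
  pose h := Num.min r (eps / (3 * K + 1)).
  have K1 : 0 < 3 * K + 1 by lra.
  have h0 : 0 < h by rewrite /h lt_min r0 divr_gt0.
  have hr : h <= r by rewrite /h ge_min lexx.
  have he : h * (3 * K + 1) <= eps by rewrite -ler_pdivlMr // /h ge_min lexx orbT.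
  have h0r : 0 <= h <= r by rewrite ltW.
  have A1 := HD h h0r; have A2 := HD' h h0r; rewrite oppr0 in A2.
  have A3 : `|g h - 2 * g 0 + g (- h)| <= K * h ^+ 2.
    have := H2 (- h) h; have -> : - h + 2 * h = h by ring.
    by rewrite addNr; apply; lra.
  have A : h * `|D' + D| <= h * (3 * K * h).
    rewrite -{1}(ger0_norm (ltW h0)) -normrM.
    have -> : h * (D' + D) = (g h - 2 * g 0 + g (- h)) - (g h - g 0 - h * D) -
       (g (- h) - g 0 - h * D') by ring.
    apply: le_trans (ler_normB _ _) _; apply: le_trans (lerD (ler_normB _ _) (lexx _)) _.
    apply: le_trans (lerD (lerD A3 A1) A2) _; apply: le_of_eq; ring.
  rewrite add0r; move: A; rewrite ler_pM2l // => A; apply: le_trans A _; lra.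
exists D => t tr; have [t0|t0] := leP 0 t.
  by rewrite (ger0_norm t0); apply: HD; move: tr; rewrite (ger0_norm t0) t0.
have tr' : 0 <= - t <= r by move: tr; rewrite (ltr0_norm t0); lra.
by have := HD' _ tr'; rewrite opprK oppr0 E (ltr0_norm t0) mulrNN.
Qed.

End SecondDifferences.

Section Differences.
Variables (R : realType) (d : nat).
Local Notation pt := 'rV[R]_d.
Local Notation eb := (@ebase R d).
Implicit Types (u w : pt -> R) (x v c : pt) (s : seq 'I_d) (h r K : R).

Fixpoint Dl s h u x : R :=
  if s is i :: s' then Dl s' h u (x + h *: eb i) - Dl s' h u x else u x.

Lemma Dl_altsum s h u x :
  Dl s h u x = altsum [seq h *: eb i | i <- s] (fun y => u (x + y)).
Proof.
elim: s x => [|i s IH] x /=; first by rewrite addr0.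
by rewrite !IH; congr (_ - _); apply: eq_altsum => y; rewrite addrA.
Qed.

Lemma Dl_sub s h u w x : Dl s h (fun y => u y - w y) x = Dl s h u x - Dl s h w x.
Proof. by elim: s x => [//|i s IH] x /=; rewrite !IH; ring. Qed.

Lemma Dl_scale s h (k : R) u x : Dl s h (fun y => k * u y) x = k * Dl s h u x.
Proof. by elim: s x => [//|i s IH] x /=; rewrite !IH; ring. Qed.

Lemma Dl_shift s h u c x : Dl s h (fun y => u (y + c)) x = Dl s h u (x + c).
Proof. by elim: s x => [//|i s IH] x /=; rewrite !IH addrAC. Qed.

Lemma normD_ebase x h i : `|x + h *: eb i| <= `|x| + `|h|.
Proof.
apply: le_trans (ler_normD _ _) _; rewrite lerD2l normrZ ler_piMr //.
exact: norm_ebase_le1.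
Qed.

Lemma Dl_le s h u x (B : R) :
  (forall y, `|y| <= `|x| + `|h| * (size s)%:R -> `|u y| <= B) ->
  `|Dl s h u x| <= 2 ^+ size s * B.
Proof.
elim: s x => [|i s IH] x HB /=; first by rewrite expr0 mul1r; apply: HB; rewrite mulr0 addr0.
apply: le_trans (ler_normB _ _) _; rewrite exprS -mulrA mulr_natl mulr2n.
apply: lerD; apply: IH => y Hy; apply: HB; apply: le_trans Hy _; rewrite -natr1 mulrDr mulr1.
  by have := normD_ebase x h i; lra.
by rewrite lerD2l lerDl.
Qed.

(** A difference of step [m e] telescopes into [m] differences of step [e] in each direction. *)
Lemma Dl_multiple s m (e : R) w x (B r : R) : 0 <= e ->
  (forall y, `|y| <= r -> `|Dl s e w y| <= B) ->
  `|x| + m%:R * e * (size s)%:R <= r ->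
  `|Dl s (m%:R * e) w x| <= m%:R ^+ size s * B.
Proof.
move=> e0; elim: s w x => [|i s IH] w x HB xr /=.
  by rewrite expr0 mul1r; apply: HB; move: xr; rewrite mulr0 addr0.
pose F k := Dl s (m%:R * e) w (x + (k%:R * e) *: eb i).
have -> : Dl s (m%:R * e) w (x + (m%:R * e) *: eb i) - Dl s (m%:R * e) w x =
   \sum_(0 <= k < m) (F k.+1 - F k).
  by rewrite telescope_sumr // /F mul0r scale0r addr0.
rewrite big_mkord; apply: le_trans (ler_norm_sum _ _ _) _.
have -> : m%:R ^+ (size s).+1 * B = \sum_(k < m) m%:R ^+ size s * B.
  by rewrite sumr_const card_ord exprS -mulrA mulr_natl.
apply: ler_sum => k _.
have -> : F k.+1 - F k =
    Dl s (m%:R * e) (fun y => w (y + e *: eb i) - w y) (x + (k%:R * e) *: eb i).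
  by rewrite Dl_sub Dl_shift /F -addrA -scalerDl -natr1 mulrDl mul1r.
apply: IH => [y yr|].
  by rewrite Dl_sub Dl_shift; exact: HB.
apply: le_trans xr; have := normD_ebase x (k%:R * e) i.
rewrite ger0_norm ?mulr_ge0 //= -natr1 mulrDr mulr1.
have : k%:R * e <= m%:R * e by rewrite ler_wpM2r // ler_nat ltnW.
lra.
Qed.

(* A bound by [h ^+ size s] on all mixed differences is stable under differentiation, which
   turns it into a criterion for smoothness. *)
Definition dbound r0 u := forall s r, r < r0 -> exists K, exists2 h0, 0 <= K /\ 0 < h0 &
  forall x h, `|x| <= r -> 0 < h < h0 -> `|Dl s h u x| <= K * h ^+ size s.

Lemma dbound_quadratic r0 u i r : dbound r0 u -> r < r0 ->
  exists K, exists2 dl, 0 <= K /\ 0 < dl & forall x, `|x| <= r -> exists D,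
    forall t, `|t| <= dl -> `|u (x + t *: eb i) - u x - t * D| <= K * `|t| ^+ 2.
Proof.
move=> Hu rr0; pose r' := (r + r0) / 2.
have r'r0 : r' < r0 by rewrite /r'; lra.
have [K1 [h1 [K10 h10] H1]] := Hu [:: i] r' r'r0.
have [K2 [h2 [K20 h20] H2]] := Hu [:: i; i] r' r'r0.
pose dl := Num.min (Num.min (h1 / 4) (h2 / 4)) ((r0 - r) / 2).
have dl0 : 0 < dl by rewrite !lt_min !divr_gt0 // subr_gt0.
have dl1 : dl <= h1 / 4 by rewrite !ge_min lexx.
have dl2 : dl <= h2 / 4 by rewrite !ge_min lexx orbT.
have dl3 : dl <= (r0 - r) / 2 by rewrite !ge_min lexx orbT.
exists (K1 + K2); exists dl; first by split => //; exact: addr_ge0.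
move=> x xr; pose g t := u (x + t *: eb i).
have gE a e : x + (a + e) *: eb i = (x + a *: eb i) + e *: eb i by rewrite scalerDl addrA.
have xa a : `|a| <= dl -> `|x + a *: eb i| <= r'.
  by move=> al; apply: le_trans (normD_ebase _ _ _) _; rewrite /r'; lra.
have [| |a e al e0 ae|a e al e0 ae|D HD] := @two_sided_derivative R g (K1 + K2) dl.
- exact: addr_ge0.
- exact: dl0.
- have al' : `|a| <= dl by rewrite ler_norml al /=; lra.
  have := H1 (x + a *: eb i) e (xa a al'); rewrite /= expr1 e0 /= /g gE => E.
  apply: le_trans (E _) _; first by lra.
  by apply: ler_wpM2r; [exact: ltW|rewrite lerDl].
- have al' : `|a| <= dl by rewrite ler_norml al /=; lra.
  have := H2 (x + a *: eb i) e (xa a al'); rewrite /= e0 /= /g.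
  have -> : a + 2 * e = a + e + e by ring.
  rewrite !gE => E; have {E} := E _; set p := u _; set q := u _; set q' := u _.
  have -> : p - q - (q - q') = p - 2 * q + q' by ring.
  move=> E; apply: le_trans (E _) _; first by lra.
  by apply: ler_wpM2r; [exact: sqr_ge0|rewrite lerDr].
by exists D => t tl; have := HD t tl; rewrite /g scale0r addr0.
Qed.

Lemma is_derive_quadratic u x v (D K dl : R) : 0 < dl ->
  (forall t, `|t| <= dl -> `|u (x + t *: v) - u x - t * D| <= K * `|t| ^+ 2) ->
  is_derive x v u D.
Proof.
move=> dl0 H.
have C : (fun t : R => t^-1 *: ((u \o shift x) (t *: v) - u x)) @ 0^' --> D.
  apply/cvgrPdist_le => e e0.
  pose eta := Num.min dl (e / (`|K| + 1)).
  have K1 : 0 < `|K| + 1 by rewrite ltr_wpDl.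
  have eta0 : 0 < eta by rewrite lt_min dl0 divr_gt0.
  near=> t.
  have t0 : t != 0 by near: t; exact: nbhs_dnbhs_neq.
  have te : `|t| < eta by near: t; exact: dnbhs0_lt.
  have td : `|t| <= dl by move: te; rewrite lt_min => /andP[/ltW].
  have tK : `|t| * (`|K| + 1) <= e.
    by rewrite -ler_pdivlMr //; move: te; rewrite lt_min => /andP[_ /ltW].
  have := H t td; rewrite /= [t *: v + x]addrC.
  set U := u _ - u x => E.
  rewrite distrC -(ler_pM2l (_ : 0 < `|t|)) ?normr_gt0 //.
  rewrite -normrM; have -> : t * (t^-1 *: U - D) = U - t * D.
    by rewrite mulrBr -[_ *: _]/(t^-1 * U) mulVKf.
  apply: le_trans E _; rewrite expr2 mulrCA; apply: ler_wpM2l => //.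
  apply: le_trans tK; rewrite mulrC; apply: ler_wpM2l => //.
  by have := ler_norm K; lra.
by apply: DeriveDef; [apply/cvg_ex; exists D|exact: (cvg_lim (@norm_hausdorff _ _) C)].
Unshelve. all: by end_near. Qed.

(** The derivative is replaced by a quotient of step [e = h / m]. Cutting the differences of step
    [h] into [m ^ p] ones of step [e], with [p = size s], makes the hypothesis for [i :: s]
    applicable with a single step: [m ^ p * K * e ^ (p + 1) / e = K * h ^ p]. The replacement error
    vanishes as [m] grows. *)
Lemma dbound_derive r0 u i : dbound r0 u -> dbound r0 ('D_(eb i) u).
Proof.
move=> Hu s r rr0; pose r' := (r + r0) / 2.
have r'r0 : r' < r0 by rewrite /r'; lra.
have [Kq [dl [Kq0 dl0] Hq]] := @dbound_quadratic r0 u i r' Hu r'r0.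
have [K [h1 [K0 h10] H1]] := Hu (i :: s) r' r'r0.
pose n : R := (size s)%:R.
have n0 : 0 <= n by exact: ler0n.
pose h0 := Num.min h1 ((r0 - r) / 2 / (n + 1)).
have n1 : 0 < n + 1 by lra.
have h00 : 0 < h0 by rewrite lt_min h10 !divr_gt0 // subr_gt0.
exists K; exists h0 => // x h xr /andP[hp hh0].
have hh1 : h < h1 by move: hh0; rewrite lt_min => /andP[].
have hn : h * n <= (r0 - r) / 2.
  have : h * (n + 1) < (r0 - r) / 2.
    by rewrite -ltr_pdivlMr //; move: hh0; rewrite lt_min => /andP[].
  by rewrite mulrDr mulr1; lra.
apply/ler_addgt0Pr => eps eps0.
pose E := 2 ^+ size s * Kq.
have E0 : 0 <= E by rewrite mulr_ge0 // exprn_ge0.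
(* Chosen so that both [e <= dl] and [E * e <= eps]. *)
pose m := (Num.truncn (h / dl + E * h / eps)).+1.
have mP : h / dl + E * h / eps < m%:R by rewrite truncnS_gt.
have m0 : 0 < m%:R :> R by rewrite ltr0n.
clearbody m.
have [e eE] : exists e, e = h / m%:R by exists (h / m%:R).
have e0 : 0 < e by rewrite eE divr_gt0.
have me : m%:R * e = h by rewrite eE mulrC mulfVK ?gt_eqF.
have q1 : 0 <= h / dl by rewrite divr_ge0 // ltW.
have q2 : 0 <= E * h / eps by rewrite divr_ge0 ?mulr_ge0 // ltW.
have edl : e <= dl.
  by rewrite eE ler_pdivrMr // mulrC -ler_pdivrMr //; lra.
have eeps : E * e <= eps.
  by rewrite eE mulrA ler_pdivrMr // [eps * _]mulrC -ler_pdivrMr //; lra.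
have eh : e <= h.
  rewrite eE ler_pdivrMr //; apply: ler_peMr; first exact: ltW.
  by rewrite ler1n -(ltr0n R).
pose w y := u (y + e *: eb i) - u y.
have Dw y : `|y| <= r' -> `|'D_(eb i) u y - e^-1 * w y| <= Kq * e.
  move=> yr'; have [D HD] := Hq y yr'.
  have -> : 'D_(eb i) u y = D by have := is_derive_quadratic dl0 HD; case.
  have := HD e; rewrite (gtr0_norm e0) => /(_ edl) B.
  rewrite distrC -(ler_pM2l e0) -{1}(gtr0_norm e0) -normrM.
  have -> : e * (e^-1 * w y - D) = u (y + e *: eb i) - u y - e * D.
    by rewrite mulrBr mulVKf ?gt_eqF.
  by apply: le_trans B _; apply: le_of_eq; ring.
have -> : Dl s h ('D_(eb i) u) x =
   Dl s h (fun y => 'D_(eb i) u y - e^-1 * w y) x + e^-1 * Dl s h w x.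
  by rewrite Dl_sub Dl_scale; ring.
apply: le_trans (ler_normD _ _) _; rewrite addrC; apply: lerD; last first.
  apply: le_trans (Dl_le (B := Kq * e) _) _; last by rewrite mulrA.
  move=> y yx; apply: Dw; apply: le_trans yx _; rewrite (gtr0_norm hp) -/n /r'; lra.
have B : `|Dl s h w x| <= m%:R ^+ size s * (K * e ^+ (size s).+1).
  rewrite -me; apply: (@Dl_multiple _ _ _ _ _ _ r'); first exact: ltW.
    move=> y yr'; rewrite Dl_sub Dl_shift; apply: H1 => //.
    by rewrite e0 /=; exact: le_lt_trans hh1.
  by rewrite me -/n /r'; lra.
rewrite normrM normfV (gtr0_norm e0) mulrC ler_pdivrMr //.
apply: le_trans B _; rewrite -me exprMn exprS; apply: le_of_eq; ring.
Qed.

Lemma dbound_Dseq r0 u s : dbound r0 u -> dbound r0 (Dseq s u).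
Proof. by move=> Hu; elim: s => [//|i s IH] /=; apply: dbound_derive. Qed.

Lemma dbound_lipschitz r0 u x L : dbound r0 u -> `|x| < r0 ->
  exists K, exists2 dl, 0 <= K /\ 0 < dl & forall v, `|v| < dl ->
    `|u (x + vec L (v 0)) - u x| <= K * `|v|.
Proof.
move=> Hu xr; elim: L => [|i L [K [dl [K0 dl0] IH]]].
  by exists 0; exists 1 => // v _; rewrite /vec big_nil addr0 subrr normr0 mul0r.
pose r := (`|x| + r0) / 2.
have rr0 : r < r0 by rewrite /r; lra.
have [K1 [h1 [K10 h10] H1]] := Hu [:: i] r rr0.
pose n : R := (size L)%:R.
have n0 : 0 <= n by exact: ler0n.
have n1 : 0 < n + 1 by lra.
pose dl' := Num.min (Num.min dl h1) ((r0 - `|x|) / 2 / (n + 1)).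
have dl'0 : 0 < dl' by rewrite !lt_min dl0 h10 !divr_gt0 // subr_gt0.
exists (K1 + K); exists dl'; first by split => //; exact: addr_ge0.
move=> v; rewrite !lt_min => /andP[/andP[vdl vh1]].
rewrite ltr_pdivlMr // mulrDr mulr1 => vn.
have vecn M : `|vec M (v 0)| <= `|v| * (size M)%:R.
  elim: M => [|l M IHM]; first by rewrite /vec big_nil normr0 mulr0.
  rewrite /vec big_cons /= -natr1 mulrDr mulr1 [leRHS]addrC.
  apply: le_trans (ler_normD _ _) _; apply: lerD; last exact: IHM.
  apply: le_trans (_ : `|v 0 l| <= _); last exact: norm_coord.
  by rewrite normrZ ler_piMr // norm_ebase_le1.
pose y := x + vec L (v 0).
have yx : `|y| <= `|x| + `|v| * n.
  by apply: le_trans (ler_normD _ _) _; rewrite lerD2l; exact: vecn.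
have vi : `|v 0 i| <= `|v| by exact: norm_coord.
have v00 : 0 <= `|v| by exact: normr_ge0.
have step : `|u (y + v 0 i *: eb i) - u y| <= K1 * `|v|.
  apply: (@le_trans _ _ (K1 * `|v 0 i|)); last exact: ler_wpM2l.
  have [v0|v0|->] := ltgtP (v 0 i) 0.
  - have := H1 (y + v 0 i *: eb i) (- v 0 i); rewrite /= expr1 scaleNr addrK distrC (ltr0_norm v0).
    apply; last by move: vi; rewrite (ltr0_norm v0); lra.
    by apply: le_trans (normD_ebase _ _ _) _; rewrite /r; lra.
  - have := H1 y (v 0 i); rewrite /= expr1 (gtr0_norm v0); apply; first by rewrite /r; lra.
    by move: vi; rewrite (gtr0_norm v0); lra.
  - by rewrite scale0r addr0 subrr !normr0 mulr0.
have -> : x + vec (i :: L) (v 0) = y + v 0 i *: eb i.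
  by rewrite /vec big_cons /y /vec -addrA; congr (_ + _); rewrite addrC.
have -> : u (y + v 0 i *: eb i) - u x = (u (y + v 0 i *: eb i) - u y) + (u y - u x) by ring.
by apply: le_trans (ler_normD _ _) _; rewrite mulrDl; apply: lerD => //; apply: IH.
Qed.

Lemma dbound_continuous r0 u x : dbound r0 u -> `|x| < r0 -> {for x, continuous u}.
Proof.
move=> Hu xr; have [K [dl [K0 dl0] H]] := dbound_lipschitz (enum 'I_d) Hu xr.
apply: (cvgrPdist_le (FF := nbhs_filter x) u (u x)).2 => e e0; pose eta := Num.min dl (e / (K + 1)).
have K1 : 0 < K + 1 by lra.
have eta0 : 0 < eta by rewrite lt_min dl0 divr_gt0.
have N : nbhs x [set y | `|y - x| < eta] by apply: nbhs_norm_lt; rewrite subrr normr0.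
apply: (@filterS _ _ (nbhs_filter x) _ _ _ N) => y /=.
rewrite lt_min => /andP[ydl]; rewrite ltr_pdivlMr // => yK.
have := H (y - x) ydl; rewrite vec_enum subrKC distrC => E; apply: le_trans E _.
by apply: le_trans (ltW yK); rewrite mulrC; apply: ler_wpM2l => //; lra.
Qed.

Lemma dbound_smooth r0 u : dbound r0 u -> smooth_on_R (cube r0) u.
Proof.
move=> Hu s x xr; have Hs := dbound_Dseq s Hu; split; last exact: dbound_continuous Hs xr.
move=> i; have [K [dl [_ dl0] H]] := dbound_quadratic i Hs xr.
have [D HD] := H x (lexx _).
by have := is_derive_quadratic dl0 HD; case.
Qed.

End Differences.

(** * Derivatives controlled by the coefficients of expansions *)

Section Expansions.
Variables (R : realType) (d : nat).
Local Notation pt := 'rV[R]_d.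
Local Notation eb := (@ebase R d).
Implicit Types (u w : pt -> R) (x v c : pt) (s : seq 'I_d) (h r : R) (K : nat -> R).

Lemma dbound_of_expansions r K u (G : set pt) : (forall q, 0 <= K q) -> dense_in r G ->
  (forall x, `|x| < r -> {for x, continuous u}) ->
  (forall x v, G x -> `|v| <= 1 -> exists a, expands r K u x v a) ->
  dbound r u.
Proof.
move=> K0 dG cu HG s r1 r1r; pose q := size s; pose qr : R := q%:R.
have q0 : 0 <= qr by exact: ler0n.
(* In the gauge [|y.1| + |y.2|] each increment has size at most [2 h], so [y] has size at most
   [2 h q]; the points of the pure difference move by at most [2 h q + 2 h q^2], which is below
   [h * c]. *)
pose c := 2 * (qr + 1) ^+ 2.
have cE : c = 2 * qr + 2 * qr * qr + 2 * qr + 2 by rewrite /c; ring.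
have qq0 : 0 <= qr * qr by exact: mulr_ge0.
have c0 : 0 < c by rewrite cE; lra.
pose h0 := Num.min 1 (r - r1) / c.
have m0 : 0 < Num.min 1 (r - r1) by rewrite lt_min ltr01 subr_gt0.
pose B := 2 ^+ q * (qr ^+ q * K q) * (2 * qr) ^+ q.
have B0 : 0 <= B by rewrite !mulr_ge0 ?exprn_ge0 // mulr_ge0.
exists (2 ^+ q * B); exists h0.
  by split; [rewrite mulr_ge0 ?exprn_ge0|rewrite divr_gt0].
move=> x h xr1 /andP[hp]; rewrite ltr_pdivlMr // lt_min => /andP[hc1 hcr].
rewrite Dl_altsum mixed_pure_difference size_map -/q.
set zs := djok _.
have sz : size zs = q by rewrite size_map size_iota size_map.
have -> : 2 ^+ q * B * h ^+ size s = 2 ^+ size zs * (B * h ^+ q) by rewrite sz mulrA.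
have hq : 0 <= h * qr by rewrite mulr_ge0 // ltW.
have hqq : 0 <= h * qr * qr by rewrite mulr_ge0.
have hcE : h * c = 2 * (h * qr) + 2 * (h * qr * qr) + 2 * (h * qr) + 2 * h by rewrite cE; ring.
apply: (altsum_le (N := fun y : pt * pt => `|y.1| + `|y.2|) (a := 2 * h)).
- by rewrite /= !normr0 addr0.
- move=> y z /=; apply: le_trans (lerD (ler_normD _ _) (ler_normD _ _)) _.
  by rewrite addrACA.
- by rewrite mulr_ge0 // ltW.
- move=> z /mapP[k]; rewrite mem_iota size_map add0n => /andP[_ ks] -> /=.
  have vk : `|nth 0 [seq h *: eb i | i <- s] k| <= h.
    case: s ks {q qr q0 c cE qq0 c0 h0 B B0 hc1 hcr zs sz hq hqq hcE} => // i s ks.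
    rewrite (nth_map i) // normrZ gtr0_norm //; apply: ler_piMr; first exact: ltW.
    exact: norm_ebase_le1.
  rewrite normrZ normfV normr_nat mulr_natl mulr2n; apply: lerD => //.
  apply: le_trans vk; apply: ler_piMl => //.
  by rewrite invf_le1 ?ltr0n // ler1n.
move=> y; rewrite sz -/qr => Ny.
have y1 : `|y.1| <= 2 * h * qr by apply: le_trans Ny; rewrite lerDl.
have y2 : `|y.2| <= 2 * h * qr by apply: le_trans Ny; rewrite lerDr.
have y2q : `|- y.2| * qr <= 2 * (h * qr * qr).
  have -> : 2 * (h * qr * qr) = 2 * h * qr * qr by ring.
  by rewrite normrN; apply: ler_wpM2r.
have := @pdiff_le R d r K u G q (x + y.1) (- y.2) K0 dG cu HG.
have wq : `|- y.2| * q%:R <= 1 by apply: le_trans y2q _; lra.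
move=> /(_ wq) P; apply: le_trans (P _) _.
  move=> k kq; apply: le_lt_trans (ler_normD _ _) _.
  apply: le_lt_trans (lerD (ler_normD _ _) (lexx _)) _.
  have : `|k%:R *: - y.2| <= `|- y.2| * qr.
    by rewrite normrZ normr_nat mulrC; apply: ler_wpM2l => //; rewrite ler_nat.
  lra.
have -> : B * h ^+ q = 2 ^+ q * (qr ^+ q * K q) * (2 * h * qr) ^+ q.
  have -> : 2 * h * qr = (2 * qr) * h by ring.
  by rewrite [X in _ = _ * X]exprMn [RHS]mulrA.
apply: ler_wpM2l; first by rewrite !mulr_ge0 ?exprn_ge0.
by rewrite normrN; apply: lerXn2r; rewrite // nnegrE ?(le_trans _ y2).
Qed.

Lemma is_derive_Dl r u i s h x (t : R) : 0 < h -> smooth_on_R (cube r) u ->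
  `|x + t *: eb i| + h * (size s)%:R < r ->
  is_derive t 1 (fun t => Dl s h u (x + t *: eb i)) (Dl s h ('D_(eb i) u) (x + t *: eb i)).
Proof.
move=> h0 su; elim: s x => [|l s IH] x /=.
  rewrite mulr0 addr0 => xr.
  have := @is_derive_line R d u x (eb i) 1 t; rewrite mulr1 mul1r.
  have -> : (fun z : R => u (x + (z * 1) *: eb i)) = (fun z => u (x + z *: eb i)).
    by apply/funext => z; rewrite mulr1.
  by apply; have [] := su [::] _ xr.
rewrite -natr1 mulrDr mulr1 => xr.
have E (t' : R) : x + t' *: eb i + h *: eb l = x + h *: eb l + t' *: eb i by rewrite addrAC.
apply: is_derive_sub; last by apply: IH; lra.
under eq_fun do rewrite E.
rewrite E; apply: IH; rewrite -E.
have := normD_ebase (x + t *: eb i) h l; rewrite (gtr0_norm h0); lra.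
Qed.

(** One mean value step per direction. The first direction of [s] is differentiated first, hence
    innermost in [Dseq]; this explains [rev]. *)
Lemma Dl_mean_value r u s h x : 0 < h -> smooth_on_R (cube r) u ->
  `|x| + h * (size s)%:R < r ->
  exists2 y, `|y - x| <= h * (size s)%:R & Dl s h u x = h ^+ size s * Dseq (rev s) u y.
Proof.
move=> h0; elim: s u x => [|i s IH] u x su.
  by move=> _; exists x; rewrite ?subrr ?normr0 ?mulr0 //= expr0 mul1r.
rewrite [size (i :: s)]/= -natr1 mulrDr mulr1 => xr.
have [|c /andP[c0 ch]] := @mean_value_01 R (fun t => Dl s h u (x + t *: eb i))
  (fun t => Dl s h ('D_(eb i) u) (x + t *: eb i)) h (ltW h0).
  move=> t /andP[t0 th]; apply: (is_derive_Dl (r := r)) => //.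
  by have := normD_ebase x t i; rewrite (ger0_norm t0); lra.
rewrite scale0r addr0 => E.
have xc := normD_ebase x c i; rewrite (ger0_norm c0) in xc.
have [||y yx Ey] := IH ('D_(eb i) u) (x + c *: eb i).
- exact: (@smooth_Dseq R d _ [:: i]).
- by lra.
exists y.
  have -> : y - x = (y - (x + c *: eb i)) + c *: eb i by rewrite opprD addrA subrK.
  by apply: le_trans (normD_ebase _ _ _) _; rewrite (ger0_norm c0); apply: lerD.
rewrite /= E Ey rev_cons -cats1 Dseq_cat exprS; rewrite mulrC mulrA; congr (_ * _).
Qed.

Lemma real_poly_small_vanish (p : {poly R}) n (t0 k : R) : 0 < t0 ->
  (forall t, 0 < t < t0 -> `|p.[t]| <= k * t ^+ n) -> forall l, (l < n)%N -> p`_l = 0.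
Proof.
move=> t00 H l ln; pose pc := map_poly (real_complex R) p.
have V : vanish n pc.
  apply: (poly_small_vanish (t0 := t0) (K := k)) => // t tt.
  have -> : pc.[t%:C%C] = (p.[t])%:C%C by exact: horner_map.
  by rewrite nc_real; apply: H.
have := V l ln; rewrite coef_map /= => E.
by have := congr1 (@complex.Re R) E.
Qed.

(** The mixed difference of step [h] is [h ^ p] times the derivative near [x]. Inserting the
    expansions in the directions of all partial sums of basis vectors, it is also a polynomial [P]
    in [h * n], up to [O(h ^ p.+1)]. Letting [h] tend to 0 kills the coefficients of [P] below [p]
    and identifies the derivative with [n ^ p * c p]. *)
Lemma Dseq_le_expands r K u x s (b : R) : (forall q, 0 <= K q) -> 0 <= b -> `|x| < r ->
  smooth_on_R (cube r) u ->
  (forall v, `|v| <= 1 -> exists2 a, `|a (size s)| <= b & expands r K u x v a) ->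
  `|Dseq (rev s) u x| <= (size s).+1%:R ^+ size s * (2 ^+ size s * b).
Proof.
(* A sum of at most [p] basis vectors has norm at most [p], so division by [n] brings it into the
   unit ball; [p + 1] keeps [n] positive when [p = 0]. *)
move=> K0 b0 xr su Hx; set p := size s; pose n : R := p.+1%:R.
have n0 : 0 < n by rewrite ltr0n.
pose D := Dseq (rev s) u.
have [a Ha] : exists a : pt -> nat -> R, forall v, `|v| <= 1 ->
    `|a v p| <= b /\ expands r K u x v (a v).
  have : forall v, exists a : nat -> R, `|v| <= 1 -> `|a p| <= b /\ expands r K u x v a.
    move=> v; have [v1|v1] := leP `|v| 1; last by exists (fun=> 0).
    by have [a ab ae] := Hx v v1; exists a.
  by move=> /choice[a Ha]; exists a.
pose es := [seq eb i | i <- s].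
have ses : size es = p by rewrite size_map.
pose c k := altsum es (fun y => a (n^-1 *: y) k).
have altle (Phi : pt -> R) (B : R) : (forall y, `|n^-1 *: y| <= 1 -> `|Phi y| <= B) ->
    `|altsum es Phi| <= 2 ^+ p * B.
  move=> HB; rewrite -ses; apply: (altsum_le (N := fun y : pt => `|y|) (a := 1)) => //.
  - by rewrite normr0.
  - exact: ler_normD.
  - by move=> z /mapP[i _ ->]; exact: norm_ebase_le1.
  move=> y; rewrite ses mul1r => yp; apply: HB.
  rewrite normrZ normfV gtr0_norm // mulrC ler_pdivrMr // mul1r (le_trans yp) //.
  by rewrite ler_nat.
pose P : {poly R} := \poly_(k < p.+1) c k.
have cD : {for x, continuous D} by have [_] := su (rev s) x xr.
pose h1 := Num.min 1 (r - `|x|) / n.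
have h10 : 0 < h1 by rewrite divr_gt0 // lt_min ltr01 subr_gt0.
have step h : 0 < h < h1 -> exists2 y, `|y - x| <= h * n &
    `|h ^+ p * D y - P.[h * n]| <= 2 ^+ p * K p.+1 * (h * n) ^+ p.+1.
  move=> /andP[h0]; rewrite ltr_pdivlMr // lt_min => /andP[hn1 hnr].
  have hp : h * p%:R <= h * n by rewrite ler_pM2l // ler_nat.
  have [|y yx E] := @Dl_mean_value r u s h x h0 su; first by rewrite -/p; lra.
  exists y; first exact: le_trans hp.
  rewrite -E Dl_altsum.
  have -> : [seq h *: eb i | i <- s] = [seq h *: z | z <- es] by rewrite -map_comp.
  rewrite altsum_map ?scaler0 //; last by move=> ? ?; rewrite scalerDr.
  have hn0 : 0 < h * n by rewrite mulr_gt0.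
  have -> : P.[h * n] = altsum es (fun y => \sum_(k < p.+1) (h * n) ^+ k * a (n^-1 *: y) k).
    rewrite (altsum_sum _ _ _ (fun k y => a (n^-1 *: y) k)) horner_poly.
    by apply: eq_bigr => k _; rewrite mulrC.
  set Phi := (fun y => u _); set Psi := (fun y => \sum_(k < _) _).
  have -> : altsum es Phi - altsum es Psi = altsum es (fun y => Phi y - Psi y).
    by rewrite -[LHS]addr0 -(eq_altsum es (Phi := fun y => (Phi y - Psi y) + Psi y) (Psi := Phi));
      [rewrite altsumD; ring|move=> z; rewrite subrK].
  rewrite -mulrA; apply: altle => z z1; have [_ ex] := Ha _ z1.
  have := ex p.+1 (h * n); rewrite gtr0_norm // => /(_ (ltW hn1)).
  have -> : (h * n) *: (n^-1 *: z) = h *: z by rewrite scalerA mulfK ?gt_eqF.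
  move=> F; rewrite /Phi /Psi; under eq_bigr do rewrite mulrC.
  apply: F; apply: le_lt_trans (ler_normD _ _) _.
  have -> : h *: z = (h * n) *: (n^-1 *: z) by rewrite scalerA mulfK ?gt_eqF.
  rewrite normrZ gtr0_norm //.
  have : h * n * `|n^-1 *: z| <= h * n by rewrite ler_piMr // ltW.
  lra.
clearbody h1.
pose C := 2 ^+ p * K p.+1.
have C0 : 0 <= C by rewrite mulr_ge0 ?exprn_ge0.
have near eps : 0 < eps -> exists2 h2, 0 < h2 & forall y, `|y - x| <= h2 -> `|D y - D x| <= eps.
  move=> e0; have := (cvgrPdist_le (FF := nbhs_filter x) D (D x)).1 cD eps e0.
  move=> /nbhs_ballP[e /= e1 He]; exists (e / 2); first by rewrite divr_gt0.
  move=> y yx; rewrite distrC; apply: He; rewrite -ball_normE /= distrC.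
  by apply: le_lt_trans yx _; lra.
have Pn t : 0 < t -> t = t / n * n by move=> _; rewrite mulfVK ?gt_eqF.
have Pv k : (k < p)%N -> P`_k = 0.
  have [h2 h20 Hh2] := near 1 ltr01.
  pose t0 := Num.min (Num.min (h1 * n) h2) 1.
  apply: (@real_poly_small_vanish P p t0 (C + (`|D x| + 1) / n ^+ p)).
    by rewrite !lt_min ltr01 h20 mulr_gt0.
  move=> t /andP[tp]; rewrite !lt_min => /andP[/andP[th1 th2] t1].
  have [|y] := step (t / n); first by rewrite divr_gt0 //= ltr_pdivrMr.
  rewrite -Pn // => yt Hy.
  have Dy : `|D y| <= `|D x| + 1.
    have := Hh2 y (le_trans yt (ltW th2)) => Hd.
    have -> : D y = D x + (D y - D x) by ring.
    by apply: le_trans (ler_normD _ _) _; rewrite lerD2l.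
  have -> : P.[t] = (t / n) ^+ p * D y - ((t / n) ^+ p * D y - P.[t]) by ring.
  apply: le_trans (ler_normB _ _) _; rewrite addrC mulrDl; apply: lerD.
    apply: le_trans Hy _; rewrite -/C; apply: ler_wpM2l => //.
    by rewrite exprS ler_piMl ?exprn_ge0 ?ltW //.
  rewrite normrM normrX gtr0_norm ?divr_gt0 // expr_div_n.
  have -> : (`|D x| + 1) / n ^+ p * t ^+ p = t ^+ p / n ^+ p * (`|D x| + 1) by ring.
  by apply: ler_wpM2l => //; rewrite divr_ge0 ?exprn_ge0 ?ltW //.
have PE t : P.[t] = c p * t ^+ p.
  rewrite horner_poly big_ord_recr /= big1 ?add0r // => k _.
  by have := Pv k (ltn_ord k); rewrite coef_poly ltnS ltnW // => ->; rewrite mul0r.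
have cp : `|c p| <= 2 ^+ p * b by apply: altle => y /Ha[].
apply: (@le_trans _ _ (n ^+ p * `|c p|)); last by apply: ler_wpM2l => //; apply: exprn_ge0; exact: ltW.
apply/ler_addgt0Pr => eps eps0.
have [h2 h20 Hh2] := near (eps / 2) (divr_gt0 eps0 (ltr0Sn _ 1)).
pose E := C * n ^+ p.+1.
have E0 : 0 <= E by apply: mulr_ge0 => //; apply: exprn_ge0; exact: ltW.
have E1 : 0 < E + 1 by lra.
pose h := Num.min (h1 / 2) (Num.min (h2 / n) (eps / 2 / (E + 1))).
have hp : 0 < h by rewrite !lt_min !divr_gt0.
have hh1 : h < h1.
  apply: (@le_lt_trans _ _ (h1 / 2)); first by rewrite ge_min lexx.
  by lra.
have hh2 : h * n <= h2 by rewrite -ler_pdivlMr // !ge_min lexx orbT.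
have hE : h * (E + 1) <= eps / 2 by rewrite -ler_pdivlMr // !ge_min lexx !orbT.
have [|y yx Hy] := step h; first by rewrite hp.
have Dy := Hh2 y (le_trans yx hh2).
have B : `|D y| <= n ^+ p * `|c p| + eps / 2.
  have hpp : 0 < h ^+ p by rewrite exprn_gt0.
  rewrite -(ler_pM2l hpp) -{1}(gtr0_norm hpp) -normrM.
  have -> : h ^+ p * D y = (h ^+ p * D y - P.[h * n]) + c p * (h * n) ^+ p by rewrite PE subrK.
  apply: le_trans (ler_normD _ _) _; rewrite addrC mulrDr; apply: lerD.
    rewrite normrM normrX (gtr0_norm (mulr_gt0 hp n0)) exprMn.
    by apply: le_of_eq; ring.
  apply: le_trans Hy _.
  have -> : 2 ^+ p * K p.+1 * (h * n) ^+ p.+1 = h ^+ p * (h * E).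
    by rewrite exprMn /E /C !exprS; ring.
  by apply: ler_wpM2l; [exact: ltW|lra].
rewrite -/D; have -> : D x = D y - (D y - D x) by ring.
by apply: le_trans (ler_normB _ _) _; lra.
Qed.

(** The loss [(p + 1) ^ p] from polarization is compensated by the [1 / p!] in the coefficient
    bound, up to [4 ^ (p + 1)]; with the factor [2 ^ p] this makes the 8 and the 4. Density carries
    the bound from [G] to all points. *)
Lemma Dseq_le r K u (G : set pt) (N : nat -> R) (A sg : R) x s :
  (forall q, 0 <= K q) -> 0 <= A -> 0 <= sg -> (forall k, 0 <= N k) ->
  dense_in r G -> smooth_on_R (cube r) u -> `|x| < r ->
  (forall y v, G y -> `|v| <= 1 -> exists2 a,
     forall k, `|a k| <= A * sg ^+ k * (N k / k`!%:R) & expands r K u y v a) ->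
  `|Dseq s u x| <= 4 * A * ((8 * sg) ^+ size s * N (size s)).
Proof.
move=> K0 A0 sg0 N0 dG su xr HG; set p := size s.
apply: (@continuous_le_dense R d r G (Dseq s u) _ [set y | `|y| < r]) => //.
- by have [_] := su s x xr.
- have := @nbhs_norm_lt R d r 0 x; rewrite addr0 => /(_ xr).
  by congr (nbhs _ _); apply/seteqP; split => y /=; rewrite addr0.
move=> y Gy /= yr.
pose b := A * sg ^+ p * (N p / p`!%:R).
have b0 : 0 <= b by rewrite !mulr_ge0 ?exprn_ge0 ?invr_ge0.
have sr : size (rev s) = p by rewrite size_rev.
have := @Dseq_le_expands r K u y (rev s) b K0 b0 yr su; rewrite revK sr => T.
apply: le_trans (T _) _.
  by move=> v v1; have [a Ha ea] := HG y v Gy v1; exists a => //; exact: Ha.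
have f0 : 0 < p`!%:R :> R by rewrite ltr0n fact_gt0.
have F : p.+1%:R ^+ p <= p`!%:R * 4 ^+ p.+1 :> R.
  by rewrite -!natrX -natrM ler_nat; exact: expn_le_fact.
have -> : 4 * A * ((8 * sg) ^+ p * N p) = (p`!%:R * 4 ^+ p.+1) * (2 ^+ p * b).
  have -> : 8 * sg = 4 * 2 * sg :> R by congr (_ * _); rewrite -natrM.
  by rewrite /b !exprMn exprS; field; rewrite gt_eqF.
by apply: ler_wpM2r => //; rewrite mulr_ge0 ?exprn_ge0.
Qed.

End Expansions.

(** * Germs *)

Section Germs.
Local Open Scope complex_scope.
Variables (R : realType) (d : nat).
Local Notation pt := 'rV[R]_d.
Implicit Types (f g : pt -> R[i]) (M N : nat -> R) (x v : pt).

Lemma size_mindex (alpha : 'I_d -> nat) : size (mindex_seq alpha) = mabs alpha.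
Proof.
rewrite /mindex_seq size_flatten /shape -map_comp /mabs sumnE big_map big_enum.
by apply: eq_bigr => i _; rewrite /= size_nseq.
Qed.

Lemma smooth_on_sub (V U : set pt) f : V `<=` U -> smooth_on U f -> smooth_on V f.
Proof. by move=> VU [sR sI]; split=> s x /VU Ux; [exact: sR|exact: sI]. Qed.

Lemma B_M_sigma_sub M s (V U : set pt) f : V `<=` U -> B_M_sigma M s U f -> B_M_sigma M s V f.
Proof.
move=> VU [sf [C HC]]; split; first exact: smooth_on_sub sf.
by exists C => x alpha /VU; exact: HC.
Qed.

Lemma B_M_sigma_le M N s t (V : set pt) f : (forall k, 0 < M k) -> (forall k, M k <= N k) ->
  0 < s -> s <= t -> B_M_sigma M s V f -> B_M_sigma N t V f.
Proof.
move=> M0 MN s0 st [sf [C HC]]; split => //; exists `|C| => x alpha Vx.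
apply: le_trans (HC x alpha Vx) _; rewrite lecR.
apply: (@le_trans _ _ (`|C| * (s ^+ mabs alpha * M (mabs alpha)))).
  by apply: ler_wpM2r; rewrite ?ler_norm // mulr_ge0 ?exprn_ge0 ?ltW.
have s0' := ltW s0; have t0 := le_trans s0' st.
apply: ler_wpM2l => //; apply: ler_pM => //; first exact: exprn_ge0.
  exact: ltW.
by apply: lerXn2r.
Qed.

Lemma open_cube r : open (cube r : set pt).
Proof.
rewrite openE => x /= xr; rewrite /interior.
have := @nbhs_norm_lt R d r 0 x; rewrite addr0 => /(_ xr).
by congr (nbhs _ _); apply/seteqP; split => y /=; rewrite addr0.
Qed.

Lemma closure_cube r : closure (cube r : set pt) `<=` [set x | `|x| <= r].
Proof.
move=> x cx; rewrite /= leNgt; apply/negP => rx.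
have N : nbhs x [set y | `|y - x| < `|x| - r].
  by apply: nbhs_norm_lt; rewrite subrr normr0 subr_gt0.
have [y [yr yx]] := cx _ N.
have : `|x| <= `|y| + `|y - x| by have := ler_normB y (y - x); rewrite subKr.
by move: yr yx; rewrite /cube /=; lra.
Qed.

Lemma rel_compact_cube r (U : set pt) : [set x | `|x| <= r] `<=` U ->
  rel_compact_in (cube r) U.
Proof.
move=> rU; split; last exact: subset_trans (@closure_cube r) rU.
apply: bounded_closed_compact; last exact: closed_closure.
exists r; split; first exact: num_real.
by move=> r' rr' x /closure_cube /= xr; apply: le_trans xr _; exact: ltW.
Qed.

(** The matrix is totally ordered, so the larger of the two sequences serves both germs. *)
Lemma germ_pair (WM : set (nat -> R)) f g : weight_matrix WM ->
  germ_E WM f -> germ_E WM g -> exists2 rho : R, 0 < rho &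
  exists2 M, WM M & exists2 s, 0 < s & B_M_sigma M s (cube rho) f /\ B_M_sigma M s (cube rho) g.
Proof.
move=> HW [U [oU [U0 HU]]] [V [oV [V0 HV]]].
have N : nbhs (0 : pt) (U `&` V) by apply: filterI; exact: open_nbhs_nbhs.
have [e /= e0 He] := (nbhs_ballP _ _).1 N.
pose rho := e / 2; have rho0 : 0 < rho by rewrite divr_gt0.
have sub : [set x : pt | `|x| <= rho] `<=` U `&` V.
  move=> x /= xr; apply: He; rewrite -ball_normE /= sub0r normrN.
  by apply: le_lt_trans xr _; rewrite /rho; lra.
have cs : (cube rho : set pt) `<=` U `&` V by move=> x /ltW; exact: sub.
have [subU subV] : [set x : pt | `|x| <= rho] `<=` U /\ [set x : pt | `|x| <= rho] `<=` V.
  by split=> x /sub [].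
have [csU csV] : (cube rho : set pt) `<=` U /\ (cube rho : set pt) `<=` V.
  by split=> x /cs [].
have [M1 [W1 [s1 [s10 B1]]]] := HU _ (@open_cube rho) csU (rel_compact_cube subU).
have [M2 [W2 [s2 [s20 B2]]]] := HV _ (@open_cube rho) csV (rel_compact_cube subV).
exists rho => //.
have p1 k : 0 < M1 k by apply: weight_gt0; exact: HW.1.
have p2 k : 0 < M2 k by apply: weight_gt0; exact: HW.1.
have m1 : s1 <= Num.max s1 s2 by rewrite le_max lexx.
have m2 : s2 <= Num.max s1 s2 by rewrite le_max lexx orbT.
have [le12|le21] := HW.2 _ _ W1 W2.
  exists M2 => //; exists (Num.max s1 s2); first by rewrite lt_max s10.
  by split; [exact: B_M_sigma_le B1|exact: B_M_sigma_le B2].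
exists M1 => //; exists (Num.max s1 s2); first by rewrite lt_max s10.
by split; [exact: B_M_sigma_le B1|exact: B_M_sigma_le B2].
Qed.

Lemma germ_of_cube (WM : set (nat -> R)) M (r s : R) f : WM M -> 0 < r -> 0 < s ->
  B_M_sigma M s (cube r) f -> germ_E WM f.
Proof.
move=> WMM r0 s0 Bf; exists (cube r); split; first exact: open_cube.
split; first by rewrite /cube /= normr0.
move=> V oV VU _; exists M; split => //; exists s; split => //.
exact: B_M_sigma_sub Bf.
Qed.

Lemma jet_le M (A A' s : R) phi (I : R -> Prop) G : 0 <= s -> (forall k, 0 < M k) -> A <= A' ->
  jet M A s phi I G -> jet M A' s phi I G.
Proof.
move=> s0 M0 AA' [H1 H2].
have p k : 0 <= s ^+ k * (M k / k`!%:R) by rewrite mulr_ge0 ?exprn_ge0 // divr_ge0 // ltW.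
split=> [k|n t It].
  by apply: le_trans (H1 k) _; rewrite -!mulrA; apply: ler_wpM2r.
apply: le_trans (H2 n t It) _; rewrite -!mulrA; apply: ler_wpM2r => //.
by rewrite !mulrA -(mulrA (s ^+ n)); apply: mulr_ge0; [exact: p|exact: exprn_ge0].
Qed.

Lemma jet0 M (A s : R) phi (I : R -> Prop) G : jet M A s phi I G -> I 0 -> phi 0 = G 0%N.
Proof.
move=> [_ H] I0; have := H 1%N 0 I0; rewrite normr0 expr0n mulr0 => H0.
have : nc (phi 0 - (trunc G 1).[0%:C]) = 0 by apply/eqP; rewrite -[_ == _]andbT eq_le H0 nc_ge0.
move/eqP; rewrite nc_eq0 subr_eq0 => /eqP ->.
by rewrite horner_coef0 coef_trunc.
Qed.

Lemma jet_vanish M (A s t0 : R) phi (I : R -> Prop) G : jet M A s phi I G -> 0 < t0 ->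
  (forall t, 0 < t < t0 -> I t /\ phi t = 0) -> forall k, G k = 0.
Proof.
move=> [_ H] t00 Hz k.
have V : vanish k.+1 (trunc G k.+1).
  apply: (@poly_small_vanish _ _ _ (A * s ^+ k.+1 * (M k.+1 / k.+1`!%:R)) t0) => // t tt.
  have [It pt0] := Hz t tt; have := H k.+1 t It.
  by rewrite pt0 sub0r ncN gtr0_norm //; case/andP: tt.
by have := V k (ltnSn k); rewrite coef_trunc ltnSn.
Qed.

End Germs.

(** * Regularity of a function two consecutive powers of which are regular *)

Section Roots.
Local Open Scope complex_scope.
Local Notation Re := complex.Re.
Local Notation Im := complex.Im.
Variables (R : realType) (d : nat).
Local Notation pt := 'rV[R]_d.
Implicit Types (f g : pt -> R[i]) (M N : nat -> R) (x v : pt) (r rho : R).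

Lemma near_nc_sub f x (e : R) : {for x, continuous (ReF f)} -> {for x, continuous (ImF f)} ->
  0 < e -> nbhs x [set y | nc (f y - f x) <= e].
Proof.
move=> cR cI e0; have e20 : 0 < e / 2 by rewrite divr_gt0.
have N1 := (cvgrPdist_le (FF := nbhs_filter x) (ReF f) (ReF f x)).1 cR _ e20.
have N2 := (cvgrPdist_le (FF := nbhs_filter x) (ImF f) (ImF f x)).1 cI _ e20.
apply: (@filterS _ _ (nbhs_filter x) _ _ _ (filterI N1 N2)) => y /= [].
rewrite /ReF /ImF => h1 h2; rewrite nc_dist; apply: le_trans (nc_le_ReIm _) _.
by move: h1 h2; case: (f x) => a b; case: (f y) => a' b' /=; lra.
Qed.

Lemma continuous_of_nc f x : (forall e, 0 < e -> nbhs x [set y | nc (f y - f x) <= e]) ->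
  {for x, continuous (ReF f)} /\ {for x, continuous (ImF f)}.
Proof.
move=> H; split.
  apply: (cvgrPdist_le (FF := nbhs_filter x) (ReF f) (ReF f x)).2 => e e0.
  apply: (@filterS _ _ (nbhs_filter x) _ _ _ (H e e0)) => y /=; apply: le_trans.
  by rewrite nc_dist /ReF -cReB; exact: normRe_le.
apply: (cvgrPdist_le (FF := nbhs_filter x) (ImF f) (ImF f x)).2 => e e0.
apply: (@filterS _ _ (nbhs_filter x) _ _ _ (H e e0)) => y /=; apply: le_trans.
rewrite nc_dist /ImF; have := normIm_le (f x - f y).
by case: (f x) => a b; case: (f y).
Qed.

Lemma continuous_of_powers f j W x (V : set pt) : (0 < j)%N -> 0 <= W -> nbhs x V -> V x ->
  (forall y, V y -> nc (f y) <= W) ->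
  (forall e, 0 < e -> nbhs x [set y | nc (f y ^+ j - f x ^+ j) <= e]) ->
  (forall e, 0 < e -> nbhs x [set y | nc (f y ^+ j.+1 - f x ^+ j.+1) <= e]) ->
  forall e, 0 < e -> nbhs x [set y | nc (f y - f x) <= e].
Proof.
move=> j0 W0 NV Vx HW H1 H2 e e0.
pose c : R := 2 ^+ j * (1 + W).
have c0 : 0 < c by rewrite mulr_gt0 ?exprn_gt0 //; lra.
have e'0 : 0 < e ^+ j.+1 / c by rewrite divr_gt0 ?exprn_gt0.
apply: (@filterS _ _ (nbhs_filter x) _ _ _ (filterI NV (filterI (H1 _ e'0) (H2 _ e'0)))).
move=> y /= [Vy [h1 h2]].
have := power_pair_holder j0 W0 (HW y Vy) (HW x Vx) h1 h2.
rewrite -/c mulrC divfK ?gt_eqF // => E.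
by rewrite -(@ler_pXn2r _ j.+1) // nnegrE ?nc_ge0 // ltW.
Qed.

(* At these points, which are dense, the Taylor series of the powers of [f] are divisible:
   either [f x ^+ j] is invertible or both series vanish. *)
Definition regular_pt rho f : set pt :=
  [set x | `|x| < rho /\ (f x != 0 \/ nbhs x [set y | f y = 0])].

Lemma dense_regular_pt rho f : dense_in rho (regular_pt rho f).
Proof.
move=> x B xr NB.
have NC : nbhs x (cube rho : set pt).
  exact: (open_nbhs_nbhs (conj (@open_cube R d rho) xr)).
have [[y [By yr] fy]|H] := pselect (exists2 y, (B `&` cube rho) y & f y != 0).
  by exists y => //; split => //; left.
exists x; first exact: nbhs_singleton.
split => //; right; apply: (@filterS _ _ (nbhs_filter x) _ _ _ (filterI NB NC)) => y BCy /=.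
by apply/eqP/negP => /negP fy; apply: H; exists y.
Qed.

Lemma line_near x v (V : set pt) : nbhs x V ->
  exists2 t0 : R, 0 < t0 & forall t, 0 < t < t0 -> V (x + t *: v).
Proof.
move=> /nbhs_ballP[e /= e0 He]; have v0 : 0 < `|v| + 1 by rewrite ltr_wpDl.
exists (e / (`|v| + 1)) => [|t /andP[t0]]; first by rewrite divr_gt0.
rewrite ltr_pdivlMr // => tv; apply: He; rewrite -ball_normE /= opprD addrA subrr sub0r normrN.
rewrite normrZ gtr0_norm //; apply: le_lt_trans tv; rewrite ler_pM2l //; lra.
Qed.

Lemma horner_trunc_Re (F : nat -> R[i]) q (t : R) :
  Re (trunc F q).[t%:C] = \sum_(k < q) Re (F k) * t ^+ k.
Proof. by rewrite horner_poly Re_sum; apply: eq_bigr => k _; rewrite -RealCX cReM. Qed.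

Lemma horner_trunc_Im (F : nat -> R[i]) q (t : R) :
  Im (trunc F q).[t%:C] = \sum_(k < q) Im (F k) * t ^+ k.
Proof.
rewrite horner_poly; elim: q => [|q IH]; first by rewrite !big_ord0.
rewrite !big_ord_recr /= cImD IH -RealCX; congr (_ + _).
by case: (F q) => a b /=; rewrite mulr0 add0r.
Qed.

(** Nothing is assumed of [f] itself: it is bounded because [f ^ j] is, and continuous by the
    Hoelder estimate. This continuity extends the estimates from the dense set [regular_pt] to the
    whole cube. *)
Lemma root_class (WM : set (nat -> R)) M (rho s : R) f j : weight_matrix WM ->
  R_moderate_growth WM -> WM M -> (0 < d)%N -> (0 < j)%N -> 0 < rho -> 0 < s ->
  B_M_sigma M s (cube rho) (fun x => f x ^+ j) ->
  B_M_sigma M s (cube rho) (fun x => f x ^+ j.+1) ->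
  exists2 N, WM N & exists2 t, 0 < t & B_M_sigma N t (cube rho) f.
Proof.
move=> HW HG WMM d0 j0 r0 s0 Bg Bh.
have M0 k : 0 < M k by apply: weight_gt0; exact: HW.1.
have [A1 A11 J1] := smooth_jet r0 s0 M0 Bg.
have [A2 A21 J2] := smooth_jet r0 s0 M0 Bh.
pose A := Num.max A1 A2; pose sd := d%:R * s.
have A1A : A1 <= A by rewrite le_max lexx.
have A2A : A2 <= A by rewrite le_max lexx orbT.
have A_1 : 1 <= A by exact: le_trans A1A.
have sd0 : 0 < sd by rewrite mulr_gt0 // ltr0n.
pose W := 1 + A1 * M 0%N.
have W1 : 1 <= W by rewrite /W lerDl mulr_ge0 ?(ltW (M0 _)) //; lra.
have fW x : `|x| < rho -> nc (f x) <= W.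
  move=> xr; have [|G [HG1 _]] := J1 x 0 xr; first by rewrite normr0.
  have := J1 x 0 xr; rewrite normr0 => /(_ ler01)[G' JG].
  have E := jet0 JG; rewrite normr0 scaler0 addr0 in E.
  have {}E := E (conj ler01 xr); have := JG.1 0%N.
  rewrite -E expr0 mulr1 fact0 divr1 ncX => Ej.
  have [f1|f1] := leP (nc (f x)) 1; first exact: le_trans W1.
  apply: (@le_trans _ _ (nc (f x) ^+ j)); first by rewrite ler_eXnr // ltW.
  by apply: le_trans Ej _; rewrite /W; lra.
have W0 : 0 <= W by exact: le_trans W1.
have cf x : `|x| < rho -> {for x, continuous (ReF f)} /\ {for x, continuous (ImF f)}.
  move=> xr; apply: continuous_of_nc.
  apply: (@continuous_of_powers f j W x (cube rho) j0 W0 _ xr fW).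
  - exact: (open_nbhs_nbhs (conj (@open_cube R d rho) xr)).
  - move=> e; apply: (@near_nc_sub (fun x => f x ^+ j)).
      by have [_] := Bg.1.1 [::] x xr.
    by have [_] := Bg.1.2 [::] x xr.
  - move=> e; apply: (@near_nc_sub (fun x => f x ^+ j.+1)).
      by have [_] := Bh.1.1 [::] x xr.
    by have [_] := Bh.1.2 [::] x xr.
have [N WN [T T1 HT]] := line_expansion HW HG WMM j0.
have [Kq HK] := HT A sd W A_1 sd0.
have N0 k : 0 < N k by apply: weight_gt0; exact: HW.1.
pose K q := `|Kq q|.
have K0 q : 0 <= K q by exact: normr_ge0.
pose A' := A * T; pose s' := T * sd.
have A'0 : 0 <= A' by rewrite mulr_ge0 //; lra.
have s'0 : 0 < s' by rewrite mulr_gt0 //; lra.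
have expansion x v : regular_pt rho f x -> `|v| <= 1 -> exists2 F : nat -> R[i],
    forall k, nc (F k) <= A' * s' ^+ k * (N k / k`!%:R) &
    forall q t, `|t| <= 1 -> `|x + t *: v| < rho ->
      nc (f (x + t *: v) - (trunc F q).[t%:C]) <= K q * `|t| ^+ q.
  move=> [xr Hx] v1.
  have [G /(jet_le (ltW sd0) M0 A1A) JG] := J1 x v xr v1.
  have [H /(jet_le (ltW sd0) M0 A2A) JH] := J2 x v xr v1.
  have NC : nbhs x (cube rho : set pt).
    exact: (open_nbhs_nbhs (conj (@open_cube R d rho) xr)).
  pose I (t : R) := `|t| <= 1 /\ `|x + t *: v| < rho.
  have [t1 t10 Ht1] := line_near v NC.
  have near0 : exists2 t0, 0 < t0 & forall t, 0 < t < t0 -> I t.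
    exists (Num.min t1 1); first by rewrite lt_min t10 ltr01.
    move=> t /andP[t0]; rewrite lt_min => /andP[tt1 tt].
    by split; [rewrite (gtr0_norm t0); exact: ltW|apply: Ht1; rewrite t0].
  have [||F [F1 F2]] := HK (fun t => f (x + t *: v)) I G H near0 _ JG JH.
  - by move=> t [t1' tr]; split => //; exact: fW.
  (* If [f x] is nonzero, the series of [f ^ j] starts with [f x ^ j]; otherwise both powers vanish
     along the line near [x], and both series are 0. *)
  - case: Hx => [fx|Nx]; [left|right].
      rewrite -(jet0 JG) ?scale0r ?addr0; last by rewrite normr0.
      by rewrite expf_neq0.
    have [t2 t20 Ht2] := line_near v Nx.
    have [t3 t30 Ht3] := near0.
    have t0 : 0 < Num.min t2 t3 by rewrite lt_min t20.
    have Hz t : 0 < t < Num.min t2 t3 -> I t /\ f (x + t *: v) = 0.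
      move=> /andP[tp]; rewrite lt_min => /andP[tt2 tt3].
      by split; [apply: Ht3; rewrite tp|apply: Ht2; rewrite tp].
    have VG := jet_vanish JG t0; have VH := jet_vanish JH t0.
    move=> k; split; [apply: VG|apply: VH] => t /Hz[It ->]; split => //.
      by rewrite expr0n gtn_eqF.
    by rewrite expr0n.
  exists F => // q t t1' tr; apply: le_trans (F2 q t (conj t1' tr)) _.
  by apply: ler_wpM2r; [exact: exprn_ge0|exact: ler_norm].
have dG := @dense_regular_pt rho f.
have eR x v : regular_pt rho f x -> `|v| <= 1 -> exists2 a,
    forall k, `|a k| <= A' * s' ^+ k * (N k / k`!%:R) & expands rho K (ReF f) x v a.
  move=> Gx v1; have [F F1 F2] := expansion x v Gx v1.
  exists (fun k => Re (F k)) => [k|q t t1 tr]; first exact: le_trans (normRe_le _) (F1 k).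
  apply: le_trans (F2 q t t1 tr); rewrite -horner_trunc_Re /ReF -cReB; exact: normRe_le.
have eI x v : regular_pt rho f x -> `|v| <= 1 -> exists2 a,
    forall k, `|a k| <= A' * s' ^+ k * (N k / k`!%:R) & expands rho K (ImF f) x v a.
  move=> Gx v1; have [F F1 F2] := expansion x v Gx v1.
  exists (fun k => Im (F k)) => [k|q t t1 tr]; first exact: le_trans (normIm_le _) (F1 k).
  apply: le_trans (F2 q t t1 tr); rewrite -horner_trunc_Im /ImF.
  have := normIm_le (f (x + t *: v) - (trunc F q).[t%:C]).
  by case: (f _) => a b; case: (_.[_]).
have sR : smooth_on_R (cube rho) (ReF f).
  apply: dbound_smooth; apply: (dbound_of_expansions K0 dG) => [x /cf[]|x v Gx v1] //.
  by have [a _ ea] := eR x v Gx v1; exists a.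
have sI : smooth_on_R (cube rho) (ImF f).
  apply: dbound_smooth; apply: (dbound_of_expansions K0 dG) => [x /cf[]|x v Gx v1] //.
  by have [a _ ea] := eI x v Gx v1; exists a.
exists N => //; exists (8 * s'); first by rewrite mulr_gt0.
split; first by split.
exists (8 * A') => x alpha xr; rewrite nc_normE lecR.
apply: le_trans (nc_le_ReIm _) _ => /=.
have N0' k : 0 <= N k by exact: ltW.
have := Dseq_le (mindex_seq alpha) K0 A'0 (ltW s'0) N0' dG sR xr eR.
have := Dseq_le (mindex_seq alpha) K0 A'0 (ltW s'0) N0' dG sI xr eI.
rewrite size_mindex => h1 h2; apply: le_trans (lerD h2 h1) _.
by apply: le_of_eq; ring.
Qed.

End Roots.

Theorem theorem4p3 (R : realType) (WM : set (nat -> R)) :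
  weight_matrix WM -> R_regular WM -> R_moderate_growth WM ->
  (exists M, WM M /\ (\sum_(1 <= k <oo) ((mu M k)^-1)%:E < +oo)%E) ->
  forall d : nat, (1 <= d)%N -> property_D d WM.
Proof.
move=> HW _ HG _ d d0 f j j0 Hg Hh.
have [rho r0 [M WMM [s s0 [Bg Bh]]]] := germ_pair HW Hg Hh.
have [N WN [t t0 Bf]] := root_class HW HG WMM d0 j0 r0 s0 Bg Bh.
exact: (germ_of_cube WN r0 t0 Bf).
Qed.
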